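(* Let $(M,g)$ be a Lorentzian manifold, $f:M\to\mathbb{R}$ a locally Lipschitz, locally anti-Lipschitz time function, and $d(\cdot,\cdot;f)$ the null distance associated to $f$. Assume there is a constant $b>0$ such that $g(\nabla f,\nabla f)\le -b^2$ at all points where $\nabla f$ exists. Let $(\gamma_i:[0,b_i)\to M)_{i\in\mathbb{N}}$, $b_i\in(0,\infty]$, be a sequence of past directed inextendible continuous causal curves in $M$ such that $\gamma_i(0)\to x$ for some $x\in M$. For each $i$ let $a_i=\lim_{t\to b_i}\big(f(\gamma_i(0))-f(\gamma_i(t))\big)\in(0,\infty]$ and let $s_i:[0,a_i)\to[0,b_i)$ be the change of parameter determined by $f(\gamma_i(s_i(t)))=f(\gamma_i(0))-t$. Let $\gamma:[0,a)\to M$, $a\in(0,\infty]$, be a limit curve of the sequence $(\gamma_i\circ s_i)_i$ with associated subsequence $(\gamma_{i_k}\circ s_{i_k})_k$, that is: $\gamma$ is continuous, $\gamma(0)=x$, $a\le\limsup_k a_{i_k}$, and $(\gamma_{i_k}\circ s_{i_k})_k$ $d(\cdot,\cdot;f)$-converges uniformly on compacta to $\gamma$. Suppose that 1. both sequences $(L(\gamma_{i_k}\circ s_{i_k}))_k$ and $(a_{i_k})_k$ are bounded above, and 2. $\limsup_k a_{i_k}=a$. Then there exists a subsequence $(\gamma_{i_{k_j}})_j$ of $(\gamma_{i_k})_k$ such that $$L(\gamma)\ge\limsup_j L(\gamma_{i_{k_j}}).$$ Moreover, if for all $t\in[0,a)$ we have $L(\gamma|_{[0,t]})=\lim_k L(\gamma_{i_k}\circ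 s_{i_k}|_{[0,t]})$, then $L(\gamma)=\lim_k L(\gamma_{i_k}\circ s_{i_k})$.
   Context: Manifolds are smooth, Hausdorff, paracompact; Lorentzian metrics are smooth with signature $(-,+,\dots,+)$ and $M$ is time-oriented. $\nabla f$ is the $g$-gradient. A continuous curve $\gamma:I\to M$ is future directed causal if each $t\in I$ has a neighbourhood $J\subset I$ and a convex normal neighbourhood $U$ of $\gamma(t)$ with $\gamma(J)\subset U$ such that for all $t_1<t_2$ in $J$, $\gamma(t_1)\ne\gamma(t_2)$ and the geodesic in $U$ from $\gamma(t_1)$ to $\gamma(t_2)$ is future directed causal; past directed is dual. A past directed causal $\gamma:[0,b)\to M$ is inextendible if $\gamma(t)$ has no limit in $M$ as $t\to b$. (Limit curves of causal curves as in the claim are automatically causal.) Every causal curve can be reparametrised to be locally Lipschitz in charts, and then on a compact interval its Lorentzian length is $L(\gamma)=\int\sqrt{-g(\gamma',\gamma')}\,dt$; on an arbitrary interval $I$, $L(\gamma)=\sup\{L(\gamma|_{[u,v]}):u,v\in I,\ u<v\}$. A generalised time function is a function (strictly) increasing along every future directed causal curve; a time function is a continuous one. $f$ is locally Lipschitz if on any compact subset of a chart it is Lipschitz with respect to the Euclidean distance of the chart. $f$ is anti-Lipschitz on an open set $U$ if there is a Riemannian metric $h$ on $U$ such that $f(\gamma(1))-f(\gamma(0))\ge L(\gamma;h)$ ($h$-length) for every future directed causal $\gamma:[0,1]\to U$; it is locally anti-Lipschitz if it is anti-Lipschitz on a neighbourhood of each point. Null distance: an alternating causal curve is a continuous, piecewise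 smooth $\beta:[u,v]\to M$ with a finite partition $u=t_1<\dots<t_k=v$ such that each $\beta|_{[t_i,t_{i+1}]}$ is a smooth future or past directed causal curve; $L(\beta;f)=\sum_{i=1}^{k-1}|f(\beta(t_{i+1}))-f(\beta(t_i))|$; and $d(p,q;f)=\inf\{L(\beta;f):\beta\text{ an alternating causal curve from }p\text{ to }q\}$. Curves $\beta_k:[0,c_k)\to M$ with $\beta_k(0)\to x$ $d$-converge uniformly on compacta to $\gamma:[0,a)\to M$ if $\gamma(0)=x$ and for all $\delta<a$ there is $N_\delta$ such that $k\ge N_\delta$ implies $c_k>\delta$, and $(\beta_k|_{[0,\delta]})_{k\ge N_\delta}$ converges uniformly to $\gamma|_{[0,\delta]}$ with respect to $d$. *)

(* Defs.v *)
From mathcomp Require Import all_boot all_order all_algebra.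
From mathcomp Require Import all_classical all_reals all_analysis.
Set Implicit Arguments.
Unset Strict Implicit.
Unset Printing Implicit Defensive.
Import Order.TTheory GRing.Theory Num.Theory.
Import numFieldNormedType.Exports.
Local Open Scope classical_set_scope.
Local Open Scope ring_scope.

(* Conventions.  The manifold has dimension n.+1.  Tangent vectors are given by
   their components in a chart, as row vectors; the change of components from
   the chart c to the chart c' at p is v |-> v *m J with J the Jacobian of the
   transition map, ['J f y] being such that 'd f y v = v *m 'J f y.
   Curves are total functions R -> M; only their values on the interval that
   accompanies them are meaningful. *)

(** * Smooth maps between normed spaces *)

Fixpoint Ck_on (R : realType) (V W : normedModType R) (k : nat)
    (A : set V) (F : V -> W) : Prop :=
  if k is k'.+1 then
    (forall x, A x -> differentiable F x) /\
    (forall v, Ck_on k' A (fun x => 'D_v F x))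
  else forall x, A x -> {for x, continuous F}.

(* Meant for open A. *)
Definition smooth_on (R : realType) (V W : normedModType R)
    (A : set V) (F : V -> W) : Prop := forall k, Ck_on k A F.

(** * Smooth manifolds *)

Definition paracompact (T : topologicalType) : Prop :=
  forall C : set (set T), (forall A, C A -> open A) ->
    \bigcup_(A in C) A = setT ->
  exists D : set (set T),
    [/\ forall B, D B -> open B,
        \bigcup_(B in D) B = setT,
        forall B, D B -> exists2 A, C A & B `<=` A
      & forall p : T, exists2 N : set T, nbhs p N &
          finite_set [set B | D B /\ B `&` N !=set0]].

Record chart (R : realType) (n : nat) (M : topologicalType) := Chart {
  cdom : set M ;
  cmap :> M -> 'rV[R]_n.+1 ;
  cinv : 'rV[R]_n.+1 -> M ;
  cdom_open : open cdom ;
  cimg_open : open (cmap @` cdom) ;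
  cmapK : forall p, cdom p -> cinv (cmap p) = p ;
  cmap_cont : forall p, cdom p -> {for p, continuous cmap} ;
  cinv_cont : forall y, (cmap @` cdom) y -> {for y, continuous cinv} }.

Definition cimg (R : realType) (n : nat) (M : topologicalType)
  (c : chart R n M) (A : set M) : set 'rV[R]_n.+1 := c @` (cdom c `&` A).

Definition compatible (R : realType) (n : nat) (M : topologicalType)
    (c c' : chart R n M) : Prop :=
  smooth_on (cimg c (cdom c')) (c' \o cinv c) /\
  smooth_on (cimg c' (cdom c)) (c \o cinv c').

(* [chart_at] selects one chart around each point; what is defined below through
   it does not depend on the selection. *)
Record smoothManifold (R : realType) (n : nat) (M : topologicalType) :=
  SmoothManifold {
  atlas : set (chart R n M) ;
  chart_at : M -> chart R n M ;
  manifold_hausdorff : hausdorff_space M ;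
  manifold_paracompact : paracompact M ;
  chart_at_atlas : forall p, atlas (chart_at p) ;
  chart_at_dom : forall p, cdom (chart_at p) p ;
  atlas_compatible : forall c c', atlas c -> atlas c' -> compatible c c' ;
  atlas_maximal : forall c,
    (forall c', atlas c' -> compatible c c') -> atlas c }.

(** * Metrics *)

Definition bform (R : realType) (m : nat) (G : 'M[R]_m) (v w : 'rV[R]_m) : R :=
  (v *m G *m w^T) 0 0.

Definition transition_jacobian (R : realType) (n : nat) (M : topologicalType)
    (c c' : chart R n M) (p : M) : 'M[R]_n.+1 := 'J (c' \o cinv c) (c p).

(* Smooth symmetric (0,2)-tensor fields on an open set U; [h c p] is the matrix
   of components at p in the chart c. *)
Definition sym_tensor_on (R : realType) (n : nat) (M : topologicalType)
    (S : smoothManifold R n M) (U : set M)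
    (h : chart R n M -> M -> 'M[R]_n.+1) : Prop :=
  [/\ forall c p, atlas S c -> cdom c p -> U p -> (h c p)^T = h c p,
      forall c, atlas S c -> smooth_on (cimg c U) (fun y => h c (cinv c y))
    & forall c c' p, atlas S c -> atlas S c' -> cdom c p -> cdom c' p -> U p ->
        h c p = transition_jacobian c c' p *m h c' p
                  *m (transition_jacobian c c' p)^T].

Definition riemannian_on (R : realType) (n : nat) (M : topologicalType)
    (S : smoothManifold R n M) (U : set M)
    (h : chart R n M -> M -> 'M[R]_n.+1) : Prop :=
  sym_tensor_on S U h /\
  forall c p v, atlas S c -> cdom c p -> U p -> v != 0 -> 0 < bform (h c p) v v.

Definition lorentz_signature (R : realType) (n : nat) (G : 'M[R]_n.+1) : Prop :=
  exists2 P, P \in unitmx &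
    P *m G *m P^T = diag_mx (\row_j (if j == ord0 then -1 else 1)).

(* The time orientation is given by a continuous timelike vector field, which is
   future pointing. *)
Record lorentzianManifold (R : realType) (n : nat) (M : topologicalType) :=
  LorentzianManifold {
  smooth_of :> smoothManifold R n M ;
  metric : chart R n M -> M -> 'M[R]_n.+1 ;
  metric_tensor : sym_tensor_on smooth_of setT metric ;
  metric_signature : forall c p, atlas smooth_of c -> cdom c p ->
    lorentz_signature (metric c p) ;
  orientation : chart R n M -> M -> 'rV[R]_n.+1 ;
  orientation_vector : forall c c' p, atlas smooth_of c -> atlas smooth_of c' ->
    cdom c p -> cdom c' p ->
    orientation c' p = orientation c p *m transition_jacobian c c' p ;
  orientation_cont : forall c p, atlas smooth_of c -> cdom c p ->
    {for c p, continuous (fun y => orientation c (cinv c y))} ;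
  orientation_timelike : forall c p, atlas smooth_of c -> cdom c p ->
    bform (metric c p) (orientation c p) (orientation c p) < 0 }.

Section Lorentz.
Context (R : realType) (n : nat) (M : topologicalType).
Implicit Types (g : lorentzianManifold R n M) (c : chart R n M).
Implicit Types (p q : M) (f : M -> R) (I : set R) (sigma beta : R -> M).

(** * Geodesics and convex normal sets *)

Definition partial_coord (F : 'rV[R]_n.+1 -> R) (i : 'I_n.+1)
  (y : 'rV[R]_n.+1) : R := 'D_(delta_mx 0 i) F y.

Definition metric_coord g c (i j : 'I_n.+1) (y : 'rV[R]_n.+1) : R :=
  metric g c (cinv c y) i j.

Definition christoffel g c (k i j : 'I_n.+1) (y : 'rV[R]_n.+1) : R :=
  2^-1 * \sum_l invmx (metric g c (cinv c y)) k l *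
    (partial_coord (metric_coord g c j l) i y
     + partial_coord (metric_coord g c i l) j y
     - partial_coord (metric_coord g c i j) l y).

Definition geodesic_at g sigma (t : R) : Prop :=
  exists c (J : set R),
    [/\ atlas g c, open J, J t, forall s, J s -> cdom c (sigma s)
      & let x : R -> 'rV[R]_n.+1 := c \o sigma in
        smooth_on J x /\
        forall s, J s -> forall k,
          (derive1 (derive1 x) s) 0 k + \sum_i \sum_j christoffel g c k i j (x s) *
                                  (derive1 x s) 0 i * (derive1 x s) 0 j = 0].

(* At the endpoints this asks for an extension of sigma as a geodesic, which
   always exists. *)
Definition geodesic01 g sigma : Prop :=
  forall t, 0 <= t <= 1 -> geodesic_at g sigma t.

(* U is the diffeomorphic image under exp_p of a star-shaped open neighbourhood
   of 0 in T_p M; T_p M is identified with R^(n+1) by some linear isomorphism, so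
   that the inverse of exp_p becomes a chart of the maximal atlas. *)
Definition normal_nbhd g p (U : set M) : Prop :=
  exists c, [/\ atlas g c, cdom c = U, U p, c p = 0
    & forall q, U q ->
        (forall t : R, 0 <= t <= 1 -> (c @` U) (t *: c q)) /\
        geodesic01 g (fun t => cinv c (t *: c q))].

Definition convex_normal g (U : set M) : Prop :=
  open U /\ forall p, U p -> normal_nbhd g p U.

(** * Causal curves *)

Definition future_vector g p (v : 'rV[R]_n.+1) : Prop :=
  let c := chart_at g p in
  [/\ v != 0, bform (metric g c p) v v <= 0
    & bform (metric g c p) (orientation g c p) v < 0].

Definition past_vector g p (v : 'rV[R]_n.+1) : Prop := future_vector g p (- v).

Definition velocity g sigma (t : R) : 'rV[R]_n.+1 :=
  derive1 (chart_at g (sigma t) \o sigma : R -> 'rV[R]_n.+1) t.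

(* Up to the choice of the affine parameter interval [0, 1], there is exactly one
   geodesic in a convex normal U between two points of U. *)
Definition directed_geodesic g (C : M -> 'rV[R]_n.+1 -> Prop) (U : set M) p q :
    Prop :=
  exists sigma, [/\ geodesic01 g sigma, sigma 0 = p, sigma 1 = q
    & forall t, 0 <= t <= 1 -> U (sigma t) /\ C (sigma t) (velocity g sigma t)].

Definition directed_curve g (C : M -> 'rV[R]_n.+1 -> Prop) I beta : Prop :=
  {within I, continuous beta} /\
  forall t, I t -> exists (N : set R) (U : set M),
    [/\ nbhs t N, convex_normal g U, U (beta t),
        forall s, N s -> I s -> U (beta s)
      & forall t1 t2, N t1 -> I t1 -> N t2 -> I t2 -> t1 < t2 ->
          beta t1 <> beta t2 /\ directed_geodesic g C U (beta t1) (beta t2)].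

Definition future_curve g I beta := directed_curve g (future_vector g) I beta.
Definition past_curve g I beta := directed_curve g (past_vector g) I beta.

(* The interval [0, b), for b in (0, +oo]. *)
Definition ray (b : \bar R) : set R := [set t | 0 <= t /\ (t%:E < b)%E].

(* The filter t -> b from below. *)
Definition at_end (b : \bar R) : set_system R :=
  if b is r%:E then r^'- else pinfty_nbhs R.

Definition inextendible (b : \bar R) beta : Prop :=
  ~ exists p, beta @ at_end b --> p.

(** * Lengths *)

Definition enorm (v : 'rV[R]_n.+1) : R := Num.sqrt (\sum_i v 0 i ^+ 2).

Definition lipschitz_curve g I beta : Prop :=
  forall t, I t -> exists c (N : set R) (K : R),
    [/\ atlas g c, nbhs t N, forall s, N s -> I s -> cdom c (beta s)
      & forall s s', N s -> I s -> N s' -> I s' ->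
          enorm (c (beta s) - c (beta s')) <= K * `|s - s'|].

(* The square root of Q(beta', beta'), set to 0 on the null set where beta' does
   not exist. *)
Definition speed g (Q : chart R n M -> M -> 'M[R]_n.+1) beta (t : R) : R :=
  let c := chart_at g (beta t) in
  if `[< derivable (c \o beta : R -> 'rV[R]_n.+1) t 1 >]
  then Num.sqrt (bform (Q c (beta t)) (velocity g beta t) (velocity g beta t))
  else 0.

Definition reparam (phi : R -> R) (u' v' u v : R) : Prop :=
  [/\ u' <= v', phi u' = u, phi v' = v, {within `[u', v'], continuous phi}
    & {in `[u', v'] &, {homo phi : s t / s < t}}].

(* Length on the compact interval [u, v], computed after a reparametrisation that
   is locally Lipschitz in charts.  The integral does not depend on the
   reparametrisation, so the supremum is only a way to name its value. *)
Definition qlength g (Q : chart R n M -> M -> 'M[R]_n.+1) beta (u v : R) :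
    \bar R :=
  ereal_sup [set l | exists (phi : R -> R) (u' v' : R),
    [/\ reparam phi u' v' u v, lipschitz_curve g `[u', v'] (beta \o phi)
      & l = (\int[lebesgue_measure]_(t in `[u', v'])
               (speed g Q (beta \o phi) t)%:E)%E]].

Definition lorentz_length g beta (u v : R) : \bar R :=
  qlength g (fun c p => - metric g c p) beta u v.

Definition lorentz_length_on g I beta : \bar R :=
  ereal_sup [set l | exists u v, [/\ I u, I v, u < v
                                   & l = lorentz_length g beta u v]].

(** * Time functions *)

Definition time_function g f : Prop :=
  continuous f /\
  forall I beta, is_interval I -> future_curve g I beta ->
    forall s t, I s -> I t -> s < t -> f (beta s) < f (beta t).

Definition locally_lipschitz g f : Prop :=
  forall c (K : set M), atlas g c -> K `<=` cdom c -> compact K ->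
    exists L : R, forall p q, K p -> K q -> `|f p - f q| <= L * enorm (c p - c q).

Definition anti_lipschitz_on g (U : set M) f : Prop :=
  exists2 h, riemannian_on g U h &
    forall beta, future_curve g `[0, 1] beta ->
      (forall t, 0 <= t <= 1 -> U (beta t)) ->
      (qlength g h beta 0 1 <= (f (beta 1) - f (beta 0))%:E)%E.

Definition locally_anti_lipschitz g f : Prop :=
  forall p, exists U, [/\ open U, U p & anti_lipschitz_on g U f].

(* The gradient exists at p when f is differentiable at p. *)
Definition has_gradient g f p : Prop :=
  differentiable (f \o cinv (chart_at g p) : 'rV[R]_n.+1 -> R)
    (chart_at g p p).

Definition gradient g f p : 'rV[R]_n.+1 :=
  let c := chart_at g p in
  (\row_i partial_coord (f \o cinv c) i (c p)) *m invmx (metric g c p).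

(** * Null distance *)

Definition smooth_curve g I beta : Prop :=
  forall t, I t -> exists c (J : set R) (F : R -> 'rV[R]_n.+1),
    [/\ atlas g c, open J, J t, smooth_on J F
      & forall s, J s -> I s -> cdom c (beta s) /\ c (beta s) = F s].

(* The breakpoints are tau 0 < ... < tau k. *)
Definition alternating g beta (k : nat) (tau : nat -> R) : Prop :=
  {within `[tau 0%N, tau k], continuous beta} /\
  forall i, (i < k)%N ->
    [/\ tau i < tau i.+1, smooth_curve g `[tau i, tau i.+1] beta
      & future_curve g `[tau i, tau i.+1] beta \/
        past_curve g `[tau i, tau i.+1] beta].

Definition null_length f beta (k : nat) (tau : nat -> R) : R :=
  \sum_(i < k) `|f (beta (tau i.+1)) - f (beta (tau i))|.

(* +oo if no alternating causal curve joins p to q. *)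
Definition null_distance g f p q : \bar R :=
  ereal_inf [set l | exists beta k tau,
    [/\ alternating g beta k tau, beta (tau 0%N) = p, beta (tau k) = q
      & l = (null_length f beta k tau)%:E]].

Definition converges_uniformly_on_compacta (d : M -> M -> \bar R)
    (beta : nat -> R -> M) (b : nat -> \bar R) (x : M)
    (gamma : R -> M) (a : \bar R) : Prop :=
  [/\ (fun k => beta k 0) @ \oo --> x, gamma 0 = x
    & forall delta : R, 0 <= delta -> (delta%:E < a)%E ->
        (\forall k \near \oo, (delta%:E < b k)%E) /\
        (forall eps : R, 0 < eps -> \forall k \near \oo,
           forall t, 0 <= t <= delta -> (d (beta k t) (gamma t) < eps%:E)%E)].

End Lorentz.

(* Main.v *)
(* Near a point, the cones of g lie between those of two constant Lorentz forms,
   which differ by a factor 1 + O(e).  The anti-Lipschitz property and a trapping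
   argument bound chart distances by the null distance, and show that causal
   curves parametrised by -f are uniformly Lipschitz in charts.  So the limit
   curve is Lipschitz, with increments in the constant cones, and is the limit in
   charts.  The reverse triangle inequality bounds the length of the approximating
   curves by that of inscribed polygons; these converge, and almost everywhere
   differentiability of the limit curve makes their lengths approach its length:
   on compact intervals the length is upper semicontinuous.

   It remains to control the ends of the curves.  By Rademacher's theorem and the
   reverse Cauchy-Schwarz inequality, the bound on the gradient gives
   f(y + v) - f(y) >= b sqrt(-g(v,v)) to first order for v future timelike, so
   curves parametrised by -f have speed at most 1 / b.  Hence the part of a curve beyond
   the parameter t has length at most (a_k - t) / b, and limsup a_k = a.  No
   further subsequence is needed. *)
Require Import Defs.
From HB Require Import structures.
From mathcomp Require Import all_boot all_order all_algebra.
From mathcomp Require Import all_classical all_reals all_analysis.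
From mathcomp Require Import measurable_realfun ring lra.
Import Order.TTheory GRing.Theory Num.Theory.
Import numFieldNormedType.Exports.
Local Open Scope classical_set_scope.
Local Open Scope ring_scope.
Set Implicit Arguments.
Unset Strict Implicit.
Unset Printing Implicit Defensive.

(** Lengths are suprema, over Lipschitz reparametrisations, of integrals of speeds whose
    measurability is not established. The integral of a nonnegative function is therefore used as a
    supremum over simple functions below it: this is monotone, blind to null sets and additive on
    intervals, and the needed Fatou-type bounds are proved in that setting. An upper bound for a
    length has to hold for every reparametrisation; hence speeds are compared with derivatives of
    monotone functions, whose increments depend only on the endpoints. A lower bound needs a single
    reparametrisation. Rademacher's theorem is reduced to lines: differentiability there comes from
    Radon-Nikodym, additivity of directional derivatives from translation invariance of the
    integral. The future cones of the constant forms are self-dual, so cone membership of increments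
    and derivatives is tested by scalar pairings. Since the curves are past directed, it is the
    earlier point minus the later one that lies in the future cone. *)

Lemma ae_imply (R : realType) (P Q : R -> Prop) : (forall x, P x -> Q x) ->
  {ae lebesgue_measure, forall x, P x} -> {ae lebesgue_measure, forall x, Q x}.
Proof.
by move=> PQ; apply: filterS; first exact: (ae_filter_ringOfSetsType lebesgue_measure).
Qed.

(** * Differentiability almost everywhere of Lipschitz functions of one variable *)

Lemma lebesgue_stieltjes_dominated (R : realType) (F : cumulative R R) (C : R) :
  (forall x y, x <= y -> F y - F x <= C * (y - x)) ->
  lebesgue_stieltjes_measure F `<< lebesgue_measure.
Proof.
move=> FC; have C0 : 0 <= C.
  have := FC 0 1 ler01; rewrite subr0 mulr1; apply: le_trans.
  by rewrite subr_ge0; apply: cumulative_is_nondecreasing; exact: ler01.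
have wlC A : measurable (A : set (ocitv_type R)) ->
    (wlength F A <= C%:E * wlength idfun A)%E.
  rewrite /measurable/= => /ocitvP[->|[[x y]/= xy ->]].
    by rewrite !wlength0 mule0.
  by rewrite !wlength_itv/= lte_fin xy -!EFinB -EFinM lee_fin FC// ltW.
have wl_ge0 (G : cumulative R R) A : (0 <= wlength G A)%E by exact: wlength_ge0.
apply/null_content_dominatesP => A mA A0.
apply/eqP; rewrite eq_le measure_ge0 andbT; apply/lee_addgt0Pr => e e0.
rewrite add0e.
(* A cover of the null set by half-open intervals of total length below [e / (C + 1)] has Stieltjes
   measure at most [e]; the [+ 1] allows [C = 0]. *)
have eC : (0 < (e / (C + 1))%:E)%E by rewrite lte_fin divr_gt0// ltr_wpDl.
have : (lebesgue_measure A < (e / (C + 1))%:E)%E by rewrite A0.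
rewrite /lebesgue_measure /lebesgue_stieltjes_measure /measure_extension /mu_ext.
move=> /ereal_inf_lt[_ [/= I [mI AI] <-]] sI.
apply: (@le_trans _ _ (\sum_(k <oo) wlength F (I k))%E).
  by apply: ereal_inf_lbound; exists I.
apply: (@le_trans _ _ (\sum_(k <oo) C%:E * wlength idfun (I k))%E).
  by apply: lee_nneseries => // k _; exact: wlC.
rewrite nneseriesZl//.
apply: (@le_trans _ _ (C%:E * (e / (C + 1))%:E)%E).
  by rewrite lee_wpmul2l ?lee_fin// ltW.
rewrite -EFinM lee_fin mulrA ler_pdivrMr ?ltr_wpDl// mulrC ler_pM2l//; lra.
Qed.

Section lipschitz_ae.
Context (R : realType) (phi : R -> R) (K a b : R).
Hypothesis phi_lip : forall s t, `|phi s - phi t| <= K * `|s - t|.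
Hypothesis ab : a < b.

(** Adding [(K + 1) * x] makes [phi] increasing, and [K + 1] rather than [K] keeps the total
    increase [T] positive. Truncated to [[a, b]] and divided by [T], the sum becomes the
    distribution function [F] of a probability measure. *)
Let clip (x : R) : R := Num.min b (Num.max a x).
Let T : R := (K + 1) * (b - a) + phi b - phi a.
Let F (x : R) : R := ((K + 1) * (clip x - a) + (phi (clip x) - phi a)) / T.

Let K_ge0 : 0 <= K.
Proof.
have := phi_lip 1 0; rewrite subr0 normr1 mulr1; exact: le_trans.
Qed.

Let T_gt0 : 0 < T.
Proof.
have := phi_lip a b; rewrite [`|a - b|]ltr0_norm ?subr_lt0// ler_norml => /andP[_].
by rewrite /T; move: ab; nra.
Qed.

Let clip_nd x y : x <= y -> clip x <= clip y.
Proof. by move=> xy; rewrite /clip !minElt !maxElt; do !case: ifPn; rewrite -?leNgt; lra. Qed.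

Let clip_lip x y : x <= y -> clip y - clip x <= y - x.
Proof.
move=> xy; rewrite /clip !minElt !maxElt; do !case: ifPn; rewrite -?leNgt; lra.
Qed.

Let F_incr x y : x <= y -> 0 <= F y - F x <= ((K + K + 1) / T) * (y - x).
Proof.
move=> xy; rewrite [_ / T * _]mulrAC.
have -> : F y - F x =
    ((K + 1) * (clip y - clip x) + (phi (clip y) - phi (clip x))) / T.
  by rewrite /F -mulrBl; congr (_ / _); ring.
have H1 := clip_nd xy; have H2 := clip_lip xy.
have := phi_lip (clip y) (clip x); rewrite [`|clip y - clip x|]ger0_norm ?subr_ge0//.
rewrite ler_norml => /andP[H3 H4]; apply/andP; split.
  by rewrite divr_ge0 ?(ltW T_gt0)//; nra.
rewrite ler_pM2r ?invr_gt0//; have := ler_wpM2l K_ge0 H2; lra.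
Qed.

Let F_nd : nondecreasing F.
Proof. by move=> x y xy; rewrite -subr_ge0; case/andP: (F_incr xy). Qed.

Let F_cont : continuous F.
Proof.
have C0 : 0 < (K + K + 1) / T by rewrite divr_gt0// ltr_wpDl// addr_ge0.
move=> x; apply/(@cvgrPdist_le _ R^o) => e e0; near=> y.
have : `|F x - F y| <= ((K + K + 1) / T) * `|x - y|.
  have [xy|/ltW xy] := leP x y; have /andP[H1 H2] := F_incr xy.
    by rewrite distrC (distrC x) !ger0_norm ?subr_ge0 // -subr_ge0.
  by rewrite !ger0_norm ?subr_ge0 // -subr_ge0.
move=> /le_trans; apply; rewrite -ler_pdivlMl//.
near: y; apply: (@cvgr_dist_le _ R^o _ _ _ id) => //.
by rewrite mulr_gt0// invr_gt0.
Unshelve. all: end_near. Qed.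

Let F_left x : x <= a -> F x = 0.
Proof.
move=> xa; have -> : F x = F a.
  by rewrite /F /clip (max_idPl xa) maxxx.
by rewrite /F /clip maxxx (min_idPr (ltW ab)) !subrr mulr0 addr0 mul0r.
Qed.

Let F_right x : b <= x -> F x = 1.
Proof.
move=> bx; rewrite /F /clip (max_idPr _) ?(le_trans (ltW ab))//.
by rewrite (min_idPl bx) addrA divff// gt_eqF.
Qed.

HB.instance Definition _ := isCumulative.Build R _ R F F_nd
  (right_continuousW F_cont).

Let F_Ny : F @ -oo --> (0 : R).
Proof.
apply: (@cvg_near_cst _ R^o); near=> x; apply: F_left; near: x.
by apply: nbhs_ninfty_le; rewrite num_real.
Unshelve. all: end_near. Qed.

Let F_y : F @ +oo --> (1 : R).
Proof.
apply: (@cvg_near_cst _ R^o); near=> x; apply: F_right; near: x.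
by apply: nbhs_pinfty_ge; rewrite num_real.
Unshelve. all: end_near. Qed.

HB.instance Definition _ := isCumulativeBounded.Build R 0 1 F F_Ny F_y.

(** The Stieltjes measure of [F] is absolutely continuous, so [F] is the indefinite integral of its
    Radon-Nikodym density and is differentiable almost everywhere. On []a, b[], [phi] differs from a
    multiple of [F] by an affine function. *)
Lemma lipschitz_ae_derivable_itv :
  {ae lebesgue_measure, forall x, a < x < b -> derivable phi x 1}.
Proof.
have dom : lebesgue_stieltjes_measure F `<< lebesgue_measure.
  by apply: (@lebesgue_stieltjes_dominated _ _ ((K + K + 1) / T)) => x y /F_incr /andP[].
have [p [p_ge0 p_fin p_int pE]] : exists p : R -> \bar R,
    [/\ forall x, (0 <= p x)%E, forall x, p x \is a fin_num,
      lebesgue_measure.-integrable [set: R] p &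
      forall A : set R, measurable A ->
        lebesgue_stieltjes_measure F A = (\int[lebesgue_measure]_(x in A) p x)%E] :=
  @radon_nikodym_sigma_finite _ _ R lebesgue_measure
    (lebesgue_stieltjes_measure F : {finite_measure set _ -> \bar R}) dom.
pose q x := fine (p x).
have qE : EFin \o q = p by apply/funext => x; rewrite /= /q fineK.
have qint : lebesgue_measure.-integrable [set: R] (EFin \o q) by rewrite qE.
have qitv y : lebesgue_measure.-integrable
    [set` Interval (BRight a) (BRight y)] (EFin \o q).
  apply: (@integrableS _ _ R lebesgue_measure [set: R]) => //.
have qloc : locally_integrable [set: R] q.
  by apply: open_integrable_locally => //; exact: openT.
have := FTC1 qitv qloc; apply: ae_imply => x qx /andP[ax xb].
have /qx[+ _] : (BRight a < BRight x)%O by rewrite bnd_simp.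
move=> dG.
have GF y : a < y ->
    (\int[lebesgue_measure]_(t in [set` Interval (BRight a) (BRight y)]) q t)%R
    = F y.
  move=> ay; rewrite /Rintegral.
  have -> : (\int[lebesgue_measure]_(t in `]a, y]) (q t)%:E)%E =
      lebesgue_stieltjes_measure F `]a, y].
    by rewrite pE ?qE//; apply: eq_integral => t _; rewrite -qE.
  rewrite /lebesgue_stieltjes_measure /measure_extension measurable_mu_extE/=;
    last exact: is_ocitv.
  by rewrite wlength_itv_bnd ?(ltW ay)//= (F_left (lexx a)) subr0.
have dF : derivable F x 1.
  apply: (near_eq_derivable _ dG).
  by near=> y; apply: GF; near: y; exact: lt_nbhsr.
have dT : derivable (T *: F - (K + 1) *: (id - cst a) + cst (phi a) : R -> R) x 1.
  apply: derivableD; last exact: derivable_cst.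
  apply: derivableB; first exact: derivableZ.
  apply: derivableZ; apply: derivableB; first exact: derivable_id.
  exact: derivable_cst.
apply: (near_eq_derivable _ dT).
near=> y.
have ay : a < y by near: y; exact: lt_nbhsr.
have yb : y < b by near: y; exact: lt_nbhsl.
have clipE : clip y = y.
  by rewrite /clip (max_idPr (ltW ay)) (min_idPr (ltW yb)).
change (T * F y - (K + 1) * (y - a) + phi a = phi y).
by rewrite /F clipE mulrC divfK ?gt_eqF//; ring.
Unshelve. all: end_near. Qed.

End lipschitz_ae.

Lemma lipschitz_ae_derivable (R : realType) (phi : R -> R) (K : R) :
  (forall s t, `|phi s - phi t| <= K * `|s - t|) ->
  {ae lebesgue_measure, forall x, derivable phi x 1}.
Proof.
move=> phi_lip.
have : {ae lebesgue_measure, forall x, forall k : nat,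
    - k.+1%:R < x < k.+1%:R -> derivable phi x 1}.
  apply/ae_foralln => k; apply: lipschitz_ae_derivable_itv phi_lip _.
  by rewrite (@lt_trans _ _ 0)// ?oppr_lt0 ltr0n.
apply: ae_imply => x H; apply: (H (Num.truncn `|x|)).
by rewrite -ltr_norml truncnS_gt.
Qed.

(** * Integrals of nonnegative functions without measurability *)

Section lower_integral.
Context d (T : measurableType d) (R : realType).
Variable mu : {measure set T -> \bar R}.
Implicit Types (D : set T) (f g : T -> \bar R).
Import HBNNSimple.
Local Open Scope ereal_scope.

(** No measurability is required: simple functions below [f] are also below [g]. *)
Lemma ge0_le_integral_fun D f g : (forall x, D x -> 0 <= f x) ->
  (forall x, D x -> f x <= g x) ->
  \int[mu]_(x in D) f x <= \int[mu]_(x in D) g x.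
Proof.
move=> f0 fg.
have g0 x : D x -> 0 <= g x by move=> Dx; exact: le_trans (f0 _ Dx) (fg _ Dx).
rewrite !ge0_integralE//; apply: ereal_sup_le => _ [h /= hf <-]; exists h => // x.
apply: le_trans (hf x) _; rewrite !patchE; case: ifPn => // /set_mem; exact: fg.
Qed.

(* For f >= 0 the integral is a supremum over simple functions below f, hence it
   is attained by a measurable minorant even when f is not measurable. *)
Lemma ge0_integral_minorant D f : measurable D -> (forall x, 0 <= f x) ->
  exists f0 : T -> \bar R, [/\ measurable_fun [set: T] f0,
    forall x, 0 <= f0 x, forall x, D x -> f0 x <= f x &
    \int[mu]_(x in D) f0 x = \int[mu]_(x in D) f x].
Proof.
move=> mD f0.
have f0D x : D x -> 0 <= f x by [].
set S := [set sintegral mu h | h in [set h : {nnsfun T >-> R} |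
  forall x, (h x)%:E <= (f \_ D) x]].
have SE : \int[mu]_(x in D) f x = ereal_sup S by rewrite ge0_integralE.
have S0 : S !=set0.
  exists (sintegral mu (@nnsfun0 _ T R)); exists nnsfun0 => // x /=.
  by rewrite patchE; case: ifPn.
have /ereal_sup_seq[u Su ucvg] : S != set0 by apply/set0P.
pose h n : {nnsfun T >-> R} := sval (cid2 (Su n)).
have hf n x : (h n x)%:E <= (f \_ D) x by rewrite /h; case: cid2.
have hu n : sintegral mu (h n) = u n by rewrite /h; case: cid2.
pose f1 (x : T) : \bar R := ereal_sup (range (fun n => (h n x)%:E)).
have f1E x : f1 x = esups (fun n => (h n x)%:E) 0%N.
  by rewrite /f1 /esups/=; congr ereal_sup; apply/seteqP; split => _ [n _ <-]; exists n.
have h1 n x : (h n x)%:E <= f1 x by apply: ereal_sup_ubound; exists n.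
have mf1 : measurable_fun [set: T] f1.
  rewrite (_ : f1 = (fun x => esups (fun n => (h n x)%:E) 0%N)).
    by apply: measurable_fun_esups => n; exact/measurable_EFinP.
  by apply/funext => x; rewrite f1E.
have f1D x : f1 x <= (f \_ D) x by apply: ge_ereal_sup => _ [n _ <-].
have f10 x : (0%:E <= f1 x)%E.
  have := h1 0%N x; apply: le_trans; rewrite lee_fin; exact: fun_ge0.
exists f1; split => //.
  by move=> x Dx; apply: le_trans (f1D x) _; rewrite patchE mem_set.
apply/eqP; rewrite eq_le; apply/andP; split.
  apply: ge0_le_integral_fun => // x Dx; apply: le_trans (f1D x) _.
  by rewrite patchE mem_set.
rewrite SE -(cvg_lim _ ucvg)//; apply: lime_le; first by apply/cvg_ex; exists (ereal_sup S).
apply: nearW => n; rewrite -hu -integralT_nnsfun [leRHS]integral_mkcond.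
apply: ge0_le_integral_fun => x _; first by rewrite lee_fin.
rewrite patchE; case: ifPn => xD; first exact: h1.
by apply: le_trans (hf n x) _; rewrite patchE (negbTE xD).
Qed.

(** A measurable minorant of [f] with the same integral can be restricted to the complement of the
    exceptional null set, where the inequality holds at every point. *)
Lemma ae_ge0_le_integral_fun D f g : measurable D -> (forall x, 0 <= f x) ->
  (forall x, 0 <= g x) -> {ae mu, forall x, D x -> f x <= g x} ->
  \int[mu]_(x in D) f x <= \int[mu]_(x in D) g x.
Proof.
move=> mD f0 g0 [N [mN N0 fgN]].
have [h [mh h0 hf <-]] := ge0_integral_minorant mD f0.
rewrite (ge0_negligible_integral mN mD (measurable_funTS mh) (fun x _ => h0 x) N0).
rewrite integral_mkcond [leRHS]integral_mkcond.
apply: ge0_le_integral_fun => x _; rewrite !patchE; first by case: ifPn.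
case: ifPn => [/set_mem [Dx Nx]|_]; last by case: ifPn.
rewrite mem_set//; apply: le_trans (hf _ Dx) _.
by apply: contra_notP Nx => fg; apply: fgN => /(_ Dx).
Qed.
End lower_integral.

Section interval_integral.
Context (R : realType).
Implicit Types (f : R -> \bar R) (u v w : R).
Local Open Scope ereal_scope.
Local Notation leb := (@lebesgue_measure R).

Let split_measurable f u w v : (u <= w)%R -> (w <= v)%R ->
  measurable_fun [set: R] f -> (forall x, 0 <= f x) ->
  \int[leb]_(x in `[u, v]) f x =
    \int[leb]_(x in `[u, w]) f x + \int[leb]_(x in `[w, v]) f x.
Proof.
move=> uw wv mf f0.
rewrite (@itv_bndbnd_setU _ _ (BLeft u) (BLeft w) (BRight v)) ?bnd_simp//.
rewrite ge0_integral_setU//; last 2 first.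
- exact: measurable_funTS.
- apply/disj_setPS => x [/=]; rewrite !in_itv/= => /andP[_ xw] /andP[wx _].
  by move: xw; rewrite ltNge wx.
by rewrite -integral_itv_bndo_bndc//; exact: measurable_funTS.
Qed.

(** Both inequalities pass through measurable minorants: one on [[u, v]] restricts to the two parts,
    and two on the parts glue to a measurable function below [f]. *)
Lemma ge0_integral_itv_split f u w v : (u <= w)%R -> (w <= v)%R ->
  (forall x, 0 <= f x) ->
  \int[leb]_(x in `[u, v]) f x =
    \int[leb]_(x in `[u, w]) f x + \int[leb]_(x in `[w, v]) f x.
Proof.
move=> uw wv f0; apply/eqP; rewrite eq_le; apply/andP; split.
  have [h [mh h0 hf <-]] := ge0_integral_minorant leb (measurable_itv `[u, v]) f0.
  rewrite (split_measurable uw wv)//; apply: leeD;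
    apply: ge0_le_integral_fun => // x /=; rewrite in_itv/= => /andP[x1 x2];
    apply: hf => /=; rewrite in_itv/=.
  + by rewrite x1 (le_trans x2).
  + by rewrite x2 (le_trans uw).
have [h1 [mh1 h10 hf1 <-]] := ge0_integral_minorant leb (measurable_itv `[u, w]) f0.
have [h2 [mh2 h20 hf2 <-]] := ge0_integral_minorant leb (measurable_itv `[w, v]) f0.
(* The point [w] is given to the right part; being null, it does not affect the left integral. *)
pose h x := (h1 \_ `]-oo, w[) x + (h2 \_ `[w, +oo[) x.
have h0 x : 0 <= h x.
  by rewrite /h !patchE; apply: adde_ge0; case: ifPn.
have hl x : (x < w)%R -> h x = h1 x.
  move=> xw; rewrite /h !patchE mem_set/= ?in_itv//=.
  by rewrite memNset ?adde0//= in_itv/= andbT; apply/negP; rewrite -ltNge.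
have hr x : (w <= x)%R -> h x = h2 x.
  move=> wx; rewrite /h !patchE memNset/= ?in_itv//=; last by apply/negP; rewrite -leNgt.
  by rewrite mem_set ?add0e//= in_itv/= andbT.
have mh : measurable_fun [set: R] h.
  by apply: emeasurable_funD; apply/(measurable_restrictT _ (measurable_itv _));
    exact: measurable_funTS.
apply: (@le_trans _ _ (\int[leb]_(x in `[u, v]) h x)); last first.
  apply: ge0_le_integral_fun => // x /=; rewrite in_itv/= => /andP[x1 x2].
  have [xw|wx] := ltP x w.
    by rewrite hl//; apply: hf1; rewrite /= in_itv/= x1 ltW.
  by rewrite hr//; apply: hf2; rewrite /= in_itv/= x2 wx.
rewrite (split_measurable uw wv)//; apply: leeD; last first.
  apply: ge0_le_integral_fun => // x /=; rewrite in_itv/= => /andP[x1 _].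
  by rewrite hr.
rewrite -!integral_itv_bndo_bndc; try exact: measurable_funTS.
apply: ge0_le_integral_fun => // x /=; rewrite in_itv/= => /andP[_ x1].
by rewrite hl.
Qed.

End interval_integral.

(** * Continuity induction on intervals *)

Section real_induction.
Context (R : realType).
Implicit Types (a b t : R).

(** The supremum of the points up to which [P] holds throughout has the property itself, by the
    limit clause, and the other clause would push it further if it were below [b]. *)
Lemma real_induction (P : R -> Prop) a b : a <= b -> P a ->
  (forall t, a <= t -> t < b -> P t ->
    exists2 d, 0 < d & forall s, t < s -> s < t + d -> s <= b -> P s) ->
  (forall t, a < t -> t <= b -> (forall s, a <= s -> s < t -> P s) -> P t) ->
  P b.
Proof.
move=> ab Pa step limit.
pose S := [set t | a <= t <= b /\ forall s, a <= s <= t -> P s].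
have Sa : S a.
  by split=> [|s]; [rewrite lexx ab|rewrite -eq_le => /eqP <-].
have Sub : ubound S b by move=> t [/andP[]].
have supS : has_sup S by split; [exists a|exists b].
set m := sup S.
have am : a <= m by apply: ub_le_sup => //; exists b.
have mb : m <= b by apply: ge_sup => //; exists a.
have Plt s : a <= s -> s < m -> P s.
  move=> as_ sm; have [t [_ Pt] st] := sup_gt (ex_intro _ a Sa) sm.
  by apply: Pt; rewrite as_ ltW.
have Pm : P m.
  move: am; rewrite le_eqVlt => /predU1P[<-//|am].
  exact: limit.
move: mb; rewrite le_eqVlt => /predU1P[<-//|mb].
have [d d0 Pd] := step _ am mb Pm.
pose t := Num.min b (m + d / 2).
have mt : m < t by rewrite lt_min mb ltrDl divr_gt0.
have tb : t <= b by rewrite ge_min lexx.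
have td : t < m + d.
  by rewrite gt_min ltrD2l ltr_pdivrMr// ltr_pMr// ltrDl ltr01 orbT.
have : S t.
  split; first by rewrite (le_trans am (ltW mt)).
  move=> s /andP[as_ st]; have [sm|] := ltP s m; first exact: Plt.
  rewrite le_eqVlt => /predU1P[<-//|ms].
  by apply: Pd => //; [exact: le_lt_trans st td|exact: le_trans st tb].
move=> St; suff : t <= m by rewrite leNgt mt.
by apply: ub_le_sup => //; exists b.
Qed.

(** Compactness of [[a, b]] in the form of Cousin's lemma. It globalises the local estimates below
    that add up along intervals: monotonicity, cone membership and length bounds. *)
Lemma interval_patch (Q : R -> R -> Prop) a b : a < b ->
  (forall u w v, a <= u -> u < w -> w < v -> v <= b -> Q u w -> Q w v -> Q u v) ->
  (forall t, a <= t -> t <= b -> exists2 d, 0 < d & forall u v,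
     a <= u -> u < v -> v <= b -> t - d < u -> v < t + d -> Q u v) ->
  Q a b.
Proof.
move=> ab tr loc.
suff [/eqP|//] : b = a \/ Q a b by rewrite gt_eqF.
apply: (@real_induction (fun t => t = a \/ Q a t) a b); first exact: ltW.
- by left.
- move=> t at_ tb Pt; have [d d0 Qd] := loc _ at_ (ltW tb).
  exists d => // s ts std sb; right.
  have Qts : Q t s by apply: Qd => //; rewrite ltrBlDr ltrDl.
  by case: Pt Qts at_ => [->//|Qat Qts]; rewrite le_eqVlt => /predU1P[->//|at_]; apply: tr Qat Qts.
- move=> t at_ tb Ps; have [d d0 Qd] := loc _ (ltW at_) tb; right.
  pose s := Num.max a (t - d / 2).
  have as_ : a <= s by rewrite le_max lexx.
  have st : s < t by rewrite gt_max at_ ltrBlDr ltrDl divr_gt0.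
  have Qst : Q s t.
    apply: Qd => //; last by rewrite ltrDl.
    by rewrite lt_max ltrD2l ltrN2 ltr_pdivrMr// ltr_pMr// ltrDl ltr01 orbT.
  have [sa|Qas] := Ps _ as_ st; first by rewrite -sa.
  move: as_; rewrite le_eqVlt => /predU1P[->//|as_].
  exact: tr Qas Qst.
Qed.

End real_induction.

(** * Step functions on uniform grids *)

Section step_functions.
Context (R : realType).
Implicit Types (u v t : R) (K j : nat) (c : nat -> R).
Local Notation leb := (@lebesgue_measure R).

Definition grid_point u v K j : R := u + (v - u) * j%:R / K%:R.

(** The cells are half-open, so the value at [v] is the default [0]; evaluations are made on [[u,
    v[]. *)
Definition step_fun u v K c t : R :=
  \sum_(j < K) c j * \1_(`[grid_point u v K j, grid_point u v K j.+1[%classic) t.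

Lemma grid_point0 u v K : grid_point u v K 0 = u.
Proof. by rewrite /grid_point mulr0 mul0r addr0. Qed.

Lemma grid_point_last u v K : (0 < K)%N -> grid_point u v K K = v.
Proof. by move=> K0; rewrite /grid_point mulfK ?pnatr_eq0 -?lt0n// addrC subrK. Qed.

Lemma grid_pointS u v K j :
  grid_point u v K j.+1 = grid_point u v K j + (v - u) / K%:R.
Proof. by rewrite /grid_point -natr1 mulrDr mulr1 mulrDl addrA. Qed.

Lemma le_grid_point u v K i j : u <= v -> (i <= j)%N ->
  grid_point u v K i <= grid_point u v K j.
Proof.
move=> uv ij; rewrite /grid_point lerD2l ler_wpM2r ?invr_ge0//.
by rewrite ler_wpM2l ?subr_ge0// ler_nat.
Qed.

Lemma grid_point_itv u v K j : u <= v -> (0 < K)%N -> (j <= K)%N ->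
  u <= grid_point u v K j <= v.
Proof.
move=> uv K0 jK; rewrite -{1}(grid_point0 u v K) le_grid_point//=.
by rewrite -{2}(grid_point_last u v K0) le_grid_point.
Qed.

Lemma step_funE u v K c t j : u <= v -> (j < K)%N ->
  grid_point u v K j <= t < grid_point u v K j.+1 -> step_fun u v K c t = c j.
Proof.
move=> uv jK tj; rewrite /step_fun (bigD1 (Ordinal jK))//= big1 ?addr0.
  by rewrite indicE mem_set ?mulr1//= in_itv.
move=> i ij; rewrite indicE memNset ?mulr0//= in_itv/= => /andP[it ti].
move/andP: tj => [jt tj].
have [lt_ij|lt_ji|e_ij] := ltngtP i j.
- by have := lt_le_trans ti (le_trans (le_grid_point K uv lt_ij) jt); rewrite ltxx.
- by have := lt_le_trans tj (le_trans (le_grid_point K uv lt_ji) it); rewrite ltxx.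
- by move/eqP: ij; apply; apply: val_inj.
Qed.

Lemma grid_cell u v K t : (0 < K)%N -> u <= t < v ->
  exists2 j, (j < K)%N & grid_point u v K j <= t < grid_point u v K j.+1.
Proof.
move=> K0 /andP[ut tv].
have exj : exists j, (t < grid_point u v K j.+1) && (j < K)%N.
  by exists K.-1; rewrite prednK// grid_point_last// tv leqnn.
have [j /andP[tj jK] minj] := ex_minnP exj; exists j => //; rewrite tj andbT.
case: j jK tj minj => [|j] jK tj minj; first by rewrite grid_point0.
rewrite leNgt; apply/negP => tj'.
by have := minj j; rewrite tj' (ltnW jK) ltnn => /(_ isT).
Qed.

Lemma measurable_step_fun u v K c (D : set R) : measurable_fun D (step_fun u v K c).
Proof.
apply: measurable_funTS; rewrite /step_fun; apply: measurable_sum => j.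
exact: measurable_funM.
Qed.

Lemma step_fun_ge0 u v K c t : (forall j, (j < K)%N -> 0 <= c j) ->
  0 <= step_fun u v K c t.
Proof.
by move=> c0; apply: sumr_ge0 => j _; rewrite mulr_ge0// c0.
Qed.

Lemma integral_step_fun u v K c : u <= v -> (0 < K)%N ->
  (forall j, (j < K)%N -> 0 <= c j) ->
  (\int[leb]_(t in `[u, v]) (step_fun u v K c t)%:E =
    (\sum_(j < K) c j * ((v - u) / K%:R))%:E)%E.
Proof.
move=> uv K0 c0; under eq_integral do rewrite /step_fun -sumEFin.
rewrite ge0_integral_sum//; last 2 first.
- by move=> j; apply/measurable_EFinP/measurable_funM.
- by move=> j t _; rewrite lee_fin mulr_ge0// c0.
rewrite -sumEFin; apply: eq_bigr => j _.
under eq_integral do rewrite EFinM.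
rewrite ge0_integralZl_EFin//; [|exact/measurable_EFinP|exact: c0].
rewrite integral_indic//.
rewrite EFinM; congr (_ * _)%E.
have jK : (j < K)%N by [].

have sub : `[grid_point u v K j, grid_point u v K j.+1[%classic `<=` `[u, v]%classic.
  move=> t /=; rewrite !in_itv/= => /andP[t1 t2].
  have /andP[g1 _] := grid_point_itv uv K0 (ltnW jK).
  have /andP[_ g2] := grid_point_itv uv K0 jK.
  by rewrite (le_trans g1)// (le_trans (ltW t2)).
rewrite (setIidl sub) /= lebesgue_measure_itv/= lte_fin grid_pointS.
case: ifPn => [_|]; first by rewrite -EFinB addrAC subrr add0r.
rewrite ltrDl -leNgt => le0; congr EFin; apply/esym/eqP.
by rewrite eq_le le0/= divr_ge0// subr_ge0.
Qed.

End step_functions.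

(** * Derivatives in terms of increments *)

Section derivable_increments.
Context (R : realType) (V : normedModType R).
Implicit Types (f : R -> V) (t : R) (L : V).

Lemma derivable_increment f t : derivable f t 1 ->
  forall e, 0 < e -> exists2 d, 0 < d & forall s, `|s - t| < d ->
    `|f s - f t - (s - t) *: derive1 f t| <= e * `|s - t|.
Proof.
move=> df e e0; have /cvgrPdist_le/(_ _ e0) := df.
move=> -[d /= d0 Hd]; exists d => // s sd.
have [->|st] := eqVneq s t; first by rewrite !subrr scale0r subr0 !normr0 mulr0.
have h0 : s - t != 0 by rewrite subr_eq0.
have := Hd (s - t); rewrite /ball_/= sub0r normrN => /(_ sd h0).
rewrite /= [_ *: 1]mulr1 subrK => He.
rewrite -ler_pdivrMr ?normr_gt0// mulrC -normfV -normrZ.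
rewrite scalerBr scalerA mulVf// scale1r.
rewrite distrC derive1E; exact: He.
Qed.

Lemma increment_derivable f t L :
  (forall e, 0 < e -> exists2 d, 0 < d & forall s, `|s - t| < d ->
    `|f s - f t - (s - t) *: L| <= e * `|s - t|) ->
  derivable f t 1 /\ derive1 f t = L.
Proof.
move=> H; suff cv : h^-1 *: ((f \o shift t) (h *: (1 : R)) - f t) @[h --> (0 : R)^'] --> L.
  split; first by apply/cvg_ex; exists L.
  by rewrite derive1E; exact: cvg_lim cv.
apply/cvgrPdist_le => e e0; have [d d0 Hd] := H _ e0.
exists d => // h; rewrite /ball_/= sub0r normrN => hd h0.
have := Hd (h + t); rewrite addrK => /(_ hd) He.
rewrite /= [h *: 1]mulr1 -[L in L - _]scale1r -{1}(mulVf h0) -scalerA -scalerBr normrZ.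
by rewrite normfV ler_pdivrMl ?normr_gt0// mulrC distrC.
Qed.

(* Straddle lemma: the difference quotients over intervals shrinking to t and
   containing t converge to the derivative. *)
Lemma derivable_straddle f t : derivable f t 1 ->
  forall e, 0 < e -> exists2 d, 0 < d & forall a b, a <= t -> t <= b -> a < b ->
    b - a < d -> `|(b - a)^-1 *: (f b - f a) - derive1 f t| <= e.
Proof.
move=> df e e0; have [d d0 Hd] := derivable_increment df e0.
exists d => // a b at_ tb ab abd.
have bt : `|b - t| < d by rewrite ger0_norm ?subr_ge0//; lra.
have ta : `|a - t| < d by rewrite ler0_norm ?subr_le0//; lra.
have := Hd b bt; have := Hd a ta.
rewrite (ger0_norm (_ : 0 <= b - t)) ?subr_ge0//.
rewrite (ler0_norm (_ : a - t <= 0)) ?subr_le0// opprB => Ha Hb.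
have ba0 : 0 < b - a by rewrite subr_gt0.
rewrite -[derive1 f t]scale1r -(mulVf (lt0r_neq0 ba0)) -scalerA -scalerBr normrZ.
rewrite normfV (gtr0_norm ba0) ler_pdivrMl//.
have -> : f b - f a - (b - a) *: derive1 f t =
    (f b - f t - (b - t) *: derive1 f t) - (f a - f t - (a - t) *: derive1 f t).
  have -> : f b - f a = (f b - f t) - (f a - f t) by rewrite opprB addrA subrK.
  have -> : (b - a) = (b - t) - (a - t) by ring.
  have gen (X Y P Q : V) : X - Y - (P - Q) = (X - P) - (Y - Q).
    by rewrite !opprB addrACA [RHS]addrACA [- P + _]addrC.
  by rewrite [in LHS]scalerBl; exact: gen.
apply: le_trans (ler_normB _ _) _.
by apply: le_trans (lerD Hb Ha) _; rewrite -mulrDr mulrC ler_wpM2r//; lra.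
Qed.

End derivable_increments.

(** * Fatou-type bounds for difference quotients and step functions *)

Section ae_lebesgue.
Context (R : realType).
Local Notation leb := (@lebesgue_measure R).

Lemma ae_and (P Q : R -> Prop) : {ae leb, forall x, P x} ->
  {ae leb, forall x, Q x} -> {ae leb, forall x, P x /\ Q x}.
Proof.
move=> aP aQ.
exact: (@filterI _ _ (ae_filter_ringOfSetsType leb) _ _ aP aQ).
Qed.

Lemma ae_neq (c : R) : {ae leb, forall x, x != c}.
Proof.
exists [set c]; split; [exact: measurable_set1|exact: lebesgue_measure_set1|].
by move=> x /= /negP; rewrite negbK => /eqP.
Qed.

Lemma limn_esup_le (x : \bar R) (u : nat -> \bar R) :
  (\forall m \near \oo, (u m <= x)%E) -> (limn_esup u <= x)%E.
Proof.
move=> H; rewrite /limn_esup /limf_esup.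
apply: (@le_trans _ _ (ereal_sup (u @` [set m | (u m <= x)%E]))).
  by apply: ereal_inf_lbound; exists [set m | (u m <= x)%E].
by apply: ge_ereal_sup => _ [m /= xm <-].
Qed.

Lemma le_limn_esup (x : \bar R) (u : nat -> \bar R) :
  (forall N : nat, exists2 m, (N <= m)%N & (x <= u m)%E) -> (x <= limn_esup u)%E.
Proof.
move=> H; apply: le_ereal_inf_tmp => _ [A [N _ NA] <-].
have [m Nm xm] := H N; apply: le_trans xm _.
by apply: ereal_sup_ubound; exists m => //; exact: NA.
Qed.

Lemma le_limn_einf (x : \bar R) (u : nat -> \bar R) :
  (\forall m \near \oo, (x <= u m)%E) -> (x <= limn_einf u)%E.
Proof.
move=> H; rewrite /limn_einf leeNr; apply: limn_esup_le.
by near=> m; rewrite leeN2; near: m.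
Unshelve. all: end_near. Qed.

Lemma limn_einf_le (x : \bar R) (u : nat -> \bar R) :
  (forall m, (u m <= x)%E) -> (limn_einf u <= x)%E.
Proof.
move=> H; rewrite /limn_einf leeNl; apply: le_limn_esup => N.
by exists N; rewrite ?leeN2.
Qed.

Lemma step_width_small (u v d : R) : u <= v -> 0 < d ->
  \forall m \near \oo, (v - u) / m.+1%:R < d.
Proof.
move=> uv d0; near=> m.
rewrite ltr_pdivrMr ?ltr0n// -ltr_pdivrMl//.
have : d^-1 * (v - u) < m%:R.
  by near: m; exact: nbhs_infty_gtr.
by move=> /lt_trans; apply; rewrite ltr_nat.
Unshelve. all: end_near. Qed.

(** Fatou's lemma for the difference quotients of [h] on uniform grids, whose integrals all
    telescope to [h v - h u]; by the straddle lemma they converge to the derivative. The alternative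
    [F t = 0] covers the points where a speed takes its default value. *)
Lemma ge0_integral_le_increment (h F : R -> R) (u v : R) : u <= v ->
  (forall s t, u <= s -> s <= t -> t <= v -> h s <= h t) ->
  (forall t, 0 <= F t) ->
  {ae leb, forall t, u < t < v ->
    F t = 0 \/ derivable h t 1 /\ F t <= derive1 h t} ->
  (\int[leb]_(t in `[u, v]) (F t)%:E <= (h v - h u)%:E)%E.
Proof.
rewrite le_eqVlt => /predU1P[<- _ _ _|uv].
  by rewrite set_itv1 integral_set1 subrr.
move=> hnd F0 aeF; have uv' := ltW uv.
pose w m := (v - u) / m.+1%:R.
have w0 m : 0 < w m by rewrite divr_gt0 ?subr_gt0.
pose c m j := (w m)^-1 * (h (grid_point u v m.+1 j.+1) - h (grid_point u v m.+1 j)).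
have c0 m j : (j < m.+1)%N -> 0 <= c m j.
  move=> jm; rewrite mulr_ge0 ?invr_ge0 ?(ltW (w0 m))// subr_ge0.
  have /andP[g1 _] := grid_point_itv uv' (ltn0Sn m) (ltnW jm).
  have /andP[_ g2] := grid_point_itv uv' (ltn0Sn m) jm.
  by apply: hnd => //; exact: le_grid_point.
pose D m t := (step_fun u v m.+1 (c m) t)%:E.
have D0 m t : (0 <= D m t)%E by rewrite lee_fin step_fun_ge0// => j; exact: c0.
have iD m : (\int[leb]_(t in `[u, v]) D m t = (h v - h u)%:E)%E.
  rewrite integral_step_fun//; last by move=> j; exact: c0.
  under eq_bigr => j _ do rewrite /c mulrC mulrA divff ?gt_eqF ?w0// mul1r.
  rewrite -(big_mkord xpredT (fun j => h (grid_point u v m.+1 j.+1) - h (grid_point u v m.+1 j))).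
  by rewrite telescope_sumr// grid_point0 grid_point_last.
apply: (@le_trans _ _ (\int[leb]_(t in `[u, v]) limn_einf (D ^~ t))%E); last first.
  apply: le_trans (fatou _ _ _ _) _ => //.
  - by move=> m; apply/measurable_EFinP; exact: measurable_step_fun.
  - by apply: limn_einf_le => m; rewrite iD.
apply: ae_ge0_le_integral_fun => //.
- by move=> t; apply: le_limn_einf; apply: nearW.
- have := ae_and aeF (ae_and (ae_neq u) (ae_neq v)).
  apply: ae_imply => t [Ht [tu tv]] /=; rewrite in_itv/= => /andP[ut tv'].
  have {}tu : u < t by rewrite lt_neqAle eq_sym tu.
  have {}tv : t < v by rewrite lt_neqAle tv.
  have /Ht[->|[dh Fh]] : u < t < v by rewrite tu.
    by apply: le_limn_einf; apply: nearW.
  apply/lee_addgt0Pr => e e0; rewrite -leeBlDr//.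
  apply: le_limn_einf.
  have [d d0 Hd] := derivable_straddle dh e0.
  near=> m.
  have [j jm /andP[jt tj]] := @grid_cell _ u v m.+1 t (ltn0Sn m) (introT andP (conj ut tv)).
  rewrite /D (step_funE _ uv' jm) ?jt// -EFinB lee_fin.
  have gw : grid_point u v m.+1 j.+1 - grid_point u v m.+1 j = w m.
    by rewrite grid_pointS addrAC subrr add0r.
  have := Hd _ _ jt (ltW tj) (le_lt_trans jt tj).
  rewrite gw => H; have {H} : `|c m j - derive1 h t| <= e.
    by apply: H; near: m; exact: step_width_small.
  by rewrite ler_norml => /andP[+ _]; lra.
Unshelve. all: end_near. Qed.

(* Reverse Fatou for bounded step functions, with a possibly nonmeasurable
   upper bound S for their pointwise upper limit. *)
Lemma step_sums_le_integral (u v B e d : R) (c : nat -> nat -> R) (S : R -> R) :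
  u < v -> 0 <= e -> 0 < d ->
  (forall m j, (j < m.+1)%N -> 0 <= c m j <= B) ->
  (forall t, 0 <= S t) ->
  {ae leb, forall t, u < t < v -> forall r, 0 < r ->
     \forall m \near \oo, step_fun u v m.+1 (c m) t <= S t + e + r} ->
  exists m : nat, ((\sum_(j < m.+1) c m j * ((v - u) / m.+1%:R))%:E <=
    \int[leb]_(t in `[u, v]) (S t)%:E + (e * (v - u) + d)%:E)%E.
Proof.
move=> uv e0 d0 cB S0 aeS; have uv' := ltW uv.
have B0 : 0 <= B by have /andP[] := cB 0%N 0%N isT; exact: le_trans.
(* If every sum exceeded the bound, the integral of [S] would be finite, and it can then be
   subtracted. *)
apply: contrapT => /forallNP noM.
set I := (\int[leb]_(t in `[u, v]) (S t)%:E)%E in noM *.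
have I0 : (0 <= I)%E by apply: integral_ge0 => t _; rewrite lee_fin.
have {}noM m : (I + (e * (v - u) + d)%:E <=
    (\sum_(j < m.+1) c m j * ((v - u) / m.+1%:R))%:E)%E.
  by have /negP := noM m; rewrite -ltNge => /ltW.
have Ifin : I \is a fin_num.
  rewrite ge0_fin_numE//; apply: (le_lt_trans _ (ltry (\sum_(j < 1) c 0%N j * ((v - u) / 1%:R)))).
  apply: (le_trans _ (noM 0%N)); rewrite leeDl// lee_fin addr_ge0// ?mulr_ge0//; lra.
have Iint : I = (fine I)%:E by rewrite fineK.
have cB' m j : (j < m.+1)%N -> 0 <= B - c m j.
  by move=> jm; rewrite subr_ge0; have /andP[] := cB m j jm.
(* Subtraction from the uniform bound [B] turns the upper limit into a lower limit of nonnegative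
   functions, to which Fatou's lemma applies. *)
pose D m t := (step_fun u v m.+1 (fun j => B - c m j) t)%:E.
have D0 m t : (0 <= D m t)%E by rewrite lee_fin step_fun_ge0// => j; exact: cB'.
have mD m : measurable_fun `[u, v]%classic (D m).
  by apply/measurable_EFinP; exact: measurable_step_fun.
have iD m : (\int[leb]_(t in `[u, v]) D m t <=
    (B * (v - u) - (fine I + e * (v - u) + d))%:E)%E.
  rewrite integral_step_fun//; last by move=> j; exact: cB'.
  rewrite lee_fin; under eq_bigr => j _ do rewrite mulrBl.
  have -> : \sum_(j < m.+1) (B * ((v - u) / m.+1%:R) - c m j * ((v - u) / m.+1%:R)) =
      B * (v - u) - \sum_(j < m.+1) c m j * ((v - u) / m.+1%:R).
    rewrite sumrB sumr_const card_ord -[_ *+ m.+1]mulr_natr -mulrA.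
    by rewrite divfK// pnatr_eq0.
  by rewrite lerD2l lerN2 -addrA -lee_fin EFinD -Iint.
pose V t := limn_einf (D ^~ t).
have mN m : measurable_fun `[u, v]%classic (fun t => - D m t)%E.
  exact: (measurableT_comp (@oppe_measurable R setT) (mD m)).
have mV : measurable_fun `[u, v]%classic V.
  exact: (measurableT_comp (@oppe_measurable R setT) (measurable_fun_limn_esup mN)).
have V0 t : (0 <= V t)%E by apply: le_limn_einf; apply: nearW.
have iV : (\int[leb]_(t in `[u, v]) V t <=
    (B * (v - u) - (fine I + e * (v - u) + d))%:E)%E.
  by apply: le_trans (fatou _ _ _ _) _ => //; exact: limn_einf_le.
(* A measurable substitute for [S]: it lies below [S] almost everywhere, and [V + W] is still at
   least [B - e], so integrals may be added. *)
pose W t := maxe (((B - e)%:E) - V t)%E 0%E.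
have mW : measurable_fun `[u, v]%classic W.
  by apply: measurable_maxe => //; apply: emeasurable_funB.
have W0 t : (0 <= W t)%E by rewrite /W le_max lexx orbT.
have iW : (\int[leb]_(t in `[u, v]) W t <= I)%E.
  apply: ae_ge0_le_integral_fun => //.
  have := ae_and aeS (ae_and (ae_neq u) (ae_neq v)).
  apply: ae_imply => t [Ht [tu tv]] /=; rewrite in_itv/= => /andP[ut tv'].
  have {}tu : u < t by rewrite lt_neqAle eq_sym tu.
  have {}tv : t < v by rewrite lt_neqAle tv.
  have {}Ht := Ht (introT andP (conj tu tv)).
  rewrite /W ge_max lee_fin S0 andbT.
  suff VS : ((B - e - S t)%:E <= V t)%E.
    by case: (V t) VS => [r| |]; rewrite ?leeNy_eq// -?EFinB ?lee_fin; [lra|rewrite leNye].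
  apply/lee_addgt0Pr => r r0; rewrite -leeBlDr//.
  apply: le_limn_einf; have := Ht r r0.
  apply: filterS => m; rewrite /D -EFinB lee_fin.
  have [j jm jt] := @grid_cell _ u v m.+1 t (ltn0Sn m) (introT andP (conj ut tv)).
  by rewrite !(step_funE _ uv' jm jt); lra.
have : (((B - e) * (v - u))%:E <= \int[leb]_(t in `[u, v]) (V t + W t))%E.
  have -> : (((B - e) * (v - u))%:E = \int[leb]_(t in `[u, v]) (B - e)%:E)%E.
      by rewrite integral_cst//= lebesgue_measure_itv/= lte_fin uv -EFinB EFinM.
  have [Be|eB] := leP (B - e) 0.
    apply: (@le_trans _ _ 0%E); last first.
      by apply: integral_ge0 => t _; rewrite adde_ge0.
    rewrite integral_cst//= lebesgue_measure_itv/= lte_fin uv -EFinB -EFinM lee_fin.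
    by rewrite mulr_le0_ge0// subr_ge0.
  apply: ge0_le_integral_fun => t _; first by rewrite lee_fin ltW.
  rewrite /W; case: (V t) (V0 t) => [r _| _|//]; last first.
    by rewrite addye ?leey// -ltNye (lt_le_trans (ltNyr 0))// le_max lexx orbT.
  by rewrite -leeBlDl// -EFinB le_max lexx.
rewrite ge0_integralD// => H.
have := le_trans H (leeD iV iW); rewrite Iint -EFinD lee_fin; lra.
Qed.

End ae_lebesgue.

(** * Mean value inequality and translations on the line *)

Section one_variable.
Context (R : realType).
Local Notation leb := (@lebesgue_measure R).

(** Adding [K * t] makes [phi] nondecreasing, so the integral of the constant [K + m] is bounded by
    an increment; when this constant is not positive, the Lipschitz bound alone suffices. *)
Lemma lipschitz_increment_ge (phi : R -> R) (K m a b : R) : a <= b ->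
  (forall s t, `|phi s - phi t| <= K * `|s - t|) ->
  {ae leb, forall t, a < t < b -> m <= derive1 phi t} ->
  m * (b - a) <= phi b - phi a.
Proof.
move=> ab lip aem.
have K0 : 0 <= K.
  by have := lip 1 0; rewrite subr0 normr1 mulr1; exact: le_trans.
pose h t := K * t + phi t.
have hnd s t : s <= t -> h s <= h t.
  move=> st; have := lip t s; rewrite [`|t - s|]ger0_norm ?subr_ge0//.
  by rewrite ler_norml /h => /andP[+ _]; lra.
have [Km|Km] := leP (K + m) 0.
  have := lip b a; rewrite [`|b - a|]ger0_norm ?subr_ge0//.
  by rewrite ler_norml => /andP[+ _]; move: ab; nra.
have : (\int[leb]_(t in `[a, b]) (K + m)%:E <= (h b - h a)%:E)%E.
  apply: (@ge0_integral_le_increment _ h (fun=> K + m)) => //.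
  - by move=> s t _ st _; exact: hnd.
  - by move=> _; exact: ltW.
  - have := ae_and aem (lipschitz_ae_derivable lip).
    apply: ae_imply => t [mt dphi] /mt {}mt; right.
    have dK : derivable (K *: (@id R)) t 1.
      by apply: derivableZ; exact: derivable_id.
    have hE : h = K *: (@id R) + phi by apply/funext => s.
    split; first by rewrite hE; exact: derivableD.
    rewrite hE derive1E deriveD// deriveZ//.
    by rewrite derive_id -derive1E [_ *: _]mulr1 lerD2l.
rewrite integral_cst//= lebesgue_measure_itv/= lte_fin.
case: ltP => ab'; last first.
  by have -> : a = b by [apply/eqP; rewrite eq_le ab]; rewrite !subrr mulr0.
by rewrite -EFinB -EFinM lee_fin /h; lra.
Qed.

Let measurable_shift (r : R) : measurable_fun [set: measurableTypeR R]
  (fun t : measurableTypeR R => (t + r)%R : measurableTypeR R).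
Proof.
have mf : measurable_fun [set: R] (fun t : R => t + r) by apply: measurable_funD.
by move=> mT B mB; exact: (mf mT B mB).
Qed.

(** The pushforward gives every half-open interval its length, and this characterises Lebesgue
    measure. *)
Lemma lebesgue_measure_shift (r : R) (A : set R) : measurable A ->
  pushforward leb (fun t : R => t + r) A = leb A.
Proof.
move=> mA; apply/esym.
pose m : {measure set (measurableTypeR R) -> \bar R} :=
  measure_function_pushforward__canonical__measure_function_Measure leb (measurable_shift r).
apply: (@lebesgue_measure_unique R m) => // X [[x y] /= _ <-].
rewrite /m/= /pushforward.
have -> : (fun t : R => t + r) @^-1` `]x, y]%classic = `]x - r, y - r]%classic.
  by apply/seteqP; split => t /=; rewrite !in_itv/= ltrBlDr lerBrDr.
rewrite !lebesgue_measure_itv/= !lte_fin ltrD2r.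
by case: ifP => // _; rewrite -!EFinB; congr EFin; ring.
Qed.

Lemma ae_shift (P : R -> Prop) (r : R) :
  {ae leb, forall t, P t} -> {ae leb, forall t, P (t + r)}.
Proof.
move=> [N [mN N0 PN]]; exists ((fun t : R => t + r) @^-1` N); split.
- by rewrite -[X in measurable X]setTI; apply: measurable_shift.
- by rewrite -[RHS]N0; exact: lebesgue_measure_shift.
- by move=> t /= nP; apply: PN.
Qed.

Lemma integral_shift (f : R -> R) (a b r : R) : continuous f ->
  (\int[leb]_(t in `[a, b]) (f (t + r))%:E =
   \int[leb]_(t in `[(a + r)%R, (b + r)%R]) (f t)%:E)%E.
Proof.
move=> cf.
have mf0 : measurable_fun [set: R] (EFin \o f).
  by apply/measurable_EFinP; exact: continuous_measurable_fun.
have mf : measurable_fun [set: measurableTypeR R] (EFin \o f : measurableTypeR R -> \bar R).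
  by move=> mT B mB; exact: (mf0 mT B mB).
have DE : (fun t : R => t + r) @^-1` `[a + r, b + r]%classic = `[a, b]%classic.
  by apply/seteqP; split => t /=; rewrite !in_itv/= !lerD2r.
have := @integral_pushforward _ _ _ _ R _ (measurable_shift r) leb `[a + r, b + r]%classic _ mf.
rewrite DE => <-//; last first.
  apply: continuous_compact_integrable; first exact: segment_compact.
  apply: continuous_subspaceT => t; apply: continuous_comp; last exact: cf.
  by apply: continuousD; [exact: cvg_id|exact: cvg_cst].
apply: eq_measure_integral => A mA _; exact: lebesgue_measure_shift.
Qed.

End one_variable.

(** * Almost-everywhere statements on the line and in several coordinates *)

Lemma ae_eq0_of_itv_integrals (R : realType) (w : R -> R) (B : R) :
  measurable_fun [set: R] w -> (forall t, `|w t| <= B) ->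
  (forall a b, a < b -> (\int[lebesgue_measure]_(t in `[a, b]) (w t))%R = 0) ->
  {ae lebesgue_measure, forall t, w t = 0}.
Proof.
move=> mw wB w0.
have wint (A : set R) : measurable A -> (lebesgue_measure A < +oo)%E ->
    lebesgue_measure.-integrable A (EFin \o w).
  move=> mA Afin; apply: (@measurable_bounded_integrable _ _ R lebesgue_measure) => //.
    exact: measurable_funTS.
  exists B; split; first by rewrite num_real.
  by move=> x Bx t _; apply: le_trans (wB t) (ltW Bx).
have wloc : locally_integrable [set: R] w.
  split => // [|K _ cK]; first exact: openT.
  have := wint K (compact_measurable cK) (compact_finite_measure cK).
  by move=> /integrableP[].
suff H : forall n : nat, {ae lebesgue_measure, forall t, - n%:R < t -> w t = 0}.
  have /ae_foralln := H.
  apply: ae_imply => t Ht; apply: (Ht (Num.truncn `|t|).+1).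
  by rewrite ltrNl (le_lt_trans (ler_norm (- t)))// normrN truncnS_gt.
move=> n.
have witv y : lebesgue_measure.-integrable
    [set` Interval (BLeft (- n%:R)) (BRight y)] (EFin \o w).
  apply: wint; first exact: measurable_itv.
  by apply: compact_finite_measure; exact: segment_compact.
(* The indefinite integral vanishes identically, and its derivative is [w] almost everywhere. *)
have := FTC1 witv wloc; apply: ae_imply => t Ht nt.
case: Ht => [|_ <-]; first by [].
set F := fun x => _; rewrite derive1E (@near_eq_derive _ _ _ F (cst 0)) ?derive_cst//.
by near=> y; rewrite /F w0//; near: y; exact: lt_nbhsr.
Unshelve. all: end_near. Qed.

(* Iterated "almost everywhere" quantification over k real coordinates.  It
   plays the role of k-dimensional Lebesgue measure: adjacent quantifiers commute
   on measurable sets by Fubini, and translation invariance is one-dimensional. *)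
Section iterated_ae.
Context (R : realType).
Local Notation T := (measurableTypeR R).
Local Notation leb := (@lebesgue_measure R).

Fixpoint iter_ae (k : nat) : set (k.-tuple T) -> Prop :=
  if k is k'.+1 then
    fun E => {ae leb, forall s, iter_ae [set t : k'.-tuple T | E [tuple of s :: t]]}
  else fun E => E [tuple].

Lemma iter_ae_imply k (E F : set (k.-tuple T)) : E `<=` F -> iter_ae E -> iter_ae F.
Proof.
elim: k E F => [|k IH] E F EF /=; first exact: EF.
by apply: ae_imply => s; apply: IH => t; exact: EF.
Qed.

Lemma iter_ae_foralln k (E : nat -> set (k.-tuple T)) :
  (forall n, iter_ae (E n)) -> iter_ae (\bigcap_n E n).
Proof.
elim: k E => [|k IH] E HE; first by move=> n _; exact: HE.
have /ae_foralln := HE; apply: ae_imply => s Hs.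
by apply: iter_ae_imply (IH _ Hs) => t Ht n _; exact: Ht.
Qed.

Lemma iter_ae_and k (E F : set (k.-tuple T)) :
  iter_ae E -> iter_ae F -> iter_ae (E `&` F).
Proof.
elim: k E F => [|k IH] E F //= HE HF.
by have := ae_and HE HF; apply: ae_imply => s [Es Fs]; exact: IH.
Qed.

Lemma ae_const (Q : Prop) : {ae leb, forall s : R, Q} <-> Q.
Proof.
split=> [[N [mN N0 sub]]|q]; last by exists set0; split => // s /=.
apply: contrapT => nQ; have NT : N = setT by apply/seteqP; split => // s _; exact: sub.
have : (leb `[0%R, 1%R]%classic <= leb N)%E.
  by apply: le_measure; rewrite ?inE// NT.
by rewrite [leRHS]N0 lebesgue_measure_itv/= lte_fin ltr01 sube0 lee_fin ler10.
Qed.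

Lemma ae_measurableP (E : set T) : measurable E ->
  {ae leb, forall s, E s} <-> leb (~` E) = 0%E.
Proof.
move=> mE; have := @negligibleP _ _ _ leb (~` E) (measurableC mE).
move=> [H1 H2]; split => [h|h]; first by apply: H1.
exact: H2.
Qed.

(** The measure of the complementary section is a measurable function of [y], and the set in
    question is its zero set. *)
Lemma measurable_ae_section d (Y : measurableType d) (E : set (Y * T)) :
  measurable E -> measurable [set y | {ae leb, forall s, E (y, s)}].
Proof.
move=> mE.
have mEc : measurable (~` E) by exact: measurableC.
have -> : [set y | {ae leb, forall s, E (y, s)}] =
    (leb \o xsection (~` E)) @^-1` [set 0%E].
  apply/seteqP; split => y /=; rewrite xsectionE preimage_setC;
    by have := ae_measurableP (measurable_xsection y mE); rewrite xsectionE => -[h1 h2].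
rewrite -[X in measurable X]setTI.
exact: (measurable_fun_xsection leb mEc).
Qed.

(** Tonelli's theorem for the indicator of the complement: each side says that one of its iterated
    integrals vanishes. *)
Lemma ae_ae_swap (E : set (T * T)) : measurable E ->
  {ae leb, forall s, {ae leb, forall r, E (s, r)}} ->
  {ae leb, forall r, {ae leb, forall s, E (s, r)}}.
Proof.
move=> mE H; pose f (x : T * T) : \bar R := (\1_(~` E) x)%:E.
have mEc : measurable (~` E) by exact: measurableC.
have f0 x : (0 <= f x)%E by rewrite lee_fin.
have mf : measurable_fun [set: T * T] f.
  by apply/measurable_EFinP; exact: measurable_indic.
have null (g : T -> \bar R) : measurable_fun [set: T] g ->
    (forall x, 0 <= g x)%E -> (\int[leb]_x g x = 0)%E <-> {ae leb, forall x, g x = 0%E}.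
  move=> mg g0; have := @ae_eq_integral_abs _ _ R leb setT measurableT g mg.
  under eq_integral do rewrite gee0_abs//.
  by move=> [h1 h2]; split => [/h1|h]; [apply: ae_imply => x; apply|
    apply: h2; move: h; apply: ae_imply].
have sec (A : set T) : measurable A ->
    (\int[leb]_x (\1_(~` A) x)%:E = 0)%E <-> {ae leb, forall s, A s}.
  move=> mA; rewrite integral_indic ?setIT//; last exact: measurableC.
  by split => /(ae_measurableP mA).
have := @fubini_tonelli _ _ _ _ R leb leb f mf f0.
have Fn : (\int[leb]_s \int[leb]_r f (s, r) = 0)%E.
  apply/null.
  - exact: measurable_fun_fubini_tonelli_F.
  - by move=> s; apply: integral_ge0.
  - move: H; apply: ae_imply => s Hs.
    have := (sec _ (measurable_xsection s mE)).2; rewrite xsectionE => /(_ Hs) <-.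
    by apply: eq_integral => r _.
rewrite Fn => /esym/null H2.
have mG : measurable_fun [set: T] (fun r => \int[leb]_s f (s, r))%E.
  exact: measurable_fun_fubini_tonelli_G.
have G0 r : (0 <= \int[leb]_s f (s, r))%E by apply: integral_ge0.
have := H2 mG G0; apply: ae_imply => r Hr; have := (sec _ (measurable_ysection r mE)).1; rewrite ysectionE; apply.
by rewrite -[RHS]Hr; apply: eq_integral => s _.
Qed.

(** The induction moves the first coordinate into the parameter space, which is why [Y] is
    arbitrary. *)
Lemma measurable_iter_ae k d (Y : measurableType d) (E : set (Y * k.-tuple T)) :
  measurable E -> measurable [set y | iter_ae [set t | E (y, t)]].
Proof.
elim: k d Y E => [|k IH] d Y E mE /=.
  by have := measurable_ysection [tuple] mE; rewrite ysectionE.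
pose psi (z : (Y * T) * k.-tuple T) : Y * k.+1.-tuple T :=
  (z.1.1, [tuple of z.1.2 :: z.2]).
have mpsi : measurable_fun [set: (Y * T) * k.-tuple T] psi.
  apply: measurable_fun_pair; first exact: measurableT_comp.
  by apply: measurable_cons => //; exact: measurableT_comp.
have mE' : measurable (psi @^-1` E).
  by rewrite -[X in measurable X]setTI; exact: mpsi.
exact: (measurable_ae_section (IH _ _ _ mE')).
Qed.

Lemma ae_ae_swapV (E : set (T * T)) : measurable E ->
  {ae leb, forall r, {ae leb, forall s, E (s, r)}} ->
  {ae leb, forall s, {ae leb, forall r, E (s, r)}}.
Proof.
move=> mE; apply: (@ae_ae_swap [set z | E (z.2, z.1)]).
have msw : measurable_fun [set: T * T] (fun z : T * T => (z.2, z.1)).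
  exact: measurable_fun_pair.
by rewrite -[X in measurable X]setTI; exact: msw.
Qed.

Lemma iter_ae_swap k (E : set (T * k.-tuple T)) : measurable E ->
  {ae leb, forall s, iter_ae [set t | E (s, t)]} <->
  iter_ae [set t | {ae leb, forall s, E (s, t)}].
Proof.
elim: k E => [//|k IH] E mE /=.
pose psi (z : (T * T) * k.-tuple T) : T * k.+1.-tuple T :=
  (z.1.1, [tuple of z.1.2 :: z.2]).
have mpsi : measurable_fun [set: (T * T) * k.-tuple T] psi.
  apply: measurable_fun_pair; first exact: measurableT_comp.
  by apply: measurable_cons => //; exact: measurableT_comp.
have mE' : measurable (psi @^-1` E).
  by rewrite -[X in measurable X]setTI; exact: mpsi.
pose phi r (z : T * k.-tuple T) : T * k.+1.-tuple T := (z.1, [tuple of r :: z.2]).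
have mE2 r : measurable (phi r @^-1` E).
  have mphi : measurable_fun [set: T * k.-tuple T] (phi r).
    by apply: measurable_fun_pair => //; exact: measurable_cons.
  by rewrite -[X in measurable X]setTI; exact: mphi.
split=> [H|H].
  have := ae_ae_swap (measurable_iter_ae mE') H; apply: ae_imply => r Hr.
  exact: (IH (phi r @^-1` E) (mE2 r)).1.
apply: (ae_ae_swapV (measurable_iter_ae mE')).
move: H; apply: ae_imply => r Hr.
exact: (IH (phi r @^-1` E) (mE2 r)).2.
Qed.

Definition tuple_shift k (t : k.-tuple T) (w : nat -> R) : k.-tuple T :=
  [tuple (tnth t i + w i)%R | i < k].

Lemma tuple_shift_cons k s (t : k.-tuple T) w :
  tuple_shift [tuple of s :: t] w =
  [tuple of (s + w 0%N)%R :: tuple_shift t (fun i => w i.+1)].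
Proof.
apply: eq_from_tnth => i; rewrite tnth_mktuple.
case: (unliftP ord0 i) => [j ->|->]; last by rewrite !tnth0.
by rewrite !tnthS tnth_mktuple.
Qed.

Lemma iter_ae_shift k (E : set (k.-tuple T)) w :
  iter_ae E -> iter_ae [set t | E (tuple_shift t w)].
Proof.
elim: k E w => [|k IH] E w /=; first by rewrite [tuple_shift _ _]tuple0.
move=> /(ae_shift (w 0%N)); apply: ae_imply => s /(IH _ (fun i => w i.+1)).
by apply: iter_ae_imply => t /=; rewrite tuple_shift_cons.
Qed.

Lemma tuple_shiftNK k (t : k.-tuple T) w :
  tuple_shift (tuple_shift t (fun i => - w i)) w = t.
Proof. by apply: eq_from_tnth => i; rewrite !tnth_mktuple subrK. Qed.

(* A measurable property holds almost everywhere iff it holds almost everywhere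
   on almost every line parallel to a given direction. *)
Lemma iter_ae_lineP k (E : set (k.-tuple T)) (w : nat -> R) : measurable E ->
  iter_ae [set t | {ae leb, forall s, E (tuple_shift t (fun i => s * w i))}]
  <-> iter_ae E.
Proof.
move=> mE.
pose psi (z : T * k.-tuple T) : k.-tuple T := tuple_shift z.2 (fun i => z.1 * w i).
have mpsi : measurable_fun [set: T * k.-tuple T] psi.
  apply/measurable_fun_tnthP => i.
  rewrite (_ : _ \o _ = (fun z => tnth z.2 i + z.1 * w i)%R); last first.
    by apply/funext => z /=; rewrite /psi/= tnth_mktuple.
  have m1 : measurable_fun [set: T * k.-tuple T]
      (fun z : T * k.-tuple T => (tnth z.2 i : R)).
    have h : measurable_fun [set: T * k.-tuple T]
        (fun z : T * k.-tuple T => (tnth z.2 i : T)).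
      exact: (measurableT_comp (measurable_tnth i) measurable_snd).
    by move=> mT B mB; exact: (h mT B mB).
  have m2 : measurable_fun [set: T * k.-tuple T] (fun z : T * k.-tuple T => (z.1 : R)).
    have h : measurable_fun [set: T * k.-tuple T] (fun z : T * k.-tuple T => (z.1 : T)).
      exact: measurable_fst.
    by move=> mT B mB; exact: (h mT B mB).
  have m3 : measurable_fun [set: T * k.-tuple T]
      (fun z : T * k.-tuple T => (tnth z.2 i : R) + (z.1 : R) * w i)%R.
    by apply: measurable_funD => //; apply: measurable_funM.
  by move=> mT B mB; exact: (m3 mT B mB).
have mE' : measurable (psi @^-1` E).
  by rewrite -[X in measurable X]setTI; exact: mpsi.
(* Once the line parameter [s] is quantified outside, the shift by [s * w] is undone by translation
   invariance and [s] disappears. *)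
rewrite -(iter_ae_swap mE'); split => [H|].
  apply/ae_const; move: H; apply: ae_imply => s.
  move=> /(@iter_ae_shift _ _ (fun i => - (s * w i))).
  by apply: iter_ae_imply => t; rewrite /psi/= tuple_shiftNK.
by move=> H; apply: aeW => s; exact: (iter_ae_shift (fun i => s * w i)%R H).
Qed.

(** No interval []0, d[] is null, so the coordinates can be chosen one at a time. The point found
    serves as a small generic translation. *)
Lemma iter_ae_exists k (E : set (k.-tuple T)) (d : R) : 0 < d -> iter_ae E ->
  exists2 t, E t & forall i, 0 < tnth t i < d.
Proof.
move=> d0; elim: k E => [|k IH] E /= HE; first by exists [tuple] => // -[].
have [s s0 Es] : exists2 s, 0 < s < d & iter_ae [set t : k.-tuple T | E [tuple of s :: t]].
  apply: contrapT => /forall2NP nE; case: HE => N [mN N0 sub].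
  have : (leb `]0%R, d[%classic <= leb N)%E.
    apply: le_measure; rewrite ?inE//.
    move=> s /=; rewrite in_itv/= => sd; apply: sub => /= Es.
    by have [] := nE s.
  by rewrite [leRHS]N0 lebesgue_measure_itv/= lte_fin d0 sube0 lee_fin leNgt d0.
have [t Et t0] := IH _ Es; exists [tuple of s :: t] => // i.
by case: (unliftP ord0 i) => [j ->|->]; rewrite ?tnthS ?tnth0.
Qed.

End iterated_ae.

(** * Differentials, rational points and measurability of Lipschitz functions *)

Section differentiable_increments.
Context (R : realType) (V W : normedModType R).
Implicit Types (f : V -> W) (x y : V).

Lemma differentiable_increment f x : differentiable f x ->
  forall e, 0 < e -> exists2 d, 0 < d & forall y, `|y| < d ->
    `|f (x + y) - f x - 'd f x y| <= e * `|y|.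
Proof.
move=> /diff_locallyP[_ /eqaddoP H] e e0.
have /nbhs_ballP[d /= d0 Hd] := H e e0; exists d => // y yd.
have := Hd y; rewrite -ball_normE /ball_/= sub0r normrN => /(_ yd).
by rewrite !fctE /= (addrC y x) opprD addrA.
Qed.

Lemma increment_differentiable f x (df : {linear V -> W}) : continuous df ->
  (forall e, 0 < e -> exists2 d, 0 < d & forall y, `|y| < d ->
    `|f (x + y) - f x - df y| <= e * `|y|) ->
  differentiable f x /\ 'd f x = df :> (V -> W).
Proof.
move=> cdf H.
have E : f \o shift x = cst (f x) + df +o_ (0 : V) id.
  apply/eqaddoP => e e0; have [d d0 Hd] := H e e0.
  apply/nbhs_ballP; exists d => //= y; rewrite -ball_normE /ball_/= sub0r normrN => yd.
  by have := Hd y yd; rewrite !fctE /= (addrC y x) opprD addrA.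
have dE := diff_unique cdf E; split => //.
by apply/diff_locallyP; rewrite dE.
Qed.

End differentiable_increments.

Section row_vectors.
Context (R : realType) (n : nat).
Implicit Types (x y : 'rV[R]_n.+1).

Lemma rV_coord_le_norm x i : `|x 0 i| <= `|x|.
Proof.
rewrite [leRHS]mx_normrE.
exact: (@le_bigmax _ _ _ 0 (fun ij => `|x ij.1 ij.2|) (0, i)).
Qed.

Lemma rV_norm_le x d : 0 <= d -> (forall i, `|x 0 i| <= d) -> `|x| <= d.
Proof.
move=> d0 xd; rewrite [leLHS]mx_normrE; apply: bigmax_le => // -[j i] _ /=.
by rewrite ord1.
Qed.

Lemma rV_norm_lt x d : 0 < d -> (forall i, `|x 0 i| < d) -> `|x| < d.
Proof.
move=> d0 xd; rewrite [ltLHS]mx_normrE; apply: bigmax_lt => // -[j i] _ /=.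
by rewrite ord1.
Qed.

Definition rat_row (q : 'rV[rat]_n.+1) : 'rV[R]_n.+1 := map_mx ratr q.

Lemma rat_row_dense x e : 0 < e -> exists q, `|x - rat_row q| < e.
Proof.
move=> e0.
have H i : exists q : rat, `|x 0 i - ratr q| < e.
  have : x 0 i - e < x 0 i + e by rewrite ltrD2l (lt_trans _ e0)// oppr_lt0.
  move=> /rat_in_itvoo[q]; rewrite in_itv/= => /andP[q1 q2]; exists q.
  by rewrite ltr_norml; apply/andP; split; lra.
have [q Hq] := choice H; exists (\row_i q i).
by apply: rV_norm_lt => // i; rewrite !mxE.
Qed.

Lemma lipschitz_rV_continuous (F : 'rV[R]_n.+1 -> R) (L : R) :
  (forall x y, `|F x - F y| <= L * `|x - y|) -> continuous F.
Proof.
move=> FL x; apply/(@cvgrPdist_le _ R^o _ _ (nbhs_filter x)) => e e0.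
have L1 : 0 < `|L| + 1 by rewrite ltr_wpDl.
apply/nbhs_ballP; exists (e / (`|L| + 1)) => /=; first by rewrite divr_gt0.
move=> y; rewrite -ball_normE/= => xy; apply: (le_trans (FL x y)).
apply: (@le_trans _ _ ((`|L| + 1) * `|x - y|)).
  by rewrite ler_wpM2r// (le_trans (ler_norm L))// lerDl.
by rewrite mulrC -ler_pdivlMr// ltW.
Qed.

End row_vectors.

Section measurable_lipschitz.
Context (R : realType) (n : nat).
Local Notation T := (measurableTypeR R).

Definition row_of_tuple (t : n.+1.-tuple T) : 'rV[R]_n.+1 := \row_i tnth t i.

(** Indexed by [nat] to fit [tuple_shift]; a shift of an [n.+1]-tuple never reads the default of
    [inord]. *)
Definition coord_fun (u : 'rV[R]_n.+1) (i : nat) : R := u 0 (inord i).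

Lemma row_of_tuple_shift t u s :
  row_of_tuple (tuple_shift t (fun i => s * coord_fun u i)) = row_of_tuple t + s *: u.
Proof.
by apply/rowP => i; rewrite !mxE tnth_mktuple /coord_fun inord_val.
Qed.

Lemma measurable_coord (i : 'I_n.+1) :
  measurable_fun [set: n.+1.-tuple T] (fun t : n.+1.-tuple T => (tnth t i : R)).
Proof.
have h : measurable_fun [set: n.+1.-tuple T] (fun t : n.+1.-tuple T => (tnth t i : T)).
  exact: measurable_tnth.
by move=> mT B mB; exact: (h mT B mB).
Qed.

(** Tuples carry the product sigma-algebra, so superlevel sets are exhibited as countable unions of
    open boxes with rational centres [q]: the Lipschitz lower bounds of [F] based at such [q] have
    supremum [F]. *)
Lemma measurable_lipschitz_row (F : 'rV[R]_n.+1 -> R) (L : R) :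
  (forall x y, `|F x - F y| <= L * `|x - y|) ->
  measurable_fun [set: n.+1.-tuple T] (F \o row_of_tuple).
Proof.
move=> FL; pose K := `|L| + 1.
have K0 : 0 < K by rewrite /K ltr_wpDl.
have {}FL x y : `|F x - F y| <= K * `|x - y|.
  apply: le_trans (FL x y) _.
  by rewrite ler_wpM2r// (le_trans (ler_norm L))// lerDl.
move=> mT; apply: (measurability _ (RGenOInfty.measurableE R)) => //.
move=> _ [_ [a ->] <-]; rewrite setTI.
pose A (q : 'rV[rat]_n.+1) : set (n.+1.-tuple T) :=
  [set t | a < F (rat_row R q) - K * `|row_of_tuple t - rat_row R q|].
have -> : (F \o row_of_tuple) @^-1` `]a, +oo[ = \bigcup_q A q.
  apply/seteqP; split => t /=; rewrite in_itv/= andbT.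
    move=> Fta; pose e := (F (row_of_tuple t) - a) / (K + K).
    have e0 : 0 < e by rewrite divr_gt0 ?subr_gt0 ?(addr_gt0 K0 K0).
    have [q Hq] := rat_row_dense (row_of_tuple t) e0; exists q => //.
    have := FL (row_of_tuple t) (rat_row R q); rewrite ler_norml => /andP[_ Fq].
    by rewrite ltr_pdivlMr ?(addr_gt0 K0 K0)// in Hq; rewrite /A/=; nra.
  move=> [q _]; rewrite /A/= => H; apply: lt_le_trans H _.
  have := FL (rat_row R q) (row_of_tuple t); rewrite ler_norml => /andP[_].
  by rewrite distrC; lra.
apply: countable_bigcupT_measurable => [|q]; first exact: countableP.
pose d := (F (rat_row R q) - a) / K.
have AE t : A q t <-> `|row_of_tuple t - rat_row R q| < d.
  by rewrite /A/= ltrBrDr -ltrBrDl /d ltr_pdivlMr// mulrC.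
have [d0|d0] := leP d 0.
  rewrite (_ : A q = set0)//; apply/seteqP; split => // t /AE.
  by move=> /lt_le_trans /(_ d0); rewrite normr_lt0.
have -> : A q = \bigcap_(i in [set: 'I_n.+1])
    [set t : n.+1.-tuple T | (`|tnth t i - ratr (q 0 i)| : R) < d].
  apply/seteqP; split => t.
    move=> /AE H i _ /=.
    by apply: le_lt_trans H; have := rV_coord_le_norm (row_of_tuple t - rat_row R q) i;
      rewrite !mxE.
  by move=> H; apply/AE; apply: rV_norm_lt => // i; have := H i Logic.I; rewrite /= !mxE.
apply: fin_bigcap_measurable => // i _.
have mf : measurable_fun [set: n.+1.-tuple T]
    (fun t : n.+1.-tuple T => `|(tnth t i : R) - ratr (q 0 i)|).
  apply: measurableT_comp => //; apply: measurable_funB => //; exact: measurable_coord.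
have := mf measurableT `]-oo, d[%classic (measurable_itv _).
by rewrite setTI (_ : _ @^-1` _ = [set t : n.+1.-tuple T | (`|tnth t i - ratr (q 0 i)| : R) < d]).
Qed.

End measurable_lipschitz.

(** * Differences of translates of bounded functions *)

Section shift_difference.
Context (R : realType).
Local Notation leb := (@lebesgue_measure R).

Lemma continuous_itv_integrable (A : R -> R) (a b : R) : continuous A ->
  leb.-integrable `[a, b] (EFin \o A).
Proof.
move=> cA; apply: continuous_compact_integrable; first exact: segment_compact.
exact: continuous_subspaceT.
Qed.

Lemma Rintegral_itv_split (A : R -> R) (a c b : R) : continuous A ->
  a <= c -> c <= b ->
  (\int[leb]_(t in `[a, b]) A t = \int[leb]_(t in `[a, c]) A t
    + \int[leb]_(t in `[c, b]) A t)%R.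
Proof.
move=> cA ac cb.
have := @Rintegral_itvB R A (BLeft a) (BRight b) c (continuous_itv_integrable a b cA).
rewrite !bnd_simp => /(_ ac cb) E.
rewrite -[X in _ = _ + X]Rintegral_itv_obnd_cbnd; last first.
  apply: integrableS (continuous_itv_integrable c b cA) => //.
  by move=> t /=; rewrite !in_itv/= => /andP[/ltW -> ->].
by rewrite -E addrC subrK.
Qed.

Lemma Rintegral_itv_bound (A : R -> R) (a b B : R) : continuous A -> a <= b ->
  (forall t, `|A t| <= B) -> `|(\int[leb]_(t in `[a, b]) A t)%R| <= B * (b - a).
Proof.
move=> cA ab AB.
apply: le_trans (le_normr_Rintegral _ (continuous_itv_integrable a b cA)) _ => //.
have -> : B * (b - a) = (\int[leb]_(t in `[a, b]) B)%R.
  rewrite Rintegral_cst//; congr (_ * _).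
  by rewrite /= lebesgue_measure_itv/= lte_fin; case: ltP => //= ba;
    apply/eqP; rewrite subr_eq0 eq_le ab ba.
apply: le_Rintegral => //.
- by apply: continuous_itv_integrable => t; apply: continuous_comp; [exact: cA|exact: norm_continuous].
- by apply: continuous_itv_integrable => t; exact: cvg_cst.
Qed.

(** The two integrals differ only by the end pieces over [[a, a + h]] and [[b, b + h]]. *)
Lemma Rintegral_shift_difference (A : R -> R) (a b h B : R) : continuous A ->
  a <= b -> 0 <= h -> (forall t, `|A t| <= B) ->
  `|(\int[leb]_(t in `[a, b]) (A (t + h) - A t))%R| <= (B + B) * h.
Proof.
move=> cA ab h0 AB.
have cAh : continuous (fun t => A (t + h)).
  move=> t; apply: continuous_comp; last exact: cA.
  by apply: continuousD; [exact: cvg_id|exact: cvg_cst].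
rewrite RintegralB//; [|exact: continuous_itv_integrable..].
have -> : (\int[leb]_(t in `[a, b]) A (t + h) = \int[leb]_(t in `[a + h, b + h]) A t)%R.
  by rewrite /Rintegral integral_shift.
have h1 := Rintegral_itv_split cA (_ : a <= a + h) (_ : a + h <= b + h).
have h2 := Rintegral_itv_split cA (_ : a <= b) (_ : b <= b + h).
rewrite lerDl lerD2r in h1; rewrite lerDl in h2.
have {}h1 := h1 h0 ab; have {}h2 := h2 ab h0.
have -> : (\int[leb]_(t in `[a + h, b + h]) A t - \int[leb]_(t in `[a, b]) A t =
   \int[leb]_(t in `[b, b + h]) A t - \int[leb]_(t in `[a, a + h]) A t)%R.
  by move: h1 h2; lra.
apply: le_trans (ler_normB _ _) _; rewrite mulrDl; apply: lerD.
  by rewrite -{2}[h](addrK b) (addrC h); apply: Rintegral_itv_bound; rewrite ?lerDl.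
by rewrite -{2}[h](addrK a) (addrC h); apply: Rintegral_itv_bound; rewrite ?lerDl.
Qed.

(** By dominated convergence the limit has integral zero over every interval, because a shift by
    [h k] changes such integrals by [O(h k)]; hence it vanishes almost everywhere. This is the
    source of the additivity of directional derivatives. *)
Lemma ae_shift_difference_cvg (A : nat -> R -> R) (h : nat -> R) (B : R) :
  (forall k, continuous (A k)) -> (forall k t, `|A k t| <= B) ->
  (forall k, 0 <= h k) -> h @ \oo --> 0 ->
  {ae leb, forall t, cvgn (fun k => A k (t + h k) - A k t)} ->
  {ae leb, forall t, (fun k => A k (t + h k) - A k t) @ \oo --> 0}.
Proof.
move=> cA AB h0 hcvg aeG.
pose G k t := A k (t + h k) - A k t.
have GB k t : `|G k t| <= B + B.
  by apply: le_trans (ler_normB _ _) _; exact: lerD.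
have cG k : continuous (G k).
  move=> t; apply: continuousB; last exact: cA.
  apply: continuous_comp; last exact: cA.
  by apply: continuousD; [exact: cvg_id|exact: cvg_cst].
pose w0 t := limn_sup (G ^~ t).
(* The upper limit is defined at every point; the truncation makes its bound immediate and does not
   affect actual limits. *)
pose w t := Num.max (- (B + B)) (Num.min (B + B) (w0 t)).
have B0 : 0 <= B + B by apply: le_trans (GB 0%N 0).
have mw0 : measurable_fun [set: R] w0.
  apply: measurable_fun_limn_sup => [t _|t _|k].
  - by exists (B + B) => _ [k _ <-]; apply: le_trans (ler_norm _) (GB k t).
  - by exists (- (B + B)) => _ [k _ <-]; have := GB k t; rewrite ler_norml => /andP[].
  - exact: continuous_measurable_fun.
have mw : measurable_fun [set: R] w.
  by apply: measurable_maxr => //; apply: measurable_minr.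
have wB t : `|w t| <= B + B.
  rewrite ler_norml /w le_max lexx /= ge_max ge_min lexx /=.
  by rewrite andbT; move: B0; lra.
have cvG t : cvgn (G ^~ t) -> G ^~ t @ \oo --> w t.
  move=> cv; have -> // : w t = limn (G ^~ t).
  rewrite /w /w0 cvg_limn_supE//.
  have l1 : limn (G ^~ t) <= B + B.
    by apply: limr_le => //; apply: nearW => k; apply: le_trans (ler_norm _) (GB k t).
  have l2 : - (B + B) <= limn (G ^~ t).
    by apply: limr_ge => //; apply: nearW => k; have := GB k t; rewrite ler_norml => /andP[].
  by rewrite (min_idPr l1) (max_idPr l2).
suff w0ae : {ae leb, forall t, w t = 0}.
  by have := ae_and aeG w0ae; apply: ae_imply => t [cv wt]; rewrite -wt; exact: cvG.
apply: (ae_eq0_of_itv_integrals mw wB) => a b ab.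
have intG k : leb.-integrable `[a, b] (EFin \o G k) by exact: continuous_itv_integrable.
have intw : leb.-integrable `[a, b] (EFin \o w).
  apply: (@measurable_bounded_integrable _ _ R leb) => //.
  - by apply: compact_finite_measure; exact: segment_compact.
  - exact: measurable_funTS.
  - exists (B + B); split; first by rewrite num_real.
    by move=> x Bx t _; apply: le_trans (wB t) (ltW Bx).
have Gw : {ae leb, forall t, `[a, b]%classic t ->
    (fun k => (G k t)%:E) @ \oo --> (w t)%:E}.
  move: aeG; apply: ae_imply => t cv _.
  by apply: cvg_EFin; [exact: nearW|exact: cvG].
have intB : leb.-integrable `[a, b] (fun=> (B + B)%:E).
  by apply: continuous_itv_integrable => t; exact: cvg_cst.
have GleB : {ae leb, forall t k, `[a, b]%classic t -> (`|(G k t)%:E| <= (B + B)%:E)%E}.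
  by apply: aeW => t k _; rewrite lee_fin.
have [_ _ cvI] := @dominated_convergence _ (measurableTypeR R) R leb
  `[a, b]%classic (measurable_itv _) (fun k t => (G k t)%:E) (fun t => (w t)%:E)
  (fun=> (B + B)%:E) (fun k => measurable_int leb (intG k))
  (measurable_int leb intw) Gw intB GleB.
have : (fun k => (\int[leb]_(t in `[a, b]) G k t)%R) @ \oo -->
    (\int[leb]_(t in `[a, b]) w t)%R.
  apply: fine_cvg; rewrite fineK//; exact: integrable_fin_num.
move=> /cvg_lim <-//; apply: cvg_lim => //.
apply/norm_cvg0P; apply: (@squeeze_cvgr _ _ _ _ (cst 0) (fun k => (B + B) * h k)).
- apply: nearW => k; rewrite normr_ge0/=; apply: Rintegral_shift_difference => //.
  exact: ltW.
- exact: cvg_cst.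
- by rewrite -[X in _ --> X](mulr0 (B + B)); apply: cvgMr.
Qed.

End shift_difference.

(** * Rademacher's theorem *)

Section directional.
Context (R : realType) (n : nat).
Local Notation T := (measurableTypeR R).
Local Notation leb := (@lebesgue_measure R).
Local Notation vec := 'rV[R]_n.+1.
Variables (F : vec -> R) (L : R).
Hypothesis FL : forall x y, `|F x - F y| <= L * `|x - y|.
Implicit Types (u v x : vec) (h s : R).

Definition dquot u h x : R := h^-1 * (F (x + h *: u) - F x).

(* Rational increments keep these conditions Borel. *)
Definition dir_cauchy u : set vec := [set x | forall m : nat, exists p : nat,
  forall h h' : rat, 0 < `|ratr h : R| < p.+1%:R^-1 ->
    0 < `|ratr h' : R| < p.+1%:R^-1 ->
    `|dquot u (ratr h) x - dquot u (ratr h') x| <= m.+1%:R^-1].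

Definition dir_additive u v : set vec := [set x | forall m : nat, exists p : nat,
  forall h : rat, 0 < `|ratr h : R| < p.+1%:R^-1 ->
    `|dquot (u + v) (ratr h) x - dquot u (ratr h) x - dquot v (ratr h) x|
      <= m.+1%:R^-1].

Let L_ge0 : 0 <= L.
Proof.
have := FL (const_mx 1) 0; rewrite subr0 => H.
have n0 : 0 < `|const_mx 1 : vec|.
  by apply: lt_le_trans (rV_coord_le_norm (const_mx 1) ord0); rewrite mxE normr1.
by rewrite -(pmulr_lge0 _ n0); exact: le_trans (normr_ge0 _) H.
Qed.

Lemma dquot_le u h x : `|dquot u h x| <= L * `|u|.
Proof.
rewrite /dquot normrM normfV.
have [->|h0] := eqVneq h 0; first by rewrite normr0 invr0 mul0r mulr_ge0.
rewrite mulrC ler_pdivrMr ?normr_gt0//; apply: le_trans (FL _ _) _.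
by rewrite addrAC subrr add0r normrZ -mulrA (mulrC `|u|).
Qed.

Let shift_lip w x y : `|F (x + w) - F (y + w)| <= L * `|x - y|.
Proof. by apply: le_trans (FL _ _) _; rewrite opprD addrACA subrr addr0. Qed.

Lemma measurable_dquot u h :
  measurable_fun [set: n.+1.-tuple T] (dquot u h \o @row_of_tuple R n).
Proof.
apply: measurable_funM => //; apply: measurable_funB.
  exact: (measurable_lipschitz_row (shift_lip (h *: u))).
exact: (measurable_lipschitz_row FL).
Qed.

Let measurable_le (g : vec -> R) (c : R) :
  measurable_fun [set: n.+1.-tuple T] (g \o @row_of_tuple R n) ->
  measurable [set t : n.+1.-tuple T | `|g (row_of_tuple t)| <= c].
Proof.
move=> mg; have mf : measurable_fun [set: n.+1.-tuple T]
    (fun t : n.+1.-tuple T => `|g (row_of_tuple t)|) by exact: measurableT_comp.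
have := mf measurableT `]-oo, c]%classic (measurable_itv _); rewrite setTI.
by congr measurable; apply/seteqP; split => t /=; rewrite in_itv.
Qed.

Let measurable_imply (C : Prop) (A : set (n.+1.-tuple T)) :
  measurable A -> measurable [set t | C -> A t].
Proof.
move=> mA; have [c|nc] := pselect C.
  by rewrite (_ : [set t | _] = A)//; apply/seteqP; split => t /=; [apply|].
by rewrite (_ : [set t | _] = setT)//; apply/seteqP; split => t /=.
Qed.

Let measurable_forall (I : countType) (A : I -> set (n.+1.-tuple T)) :
  (forall i, measurable (A i)) -> measurable [set t | forall i, A i t].
Proof.
move=> mA; rewrite (_ : [set t | _] = ~` (\bigcup_i ~` A i)).
  apply: measurableC; apply: countable_bigcupT_measurable; first exact: countableP.
  by move=> i; exact: measurableC.
apply/seteqP; split => t /= H; first by move=> [i _]; apply; exact: H.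
by move=> i; apply: contrapT => nA; apply: H; exists i.
Qed.

Let measurable_exists (A : nat -> set (n.+1.-tuple T)) :
  (forall i, measurable (A i)) -> measurable [set t | exists i, A i t].
Proof.
move=> mA; rewrite (_ : [set t | _] = \bigcup_i A i); first exact: bigcupT_measurable.
by apply/seteqP; split => t /= [i]; exists i.
Qed.

Lemma measurable_dir_cauchy u : measurable (@row_of_tuple R n @^-1` dir_cauchy u).
Proof.
apply: measurable_forall => m; apply: measurable_exists => p.
do 2 apply: measurable_forall => ?; do 2 apply: measurable_imply.
apply: (@measurable_le (fun x => dquot u _ x - dquot u _ x)).
by apply: measurable_funB; exact: measurable_dquot.
Qed.

Lemma measurable_dir_additive u v :
  measurable (@row_of_tuple R n @^-1` dir_additive u v).
Proof.
apply: measurable_forall => m; apply: measurable_exists => p.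
apply: measurable_forall => h; apply: measurable_imply.
apply: (@measurable_le (fun x => dquot (u + v) _ x - dquot u _ x - dquot v _ x)).
apply: measurable_funB; last exact: measurable_dquot.
by apply: measurable_funB; exact: measurable_dquot.
Qed.

Lemma line_lip x u s t : `|F (x + s *: u) - F (x + t *: u)| <= (L * `|u|) * `|s - t|.
Proof.
apply: le_trans (FL _ _) _.
by rewrite opprD addrACA subrr add0r -scalerBl normrZ mulrA mulrAC.
Qed.

Lemma ae_dir_cauchy_line x u : {ae leb, forall s, dir_cauchy u (x + s *: u)}.
Proof.
have := lipschitz_ae_derivable (line_lip x u); apply: ae_imply => s ds m.
have e0 : 0 < m.+1%:R^-1 / 2 :> R by rewrite divr_gt0// invr_gt0.
have [d d0 Hd] := derivable_increment ds e0.
set D := derive1 _ s in Hd.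
have key h : 0 < `|h| -> `|h| < d -> `|dquot u h (x + s *: u) - D| <= m.+1%:R^-1 / 2.
  move=> h0 hd; have := Hd (s + h); rewrite addrAC subrr add0r => /(_ hd).
  rewrite scalerDl addrA => H.
  have hn0 : h != 0 by rewrite -normr_gt0.
  have -> : dquot u h (x + s *: u) - D =
      h^-1 * (F (x + s *: u + h *: u) - F (x + s *: u) - h * D).
    by rewrite /dquot [RHS]mulrBr mulKf.
  by rewrite normrM normfV mulrC ler_pdivrMr.
have [p pd] : exists p : nat, p.+1%:R^-1 < d.
  exists (Num.truncn d^-1); rewrite invf_plt ?posrE//; exact: truncnS_gt.
exists p => h h' /andP[h0 hp] /andP[h0' hp'].
have := key _ h0 (lt_trans hp pd); have := key _ h0' (lt_trans hp' pd).
move: (m.+1%:R^-1) => e; rewrite !ler_norml => /andP[a1 a2] /andP[b1 b2].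
by apply/andP; split; lra.
Qed.

(** The one-dimensional theorem applies on every line parallel to [u], and a Borel set of full
    measure on such lines has full measure. *)
Lemma iter_ae_dir_cauchy u :
  iter_ae (@row_of_tuple R n @^-1` dir_cauchy u).
Proof.
apply/(iter_ae_lineP (coord_fun u) (measurable_dir_cauchy u)).
apply: iter_ae_imply (_ : iter_ae setT) => [t _ /=|]; last first.
  by elim: n.+1 => [//|k IH] /=; apply: aeW.
have := ae_dir_cauchy_line (row_of_tuple t) u; apply: ae_imply => s.
by rewrite -row_of_tuple_shift.
Qed.

End directional.

Lemma cauchy_cvgn (R : realType) (u : nat -> R) :
  (forall e, 0 < e -> exists N : nat, forall i j, (N <= i)%N -> (N <= j)%N ->
    `|u i - u j| <= e) -> cvgn u.
Proof.
move=> H; apply/cauchy_cvgP/cauchy_ballP => e e0.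
have e20 : 0 < e / 2 by rewrite divr_gt0.
have [N HN] := H _ e20.
exists (u @` [set i | (N <= i)%N], u @` [set i | (N <= i)%N]) => /=.
  by split; exists N => // i /= Ni; exists i.
move=> [_ _] [/= [i /= Ni <-] [j /= Nj <-]]; rewrite /ball/=.
apply: le_lt_trans (HN i j Ni Nj) _.
by rewrite ltr_pdivrMr// ltr_pMr// ltrDl.
Qed.

Lemma inv_nat_small (R : realType) (d : R) : 0 < d ->
  exists N : nat, forall k, (N <= k)%N -> k.+1%:R^-1 < d.
Proof.
move=> d0; exists (Num.truncn d^-1) => k Nk.
rewrite invf_plt ?posrE//; apply: (lt_le_trans (truncnS_gt _)).
by rewrite ler_nat ltnS.
Qed.

Section additivity.
Context (R : realType) (n : nat).
Local Notation leb := (@lebesgue_measure R).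
Local Notation vec := 'rV[R]_n.+1.
Variables (F : vec -> R) (L : R).
Hypothesis FL : forall x y, `|F x - F y| <= L * `|x - y|.
Implicit Types (u v x : vec) (h s : R).
Local Notation dq := (dquot F).

Lemma ratr_inv_nat k : ratr (k.+1%:R^-1) = k.+1%:R^-1 :> R.
Proof. by rewrite fmorphV/= ratr_nat. Qed.

Lemma dir_cauchy_cvgn u x : dir_cauchy F u x -> cvgn (fun k => dq u k.+1%:R^-1 x).
Proof.
move=> C; apply: cauchy_cvgn => e e0.
have [m me] := inv_nat_small e0; have [p Hp] := C m.
exists p.+1 => i j pi pj.
have small k : (p.+1 <= k)%N -> 0 < `|ratr (k.+1%:R^-1) : R| < p.+1%:R^-1.
  move=> pk; rewrite ratr_inv_nat gtr0_norm ?invr_gt0 ?ltr0n//.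
  by apply/andP; split; rewrite ?invr_gt0 ?ltr0n// ltf_pV2 ?posrE// ltr_nat ltnS.
have := Hp _ _ (small i pi) (small j pj); rewrite !ratr_inv_nat => /le_trans; apply.
by apply/ltW/me.
Qed.

Let Q u v h x := dq (u + v) h x - dq u h x - dq v h x.

(** The Cauchy conditions compare an arbitrary small rational step with one fixed step
    [1 / (k + 1)]. Three such comparisons and the sequence itself give four errors, whence the
    factor 4 in [m']. *)
Lemma dir_additive_seq u v x : dir_cauchy F u x -> dir_cauchy F v x ->
  dir_cauchy F (u + v) x -> (fun k => Q u v k.+1%:R^-1 x) @ \oo --> 0 ->
  dir_additive F u v x.
Proof.
move=> Cu Cv Cuv Q0 m; pose m' := (4 * m + 3)%N.
have m'E : m'.+1%:R^-1 = m.+1%:R^-1 / 4 :> R.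
  by rewrite (_ : m'.+1 = 4 * m.+1)%N ?natrM ?invfM 1?mulrC// /m' mulnS -addnS addnC.
have [p1 H1] := Cu m'; have [p2 H2] := Cv m'; have [p3 H3] := Cuv m'.
pose p := maxn p1 (maxn p2 p3).
have pp k : (k <= p)%N -> p.+1%:R^-1 <= k.+1%:R^-1 :> R.
  by move=> kp; rewrite lef_pV2 ?posrE// ler_nat.
have e0 : 0 < m.+1%:R^-1 / 4 :> R by rewrite divr_gt0// invr_gt0.
have /cvgrPdist_le/(_ _ e0)[N1 _ HN1] := Q0.
have pi0 : 0 < p.+1%:R^-1 :> R by rewrite invr_gt0.
have [N2 HN2] := inv_nat_small pi0.
pose k := maxn N1 N2.
exists p => h /andP[h0 hp].
have hk : 0 < `|ratr (k.+1%:R^-1) : R| < p.+1%:R^-1.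
  rewrite ratr_inv_nat gtr0_norm ?invr_gt0 ?ltr0n//.
  by rewrite HN2 ?leq_maxr// andbT invr_gt0.
have hkE := ratr_inv_nat k.
have /= := HN1 k (leq_maxl _ _); rewrite sub0r normrN -hkE => Qk.
move/andP: hk => [hk0 hkp].
have bnd j : (j <= p)%N -> (0 < `|ratr h : R| < j.+1%:R^-1) * (0 < `|ratr k.+1%:R^-1 : R| < j.+1%:R^-1).
  by move=> /pp jp; rewrite h0 hk0 (lt_le_trans hp jp) (lt_le_trans hkp jp).
have b1 := bnd p1 (leq_maxl _ _).
have b2 := bnd p2 (leq_trans (leq_maxl _ _) (leq_maxr _ _)).
have b3 := bnd p3 (leq_trans (leq_maxr _ _) (leq_maxr _ _)).
have := H1 _ _ b1.1 b1.2; have := H2 _ _ b2.1 b2.2; have := H3 _ _ b3.1 b3.2.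
rewrite m'E; move: Qk; rewrite /Q; move: (m.+1%:R^-1) => e.
rewrite !ler_norml => /andP[? ?] /andP[? ?] /andP[? ?] /andP[? ?].
by apply/andP; split; lra.
Qed.

(** Along a line parallel to [u], the additivity defect at step [h] is the difference of the
    quotients in direction [v] at [s + h] and at [s]. These quotients are bounded, so a convergent
    defect tends to zero almost everywhere. *)
Lemma ae_dir_additive_line x u v :
  {ae leb, forall s, dir_cauchy F u (x + s *: u)} ->
  {ae leb, forall s, dir_cauchy F v (x + s *: u)} ->
  {ae leb, forall s, dir_cauchy F (u + v) (x + s *: u)} ->
  {ae leb, forall s, dir_additive F u v (x + s *: u)}.
Proof.
move=> Cu Cv Cuv.
pose A k s := dq v k.+1%:R^-1 (x + s *: u).
have cA k : continuous (A k).
  have cF w : continuous (fun s => F (x + s *: u + w)).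
    move=> s; apply/(@cvgrPdist_le _ R^o) => e e0.
    have K1 : 0 < `|L * `|u| | + 1 by rewrite ltr_wpDl.
    near=> t.
    have : `|F (x + s *: u + w) - F (x + t *: u + w)| <= L * `|u| * `|s - t|.
      by rewrite (addrAC x (s *: u)) (addrAC x (t *: u)); exact: (line_lip FL).
    move=> /le_trans; apply.
    apply: (@le_trans _ _ ((`|L * `|u| | + 1) * `|s - t|)).
      by rewrite ler_wpM2r// (le_trans (ler_norm _))// lerDl.
    rewrite -ler_pdivlMl//; near: t; apply: cvgr_dist_le; first exact: cvg_id.
    by rewrite mulr_gt0// invr_gt0.
  have -> : A k = (k.+1%:R^-1)^-1 *: ((fun s => F (x + s *: u + k.+1%:R^-1 *: v))
      - (fun s => F (x + s *: u + 0))).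
    by apply/funext => s; rewrite /A /dquot !fctE addr0.
  move=> s; apply: continuousZr; apply: continuousB; exact: cF.
have AB k s : `|A k s| <= L * `|v| by exact: dquot_le.
have QE k s : Q u v k.+1%:R^-1 (x + s *: u) = A k (s + k.+1%:R^-1) - A k s.
  rewrite /Q /A /dquot -mulrBr.
  rewrite (_ : F _ - _ - _ = F (x + s *: u + k.+1%:R^-1 *: (u + v))
    - F (x + s *: u + k.+1%:R^-1 *: u)); last by ring.
  by rewrite scalerDl scalerDr !addrA.
have : {ae leb, forall s, (fun k => A k (s + k.+1%:R^-1) - A k s) @ \oo --> 0}.
  apply: (ae_shift_difference_cvg cA AB) => [k||]; first by rewrite invr_ge0.
    exact: cvg_harmonic.
  have := ae_and Cu (ae_and Cv Cuv); apply: ae_imply => s [cu [cv cuv]].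
  rewrite (_ : (fun k => _) = (fun k => dq (u + v) k.+1%:R^-1 (x + s *: u)) -
    (fun k => dq u k.+1%:R^-1 (x + s *: u)) - (fun k => dq v k.+1%:R^-1 (x + s *: u))).
    by apply: is_cvgB; [apply: is_cvgB|]; exact: dir_cauchy_cvgn.
  by apply/funext => k; rewrite -QE.
move=> Q0; have := ae_and Q0 (ae_and Cu (ae_and Cv Cuv)).
apply: ae_imply => s [q0 [cu [cv cuv]]]; apply: dir_additive_seq => //.
by under eq_fun do rewrite QE.
Unshelve. all: end_near. Qed.

Lemma iter_ae_dir_additive u v :
  iter_ae (@row_of_tuple R n @^-1` dir_additive F u v).
Proof.
apply/(iter_ae_lineP (coord_fun u) (measurable_dir_additive FL u v)).
have line w := (iter_ae_lineP (coord_fun u) (measurable_dir_cauchy FL w)).2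
  (iter_ae_dir_cauchy FL w).
have := iter_ae_and (line u) (iter_ae_and (line v) (line (u + v))).
apply: iter_ae_imply => t [/= lu [lv luv]].
have conv (P : set vec) : {ae leb, forall s,
    (@row_of_tuple R n @^-1` P) (tuple_shift t (fun i => s * coord_fun u i))} <->
    {ae leb, forall s, P (row_of_tuple t + s *: u)}.
  by split; apply: ae_imply => s /=; rewrite row_of_tuple_shift.
apply: (conv (dir_additive F u v)).2; apply: ae_dir_additive_line.
- exact: (conv (dir_cauchy F u)).1.
- exact: (conv (dir_cauchy F v)).1.
- exact: (conv (dir_cauchy F (u + v))).1.
Qed.

End additivity.

Section dot_row.
Context (R : realType) (n : nat) (w : 'I_n.+1 -> R).

Definition dot_row (v : 'rV[R]_n.+1) : R := \sum_i v 0 i * w i.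

Let dot_row_linear : linear (dot_row : 'rV[R]_n.+1 -> R^o).
Proof.
move=> a u v; rewrite /dot_row scaler_sumr -big_split/=; apply: eq_bigr => i _.
by rewrite !mxE mulrDl -mulrA.
Qed.

HB.instance Definition _ := GRing.isLinear.Build R 'rV[R]_n.+1 R^o _ dot_row
  dot_row_linear.

Lemma dot_rowZ a v : dot_row (a *: v) = a * dot_row v.
Proof. by rewrite /dot_row mulr_sumr; apply: eq_bigr => i _; rewrite mxE mulrA. Qed.

Lemma dot_rowB u v : dot_row (u - v) = dot_row u - dot_row v.
Proof. by rewrite /dot_row -sumrB; apply: eq_bigr => i _; rewrite !mxE mulrBl. Qed.

Lemma dot_row_le v : `|dot_row v| <= (\sum_i `|w i|) * `|v|.
Proof.
apply: le_trans (ler_norm_sum _ _ _) _; rewrite mulr_suml; apply: ler_sum => i _.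
by rewrite normrM mulrC ler_wpM2l// rV_coord_le_norm.
Qed.

Lemma dot_row_continuous : continuous (dot_row : 'rV[R]_n.+1 -> R^o).
Proof.
apply: (@lipschitz_rV_continuous _ _ _ (\sum_i `|w i|)) => u v.
by rewrite -dot_rowB; exact: dot_row_le.
Qed.

End dot_row.

Section frechet.
Context (R : realType) (n : nat).
Local Notation leb := (@lebesgue_measure R).
Local Notation vec := 'rV[R]_n.+1.
Local Notation rvec := 'rV[rat]_n.+1.
Variables (F : vec -> R) (L : R).
Hypothesis FL : forall x y, `|F x - F y| <= L * `|x - y|.
Local Notation dq := (dquot F).
Local Notation rr := (@rat_row R n).

(** Only rational directions occur, which keeps the conditions countable; Lipschitz continuity
    supplies the other directions. *)
Definition regular_point : set vec :=
  [set x | (forall u : rvec, dir_cauchy F (rr u) x) /\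
           (forall u v : rvec, dir_additive F (rr u) (rr v) x)].

Lemma finite_min_pos (I : finType) (d : I -> R) : (forall i, 0 < d i) ->
  exists2 e, 0 < e & forall i, e <= d i.
Proof.
move=> d0; exists (\big[Num.min/1]_i d i).
  by apply: lt_bigmin.
by move=> i; apply: bigmin_le_cond.
Qed.

Section at_regular_point.
Variable x : vec.
Hypothesis xr : regular_point x.

Let d (u : rvec) : R := limn (fun k => dq (rr u) k.+1%:R^-1 x).

Let d_cvg u : (fun k => dq (rr u) k.+1%:R^-1 x) @ \oo --> d u.
Proof. by apply: dir_cauchy_cvgn; exact: xr.1. Qed.

Let d_approx u e : 0 < e -> exists2 r, 0 < r & forall h : rat,
  0 < `|ratr h : R| < r -> `|dq (rr u) (ratr h) x - d u| <= e.
Proof.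
move=> e0; have [m me] := inv_nat_small e0; have [p Hp] := xr.1 u m.
exists p.+1%:R^-1 => [|h hp]; first by rewrite invr_gt0.
have cv : (fun k => `|dq (rr u) (ratr h) x - dq (rr u) k.+1%:R^-1 x|) @ \oo -->
    `|dq (rr u) (ratr h) x - d u|.
  by apply: cvg_norm; apply: cvgB; [exact: cvg_cst|exact: d_cvg].
rewrite -(cvg_lim _ cv)//; apply: limr_le; first by apply/cvg_ex; eexists; exact: cv.
have p0 : 0 < p.+1%:R^-1 :> R by rewrite invr_gt0.
have [N HN] := inv_nat_small p0.
exists N => // k /= Nk; rewrite -ratr_inv_nat.
apply: le_trans (ltW (me m _)) => //; apply: Hp => //.
rewrite ratr_inv_nat gtr0_norm ?invr_gt0 ?ltr0n//.
by rewrite HN// andbT invr_gt0.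
Qed.

Let d_unique u l : (forall e, 0 < e -> exists2 r, 0 < r & forall h : rat,
  0 < `|ratr h : R| < r -> `|dq (rr u) (ratr h) x - l| <= e) -> d u = l.
Proof.
move=> H; apply: cvg_lim => //; apply/cvgrPdist_le => e e0.
have [r r0 Hr] := H e e0; have [N HN] := inv_nat_small r0.
exists N => // k /= Nk; rewrite distrC -ratr_inv_nat; apply: Hr.
rewrite ratr_inv_nat gtr0_norm ?invr_gt0 ?ltr0n//.
by rewrite HN// andbT invr_gt0.
Qed.

Let rrD u v : rr (u + v) = rr u + rr v.
Proof. exact: map_mxD. Qed.

Let rrZ c u : rr (c *: u) = ratr c *: rr u.
Proof. exact: map_mxZ. Qed.

Let dD u v : d (u + v) = d u + d v.
Proof.
apply: d_unique => e e0.
have e30 : 0 < e / 3 by rewrite divr_gt0.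
have [m me] := inv_nat_small e30.
have [p Hp] := xr.2 u v m.
have [r1 r10 H1] := d_approx u e30; have [r2 r20 H2] := d_approx v e30.
exists (Num.min p.+1%:R^-1 (Num.min r1 r2)).
  by rewrite !lt_min r10 r20 invr_gt0 ltr0n.
move=> h; rewrite !lt_min => /and4P[h0 hp h1 h2].
have := Hp h; rewrite h0 hp => /(_ isT) /le_trans/(_ (ltW (me m (leqnn m)))).
have := H1 h; rewrite h0 h1 => /(_ isT); have := H2 h; rewrite h0 h2 => /(_ isT).
rewrite -rrD !ler_norml => /andP[? ?] /andP[? ?] /andP[? ?].
by apply/andP; split; lra.
Qed.

Let dZ c u : d (c *: u) = ratr c * d u.
Proof.
apply: d_unique => e e0.
have [->|c0] := eqVneq c 0.
  exists 1 => // h _; have rr0 : rr 0 = 0 by exact: map_mx0.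
  by rewrite scale0r rr0 /dquot scaler0 addr0 subrr mulr0 rmorph0 mul0r subrr normr0 ltW.
have rc0 : 0 < `|ratr c : R| by rewrite normr_gt0 fmorph_eq0.
have ec : 0 < e / `|ratr c| by rewrite divr_gt0.
have [r r0 Hr] := d_approx u ec.
exists (r / `|ratr c|) => [|h /andP[h0 hr]]; first by rewrite divr_gt0.
have := Hr (h * c); rewrite rmorphM normrM mulr_gt0//=.
rewrite -ltr_pdivlMr// hr => /(_ isT) H.
have -> : dq (rr (c *: u)) (ratr h) x = ratr c * dq (rr u) (ratr h * ratr c) x.
  rewrite /dquot rrZ scalerA [RHS]mulrA [in RHS]invfM (mulrCA (ratr c)).
  by rewrite divff ?mulr1// -normr_gt0.
by rewrite -mulrBr normrM -ler_pdivlMl// (mulrC _ e).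
Qed.

Let w i := d (delta_mx 0 i).

Let d_dot u : d u = dot_row w (rr u).
Proof.
rewrite /dot_row {1}[u]row_sum_delta.
have d0 : d 0 = 0 by have := dZ 0 0; rewrite scale0r rmorph0 mul0r.
rewrite (big_morph d dD d0); apply: eq_bigr => i _.
by rewrite dZ !mxE.
Qed.

(** The directional derivatives are additive and homogeneous over the rationals, so they come from a
    linear form. A finite net of rational directions makes the convergence of difference quotients
    uniform. *)
Lemma regular_point_differentiable : differentiable F x.
Proof.
apply: (@increment_differentiable R vec R^o F x (dot_row w) _ _).1.
  exact: dot_row_continuous.
move=> e e0; pose C := \sum_i `|w i|.
have C0 : 0 <= C by apply: sumr_ge0.
have L0 : 0 <= `|L| by [].
(* Passing to a net point costs [L] in [F] and [C] in the linear form, and the quotient at the net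
   point costs [1], each times [eta]. *)
pose K := `|L| + 1 + C.
have K0 : 0 < K by rewrite /K; lra.
pose eta := e / (2 * K).
have eta0 : 0 < eta by rewrite divr_gt0// mulr_gt0.
have [M0 HM] := inv_nat_small eta0; pose M := M0.+1.
have M0' : 0 < M%:R :> R by rewrite ltr0n.
(* Lattice points of mesh [1 / M] in the unit ball of the sup norm. *)
pose U (j : {ffun 'I_n.+1 -> 'I_(2 * M).+1}) : rvec :=
  \row_i ((j i : nat)%:R / M%:R - 1).
have net z : `|z| <= 1 -> exists j, `|z - rr (U j)| <= eta.
  move=> z1; pose k i := Num.truncn ((z 0 i + 1) * M%:R).
  have zi i : -1 <= z 0 i <= 1.
    by rewrite -ler_norml; apply: le_trans (rV_coord_le_norm z i) z1.
  have zpos i : 0 <= (z 0 i + 1) * M%:R.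
    by rewrite mulr_ge0// -lerBlDr sub0r; case/andP: (zi i).
  have kM i : (k i < (2 * M).+1)%N.
    rewrite ltnS -(ler_nat R); apply: (@le_trans _ _ ((z 0 i + 1) * M%:R)).
      by rewrite truncn_le.
    rewrite natrM ler_wpM2r//; case/andP: (zi i) => _ ?; lra.
  exists [ffun i => Ordinal (kM i)].
  apply: rV_norm_le => [|i]; first exact: ltW.
  rewrite !mxE ffunE/= rmorphB/= rmorph1 fmorph_div/= !ratr_nat.
  have t1 : (k i)%:R <= (z 0 i + 1) * M%:R by rewrite truncn_le.
  have t2 : (z 0 i + 1) * M%:R < (k i).+1%:R by exact: truncnS_gt.
  have {}t1 : (k i)%:R / M%:R <= z 0 i + 1 by rewrite ler_pdivrMr.
  have {}t2 : z 0 i + 1 < (k i)%:R / M%:R + M%:R^-1.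
    by rewrite -ltr_pdivlMr// -natr1 mulrDl mul1r in t2.
  have := HM M0 (leqnn _); rewrite -/M => etaM.
  by rewrite ler_norml; apply/andP; split; lra.
have /choice[rf Hrf] : forall j, exists r, 0 < r /\ forall h : rat,
    0 < `|ratr h : R| < r -> `|dq (rr (U j)) (ratr h) x - d (U j)| <= eta.
  by move=> j; have [r r0 Hr] := d_approx (U j) eta0; exists r.
have [r r0 rle] := finite_min_pos (fun j => (Hrf j).1).
exists (r / 2) => [|v vr]; first by rewrite divr_gt0.
have [->|v0] := eqVneq v 0.
  by rewrite addr0 subrr raddf0 subrr !normr0 mulr0.
have nv : 0 < `|v| by rewrite normr_gt0.
(* Only rational steps are controlled, so [v] is written as [rho *: z] with a rational [rho] between
   its norm and twice its norm; the factor 2 was reserved in [eta]. *)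
have : `|v| < 2 * `|v| by rewrite ltr_pMl// ltrDl.
move=> /rat_in_itvoo[q]; rewrite in_itv/= => /andP[q1 q2].
set rho := ratr q in q1 q2.
have rho0 : 0 < rho by exact: lt_trans q1.
have rhor : rho < r by apply: lt_trans q2 _; move: vr; lra.
pose z := rho^-1 *: v.
have vz : v = rho *: z by rewrite /z scalerA divff ?scale1r ?gt_eqF.
have z1 : `|z| <= 1.
  by rewrite normrZ normfV (gtr0_norm rho0) ler_pdivrMl// mulr1 ltW.
have [j Hj] := net z z1.
have [rj0 /(_ q)] := Hrf j; rewrite -/rho gtr0_norm// rho0 (lt_le_trans rhor (rle j)) => /(_ isT).
rewrite d_dot; set u := rr (U j) in Hj *; move=> Hu.
have Hu' : `|F (x + rho *: u) - F x - rho * dot_row w u| <= rho * eta.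
  have -> : F (x + rho *: u) - F x - rho * dot_row w u =
      rho * (dq u rho x - dot_row w u).
    by rewrite mulrBr /dquot mulVKf// gt_eqF.
  by rewrite normrM gtr0_norm// ler_pM2l.
have H1 : `|F (x + v) - F (x + rho *: u)| <= rho * (`|L| * eta).
  apply: le_trans (FL _ _) _.
  rewrite opprD addrACA subrr add0r vz -scalerBr normrZ gtr0_norm// mulrCA.
  rewrite ler_pM2l//; apply: (@le_trans _ _ (`|L| * `|z - u|)).
    by rewrite ler_wpM2r// ler_norm.
  by rewrite ler_wpM2l.
have H2 : `|rho * dot_row w u - dot_row w v| <= rho * (C * eta).
  rewrite vz dot_rowZ -mulrBr normrM gtr0_norm// ler_pM2l// distrC -dot_rowB.
  apply: le_trans (dot_row_le _ _) _.
  by rewrite ler_wpM2l.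
have : `|F (x + v) - F x - dot_row w v| <= rho * (K * eta).
  have -> : F (x + v) - F x - dot_row w v = (F (x + v) - F (x + rho *: u))
    + (F (x + rho *: u) - F x - rho * dot_row w u)
    + (rho * dot_row w u - dot_row w v) by ring.
  apply: le_trans (ler_normD _ _) _; apply: le_trans (lerD (ler_normD _ _) (lexx _)) _.
  by move: H1 Hu' H2; rewrite /K; lra.
move=> /le_trans; apply.
have -> : K * eta = e / 2 by rewrite /eta; field; rewrite gt_eqF.
have : rho * e <= 2 * `|v| * e by rewrite ler_pM2r// ltW.
lra.
Qed.

End at_regular_point.

End frechet.

(** * Mean value inequality in several variables *)

Section mean_value.
Context (R : realType) (n : nat).
Local Notation T := (measurableTypeR R).
Local Notation leb := (@lebesgue_measure R).
Local Notation vec := 'rV[R]_n.+1.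

Lemma line_derive1 (V : normedModType R) (F : V -> R) (z v : V) (s : R) :
  differentiable F (z + s *: v) ->
  derivable (fun s : R => F (z + s *: v)) s 1 /\
  derive1 (fun s : R => F (z + s *: v)) s = 'd F (z + s *: v) v.
Proof.
move=> dF; apply: increment_derivable => e e0.
have v1 : 0 < `|v| + 1 by rewrite ltr_wpDl.
have ev : 0 < e / (`|v| + 1) by rewrite divr_gt0.
have [d d0 Hd] := differentiable_increment dF ev.
exists (d / (`|v| + 1)) => [|t td]; first by rewrite divr_gt0.
have tv : `|(t - s) *: v| < d.
  rewrite normrZ; apply: (@le_lt_trans _ _ (`|t - s| * (`|v| + 1))).
    by rewrite ler_wpM2l// lerDl.
  by rewrite -ltr_pdivlMr.
have := Hd _ tv; rewrite -(addrA z) -scalerDl (addrC s) subrK.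
rewrite linearZ => /le_trans; apply.
rewrite normrZ mulrACA ler_piMr ?mulr_ge0 ?(ltW e0)//.
by rewrite mulrC ler_pdivrMr// mul1r lerDl.
Qed.

Variables (F : vec -> R) (L : R).
Hypothesis FL : forall x y, `|F x - F y| <= L * `|x - y|.

(** The argument on parallel lines needs a measurable set, so the countably many regularity
    conditions are intersected instead of taking all points of differentiability. *)
Lemma regular_point_ae : exists E : set (n.+1.-tuple T),
  [/\ measurable E, iter_ae E & forall t, E t -> differentiable F (row_of_tuple t)].
Proof.
pose C (i : nat) : set (n.+1.-tuple T) :=
  if unpickle i is Some u then @row_of_tuple R n @^-1` dir_cauchy F (rat_row R u) else setT.
pose A (i : nat) : set (n.+1.-tuple T) :=
  if unpickle i is Some (u, v) then
    @row_of_tuple R n @^-1` dir_additive F (rat_row R u) (rat_row R v) else setT.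
have aeT : iter_ae (setT : set (n.+1.-tuple T)).
  by elim: n.+1 => [//|k IH] /=; apply: aeW.
exists ((\bigcap_i C i) `&` (\bigcap_i A i)); split.
- apply: measurableI; apply: bigcapT_measurable => i.
    rewrite /C; case: unpickle => [u|//]; exact: (measurable_dir_cauchy FL).
  rewrite /A; case: unpickle => [[u v]|//]; exact: (measurable_dir_additive FL).
- apply: iter_ae_and; apply: iter_ae_foralln => i.
    rewrite /C; case: unpickle => [u|//]; exact: (iter_ae_dir_cauchy FL).
  rewrite /A; case: unpickle => [[u v]|//]; exact: (iter_ae_dir_additive FL).
- move=> t [Ct At]; apply: (regular_point_differentiable FL); split => u.
    by have := Ct (pickle u) Logic.I; rewrite /C pickleK.
  by move=> v; have := At (pickle (u, v)) Logic.I; rewrite /A pickleK.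
Qed.

(* By Rademacher's theorem the derivative hypothesis holds almost everywhere on
   segments parallel to v that start arbitrarily close to y. *)
Lemma lipschitz_mean_value (c y v : vec) (r m : R) :
  `|y - c| < r -> `|y + v - c| < r ->
  (forall z, `|z - c| < r -> differentiable F z -> m <= 'd F z v) ->
  m <= F (y + v) - F y.
Proof.
move=> yr yvr Hm; apply/ler_addgt0Pr => e e0.
have L0 : 0 <= `|L| by [].
(* The first bound makes the displacement of the two endpoints by [w] cost at most [e] in total; the
   others keep the displaced segment in the ball. *)
pose d := Num.min (e / (2 * (`|L| + 1))) (Num.min (r - `|y - c|) (r - `|y + v - c|)).
have d0 : 0 < d.
  by rewrite !lt_min !subr_gt0 yr yvr !andbT divr_gt0// mulr_gt0//; lra.
have [E [mE aeE Ediff]] := regular_point_ae.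
have := (iter_ae_lineP (coord_fun v) mE).2 aeE.
move=> /(@iter_ae_shift _ _ _ (coord_fun y)).
move=> /(iter_ae_exists d0)[t /= Et td].
pose w := row_of_tuple t.
have wd : `|w| < d.
  apply: rV_norm_lt => // i; rewrite mxE; have /andP[t0 t1] := td i.
  by rewrite gtr0_norm.
have rowE s : row_of_tuple (tuple_shift (tuple_shift t (coord_fun y))
    (fun i => s * coord_fun v i)) = y + w + s *: v.
  rewrite row_of_tuple_shift; congr (_ + _).
  have := row_of_tuple_shift t y 1; rewrite scale1r addrC => <-; congr row_of_tuple.
  by congr tuple_shift; apply/funext => i; rewrite mul1r.
pose phi s := F (y + w + s *: v).
have phi_lip s t' : `|phi s - phi t'| <= (L * `|v|) * `|s - t'| by exact: line_lip.
have inball s : 0 < s < 1 -> `|y + w + s *: v - c| < r.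
  move=> /andP[s0 s1].
  have -> : y + w + s *: v - c = (1 - s) *: (y - c) + s *: (y + v - c) + w.
    by apply/rowP => i; rewrite !mxE; ring.
  apply: le_lt_trans (ler_normD _ _) _.
  apply: (@le_lt_trans _ _ ((1 - s) * `|y - c| + s * `|y + v - c| + `|w|)).
    rewrite lerD2r; apply: le_trans (ler_normD _ _) _.
    by rewrite !normrZ !ger0_norm// ?subr_ge0 ltW.
  move: wd; rewrite /d !lt_min => /and3P[_ w1 w2].
  have s1' : 0 <= 1 - s by rewrite subr_ge0 ltW.
  have := ler_wpM2l s1' (ltW w1); rewrite -(ltr_pM2l s0) in w2; move: w2.
  lra.
have : m * (1 - 0) <= phi 1 - phi 0.
  apply: (lipschitz_increment_ge ler01 phi_lip).
  move: Et; apply: ae_imply => s Es s01.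
  have dz := Ediff _ Es; rewrite rowE in dz.
  by have [_ ->] := line_derive1 dz; apply: Hm => //; exact: inball.
rewrite subr0 mulr1 /phi scale1r scale0r addr0 => H; apply: (le_trans H).
have H1 : `|F (y + w + v) - F (y + v)| <= `|L| * d.
  apply: le_trans (FL _ _) _; rewrite (_ : _ - _ = w); last first.
    by rewrite (addrAC y) [_ + w]addrC addrK.
  apply: (@le_trans _ _ (`|L| * `|w|)); first by rewrite ler_wpM2r// ler_norm.
  by rewrite ler_wpM2l// ltW.
have H2 : `|F (y + w) - F y| <= `|L| * d.
  apply: le_trans (FL _ _) _; rewrite [_ + w]addrC addrK.
  apply: (@le_trans _ _ (`|L| * `|w|)); first by rewrite ler_wpM2r// ler_norm.
  by rewrite ler_wpM2l// ltW.
have de : `|L| * d <= e / 2.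
  have : d <= e / (2 * (`|L| + 1)) by rewrite /d ge_min lexx.
  rewrite ler_pdivlMr ?mulr_gt0 ?ltr_wpDl//; have := ltW d0; lra.
move: H1 H2; rewrite !ler_norml => /andP[_ a] /andP[b _]; lra.
Qed.

End mean_value.

Lemma if_asboolT (T : Type) (P : Prop) (a b : T) : P -> (if `[< P >] then a else b) = a.
Proof. by move=> p; rewrite asboolT. Qed.

Lemma if_asboolF (T : Type) (P : Prop) (a b : T) : ~ P -> (if `[< P >] then a else b) = b.
Proof. by move=> p; rewrite asboolF. Qed.

(** * Calculus in charts *)

Section chart_calculus.
Context (R : realType) (n : nat) (M : topologicalType).
Variable S : smoothManifold R n M.
Implicit Types (c : chart R n M) (p q : M) (sigma : R -> M).
Local Notation vec := 'rV[R]_n.+1.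

Lemma smooth_on_differentiable (V W : normedModType R) (A : set V) (F : V -> W) x :
  smooth_on A F -> A x -> differentiable F x.
Proof. by move=> /(_ 1%N)[+ _] Ax; apply. Qed.

Lemma smooth_on_continuous (V W : normedModType R) (A : set V) (F : V -> W) x :
  smooth_on A F -> A x -> {for x, continuous F}.
Proof. by move=> /(_ 0%N) /= + Ax; apply. Qed.

Lemma smooth_on_derive (V W : normedModType R) (A : set V) (F : V -> W) v :
  smooth_on A F -> smooth_on A (fun x => 'D_v F x).
Proof. by move=> sF k; have [_] := sF k.+1; apply. Qed.

Lemma near_cdom c p : cdom c p -> \forall q \near p, cdom c q.
Proof. by move=> cp; apply: open_nbhs_nbhs; split => //; exact: cdom_open. Qed.

Lemma near_cimg c p : cdom c p -> \forall y \near c p, (c @` cdom c) y.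
Proof.
by move=> cp; apply: open_nbhs_nbhs; split; [exact: cimg_open|exists p].
Qed.

Lemma cinvK c y : (c @` cdom c) y -> c (cinv c y) = y /\ cdom c (cinv c y).
Proof. by move=> [p cp <-]; rewrite (cmapK cp). Qed.

Lemma cinv_continuous_at c p : cdom c p -> cinv c @ c p --> p.
Proof.
move=> cp; rewrite -[X in _ --> X](cmapK cp).
exact: (@cinv_cont _ _ _ c (c p) (ex_intro2 _ _ p cp erefl)).
Qed.

Lemma transition_differentiable c c' p : atlas S c -> atlas S c' ->
  cdom c p -> cdom c' p -> differentiable (c' \o cinv c) (c p).
Proof.
move=> ac ac' cp c'p; have [sm _] := atlas_compatible ac ac'.
by apply: (smooth_on_differentiable sm); exists p.
Qed.

Lemma transition_jacobianE c c' p v :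
  'd (c' \o cinv c) (c p) v = v *m transition_jacobian c c' p.
Proof. by rewrite /transition_jacobian /jacobian mul_rV_lin1. Qed.

Lemma derive1_diff (V : normedModType R) (f : R -> V) t : derivable f t 1 ->
  derive1 f t = 'd f t 1.
Proof. by move=> /derivable1_diffP df; rewrite derive1E deriveE. Qed.

(** Continuity of [sigma] keeps nearby points in the domain of [c], so the curve in the chart [c']
    is locally the composition of the curve in [c] with the transition map. *)
Lemma chart_change sigma t c c' : {for t, continuous sigma} ->
  atlas S c -> atlas S c' -> cdom c (sigma t) -> cdom c' (sigma t) ->
  derivable (c \o sigma : R -> vec) t 1 ->
  derivable (c' \o sigma : R -> vec) t 1 /\
  derive1 (c' \o sigma : R -> vec) t =
    derive1 (c \o sigma : R -> vec) t *m transition_jacobian c c' (sigma t).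
Proof.
move=> sc ac ac' cs c's dx.
have E : {near t, c' \o sigma =1 (c' \o cinv c) \o (c \o sigma)}.
  have : \forall s \near t, cdom c (sigma s) by exact/sc/near_cdom.
  by apply: filterS => s cs'; rewrite /comp (cmapK cs').
have dT := transition_differentiable ac ac' cs c's.
have dX : differentiable (c \o sigma : R -> vec) t by exact/derivable1_diffP.
have dC : differentiable ((c' \o cinv c) \o (c \o sigma) : R -> vec) t.
  exact: differentiable_comp.
have E' : {near t, (c' \o cinv c) \o (c \o sigma) =1 c' \o sigma}.
  by apply: filterS E => s /= ->.
split; first by apply: (near_eq_derivable E'); exact/derivable1_diffP.
rewrite derive1E (near_eq_derive _ E) -derive1E derive1_diff; last exact/derivable1_diffP.
rewrite diff_comp//= transition_jacobianE; congr (_ *m _).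
by rewrite derive1_diff.
Qed.

Lemma bformZl (G : 'M[R]_n.+1) a v w : bform G (a *: v) w = a * bform G v w.
Proof. by rewrite /bform -!scalemxAl mxE. Qed.

Lemma bformZr (G : 'M[R]_n.+1) a v w : bform G v (a *: w) = a * bform G v w.
Proof. by rewrite /bform linearZ/= -scalemxAr mxE. Qed.

Lemma bform_mulmx (G J : 'M[R]_n.+1) v w :
  bform (J *m G *m J^T) v w = bform G (v *m J) (w *m J).
Proof. by rewrite /bform trmx_mul !mulmxA. Qed.

Lemma bformE (G : 'M[R]_n.+1) v w : bform G v w = \sum_i \sum_j v 0 i * G i j * w 0 j.
Proof.
rewrite /bform mxE exchange_big/=; apply: eq_bigr => j _.
by rewrite !mxE mulr_suml; apply: eq_bigr => i _.
Qed.

Lemma bformN (G : 'M[R]_n.+1) v w : bform (- G) v w = - bform G v w.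
Proof. by rewrite /bform mulmxN mulNmx mxE. Qed.

End chart_calculus.

Section lorentz_charts.
Context (R : realType) (n : nat) (M : topologicalType).
Variable g : lorentzianManifold R n M.
Implicit Types (c : chart R n M) (p q : M) (sigma : R -> M).
Local Notation vec := 'rV[R]_n.+1.

Definition covariant_at (Q : chart R n M -> M -> 'M[R]_n.+1) (p : M) : Prop :=
  forall c c', atlas g c -> atlas g c' -> cdom c p -> cdom c' p ->
    Q c p = transition_jacobian c c' p *m Q c' p *m (transition_jacobian c c' p)^T.

Lemma covariant_metric p : covariant_at (metric g) p.
Proof. by move=> c c' ac ac' cp c'p; have [_ _] := metric_tensor g; apply. Qed.

Lemma covariant_metricN p : covariant_at (fun c p => - metric g c p) p.
Proof.
by move=> c c' ac ac' cp c'p; rewrite (covariant_metric ac ac' cp c'p) mulmxN mulNmx.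
Qed.

Lemma covariant_sym_tensor (U : set M) h p : sym_tensor_on g U h -> U p ->
  covariant_at h p.
Proof. by move=> [_ _ H] Up c c' ac ac' cp c'p; exact: H. Qed.

(** Derivability does not depend on the chart, so the default value [0] is chart independent as
    well. *)
Lemma speedE (Q : chart R n M -> M -> 'M[R]_n.+1) sigma t c :
  covariant_at Q (sigma t) -> {for t, continuous sigma} ->
  atlas g c -> cdom c (sigma t) ->
  speed g Q sigma t = if `[< derivable (c \o sigma : R -> vec) t 1 >] then
    Num.sqrt (bform (Q c (sigma t)) (derive1 (c \o sigma : R -> vec) t)
      (derive1 (c \o sigma : R -> vec) t)) else 0.
Proof.
move=> cQ sc ac cs; rewrite /speed.
set c0 := chart_at g (sigma t).
have ac0 : atlas g c0 by exact: chart_at_atlas.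
have c0s : cdom c0 (sigma t) by exact: chart_at_dom.
have [d0|d0] := pselect (derivable (c0 \o sigma : R -> vec) t 1); last first.
  have d1 : ~ derivable (c \o sigma : R -> vec) t 1.
    by move=> d1; apply: d0; have [] := chart_change sc ac ac0 cs c0s d1.
  by transitivity (0 : R); [exact: (if_asboolF _ _ d0)|exact/esym/(if_asboolF _ _ d1)].
have [d1 vE] := chart_change sc ac0 ac c0s cs d0.
transitivity (Num.sqrt (bform (Q c0 (sigma t)) (velocity g sigma t) (velocity g sigma t))).
  exact: (if_asboolT _ _ d0).
apply: etrans (esym (if_asboolT _ _ d1)); congr Num.sqrt.
by rewrite (cQ c0 c ac0 ac c0s cs) bform_mulmx /velocity -/c0 vE.
Qed.

Definition future_in c p (v : vec) : Prop :=
  [/\ v != 0, bform (metric g c p) v v <= 0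
    & bform (metric g c p) (orientation g c p) v < 0].

Lemma future_velocityP sigma t c : {for t, continuous sigma} ->
  atlas g c -> cdom c (sigma t) -> derivable (c \o sigma : R -> vec) t 1 ->
  future_vector g (sigma t) (velocity g sigma t) <->
  future_in c (sigma t) (derive1 (c \o sigma : R -> vec) t).
Proof.
move=> sc ac cs d1; rewrite /future_vector /velocity.
set c0 := chart_at g (sigma t).
have ac0 : atlas g c0 by exact: chart_at_atlas.
have c0s : cdom c0 (sigma t) by exact: chart_at_dom.
have [d0 v0E] := chart_change sc ac ac0 cs c0s d1.
have [_ vE] := chart_change sc ac0 ac c0s cs d0.
set v0 := derive1 (c0 \o sigma) t in v0E vE *.
set v := derive1 (c \o sigma) t in v0E vE *.
have -> : bform (metric g c0 (sigma t)) v0 v0 = bform (metric g c (sigma t)) v v.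
  by rewrite (covariant_metric ac0 ac c0s cs) bform_mulmx -vE.
have -> : bform (metric g c0 (sigma t)) (orientation g c0 (sigma t)) v0 =
    bform (metric g c (sigma t)) (orientation g c (sigma t)) v.
  rewrite (covariant_metric ac0 ac c0s cs) bform_mulmx -vE.
  by rewrite (orientation_vector ac0 ac c0s cs).
have -> : (v0 != 0) = (v != 0); last by [].
apply/idP/idP; apply: contra_neq => e0.
  by rewrite v0E e0 mul0mx.
by rewrite vE e0 mul0mx.
Qed.

End lorentz_charts.

(** * Smooth curves and geodesics *)

Section c1_curves.
Context (R : realType) (n : nat).
Local Notation vec := 'rV[R]_n.+1.

Lemma derivable_coord_at (x : R -> vec) t i : derivable x t 1 ->
  derivable (fun s => x s 0 i) t 1 /\ derive1 (fun s => x s 0 i) t = (derive1 x t) 0 i.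
Proof.
move=> dx; apply: increment_derivable => e e0.
have [d d0 Hd] := derivable_increment dx e0; exists d => // s sd.
apply: le_trans (Hd s sd).
by have := rV_coord_le_norm (x s - x t - (s - t) *: derive1 x t) i; rewrite !mxE.
Qed.

Lemma derivable_continuous_at (V : normedModType R) (x : R -> V) t :
  derivable x t 1 -> {for t, continuous x}.
Proof. by move=> /derivable1_diffP /differentiable_continuous. Qed.

(* Strict differentiability of C^1 curves, by the mean value theorem. *)
Lemma C1_increment (x : R -> vec) t : (\forall s \near t, derivable x s 1) ->
  {for t, continuous (derive1 x)} ->
  forall e, 0 < e -> exists2 d, 0 < d & forall s s', `|s - t| < d -> `|s' - t| < d ->
    `|x s - x s' - (s - s') *: derive1 x t| <= e * `|s - s'|.
Proof.
move=> ndx cdx e e0.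
have ndc : \forall s \near t, `|derive1 x t - derive1 x s| < e.
  by move/cvgrPdist_lt: cdx; apply.
have [d /= d0 Hd] := filterI ndx ndc; exists d => // s s' sd s'd.
wlog ss' : s s' sd s'd / s' < s => [hw|].
  have [lt|lt|->] := ltgtP s s'; last by rewrite !subrr scale0r subrr !normr0 mulr0.
    rewrite (_ : x s - x s' - (s - s') *: derive1 x t =
        - (x s' - x s - (s' - s) *: derive1 x t)).
      by rewrite normrN (distrC s s'); exact: hw.
    by apply/rowP => j; rewrite !mxE; ring.
  exact: hw.
have inb r : s' <= r <= s -> ball t d r.
  move=> /andP[r1 r2]; rewrite /ball/= distrC ltr_norml.
  move: sd s'd; rewrite !ltr_norml => /andP[? ?] /andP[? ?].
  by apply/andP; split; lra.
apply: rV_norm_le => [|i]; first by rewrite mulr_ge0// ltW.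
have dxi r : s' <= r <= s -> derivable (fun r => x r 0 i) r 1 /\
    derive1 (fun r => x r 0 i) r = (derive1 x r) 0 i.
  by move=> /inb /Hd[dr _]; exact: derivable_coord_at.
have [r rI E] : exists2 r, r \in `]s', s[ &
    x s 0 i - x s' 0 i = (derive1 x r) 0 i * (s - s').
  apply: (@MVT _ (fun r => x r 0 i) (fun r => (derive1 x r) 0 i)) => //.
    move=> r; rewrite in_itv/= => /andP[r1 r2].
    have [dr <-] := dxi r (introT andP (conj (ltW r1) (ltW r2))).
    by rewrite derive1E; exact: derivableP.
  apply: derivable_within_continuous => r; rewrite in_itv/= => /dxi[].
  by [].
rewrite !mxE E mulrC -mulrBr normrM mulrC ler_wpM2r//.
move: rI; rewrite in_itv/= => /andP[r1 r2].
have [_ /ltW] := Hd r (inb r (introT andP (conj (ltW r1) (ltW r2)))).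
rewrite distrC; apply: le_trans.
by have := rV_coord_le_norm (derive1 x r - derive1 x t) i; rewrite !mxE.
Qed.

End c1_curves.

Section affine.
Context (R : realType).

Lemma derive_affine (V : normedModType R) (F : R -> V) (a b v s : R) :
  'D_v (fun s => F (a + b * s)) s = 'D_(b * v) F (a + b * s).
Proof.
rewrite /derive.
suff -> : (fun h : R => h^-1 *: (((fun s => F (a + b * s)) \o shift s) (h *: v)
    - F (a + b * s))) =
  (fun h : R => h^-1 *: ((F \o shift (a + b * s)) (h *: (b * v)) - F (a + b * s))) by [].
apply/funext => h; congr (_ *: (F _ - _)).
by rewrite /= /GRing.scale/=; ring.
Qed.

Lemma differentiable_affine (V : normedModType R) (F : R -> V) (a b s : R) :
  differentiable F (a + b * s) -> differentiable (fun s => F (a + b * s)) s.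
Proof.
move=> dF; apply: (@differentiable_comp _ _ _ _ (fun s => a + b * s) F) => //.
Qed.

Lemma Ck_on_affine (V : normedModType R) k (J : set R) (F : R -> V) (a b : R) :
  Ck_on k J F -> Ck_on k [set s | J (a + b * s)] (fun s => F (a + b * s)).
Proof.
elim: k F => [|k IH] F /=.
  move=> cF s Js; apply: (@continuous_comp _ _ _ (fun s => a + b * s) F); last exact: cF.
  by apply: continuousD; [exact: cst_continuous|apply: continuousM => //; exact: cst_continuous].
move=> [dF DF]; split=> [s Js|v].
  by apply: differentiable_affine; exact: dF.
rewrite (_ : (fun x => _) = fun s => 'D_(b * v) F (a + b * s)).
  exact: (IH (fun s => 'D_(b * v) F s) (DF (b * v))).
by apply/funext => s; exact: derive_affine.
Qed.

Lemma derive1_affine (V : normedModType R) (F : R -> V) (a b s : R) :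
  derivable F (a + b * s) 1 ->
  derivable (fun s => F (a + b * s)) s 1 /\
  derive1 (fun s => F (a + b * s)) s = b *: derive1 F (a + b * s).
Proof.
move=> /derivable1_diffP dF; split.
  by apply/derivable1_diffP; exact: differentiable_affine.
rewrite derive1E derive_affine mulr1 derive1E !deriveE//.
have bE : b = b *: (1 : R) by rewrite [RHS]mulr1.
transitivity ('d F (a + b * s) (b *: (1 : R))); first by rewrite -bE.
exact: linearZ.
Qed.

End affine.

Lemma derive1_scale (R : realType) (V : normedModType R) (f : R -> V) (b s : R) :
  derivable f s 1 -> derive1 (fun r => b *: f r) s = b *: derive1 f s.
Proof.
by move=> df; rewrite !derive1E; exact: (deriveZ b df).
Qed.

Lemma near_eq_derive1 (R : realType) (V : normedModType R) (f h : R -> V) (s : R) :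
  {near s, f =1 h} -> derive1 f s = derive1 h s.
Proof. by move=> E; rewrite !derive1E; exact: near_eq_derive. Qed.

Lemma cvg_sum_seq (R : realType) (T : Type) (F : set_system T) (FF : Filter F)
  (V : normedModType R) (I : Type) (r : seq I) (f : I -> T -> V) (a : I -> V) :
  (forall i, f i @ F --> a i) ->
  (fun x => \sum_(i <- r) f i x) @ F --> \sum_(i <- r) a i.
Proof.
move=> fa; elim: r => [|i r IH].
  by rewrite big_nil; under eq_fun do rewrite big_nil; exact: cvg_cst.
by rewrite big_cons; under eq_fun do rewrite big_cons; exact: cvgD.
Qed.

Section geodesics.
Context (R : realType) (n : nat) (M : topologicalType).
Variable g : lorentzianManifold R n M.
Implicit Types (c : chart R n M) (p q : M) (sigma : R -> M) (U : set M).
Local Notation vec := 'rV[R]_n.+1.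

(** What most estimates use of a geodesic: smoothness in some chart, from which continuity and the
    [C^1] property in every chart follow. *)
Definition smooth_near sigma (t : R) : Prop := exists c (J : set R),
  [/\ atlas g c, open J, J t, forall s, J s -> cdom c (sigma s)
    & smooth_on J (c \o sigma : R -> vec)].

Lemma geodesic_smooth_near sigma t : geodesic_at g sigma t -> smooth_near sigma t.
Proof. by move=> [c [J [ac oJ Jt cJ [sm _]]]]; exists c, J. Qed.

Lemma smooth_near_continuous sigma t : smooth_near sigma t -> {for t, continuous sigma}.
Proof.
move=> [c [J [ac oJ Jt cJ sm]]].
have nJ : \forall s \near t, J s by exact: open_nbhs_nbhs.
have E : {near t, cinv c \o (c \o sigma) =1 sigma}.
  by apply: filterS nJ => s Js /=; rewrite (cmapK (cJ s Js)).
have cx : {for t, continuous (c \o sigma : R -> vec)} by exact: smooth_on_continuous sm Jt.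
have cc : cinv c \o (c \o sigma) @ t --> sigma t.
  apply: cvg_comp (cinv_continuous_at (cJ t Jt)); exact: cx.
by apply: cvg_trans cc; apply: near_eq_cvg; apply: filterS E => s ->.
Qed.

Lemma smooth_near_near sigma t : smooth_near sigma t ->
  \forall s \near t, smooth_near sigma s.
Proof.
move=> [c [J [ac oJ Jt cJ sm]]].
have nJ : \forall s \near t, J s by exact: open_nbhs_nbhs.
by apply: filterS nJ => s Js; exists c, J.
Qed.

Lemma smooth_near_derivable sigma t c : smooth_near sigma t -> atlas g c ->
  cdom c (sigma t) -> derivable (c \o sigma : R -> vec) t 1.
Proof.
move=> sn ac ct; have sc := smooth_near_continuous sn.
have [c' [J [ac' oJ Jt cJ sm]]] := sn.
have dx : derivable (c' \o sigma : R -> vec) t 1.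
  by apply/derivable1_diffP; exact: smooth_on_differentiable sm Jt.
by have [] := chart_change sc ac' ac (cJ t Jt) ct dx.
Qed.

(** The chain rule writes the velocity in the new chart as a sum of its old components times partial
    derivatives of the transition map, all continuous. *)
Lemma smooth_near_C1 sigma t c : smooth_near sigma t -> atlas g c ->
  cdom c (sigma t) ->
  (\forall s \near t, derivable (c \o sigma : R -> vec) s 1) /\
  {for t, continuous (derive1 (c \o sigma : R -> vec))}.
Proof.
move=> sn ac ct; have sc := smooth_near_continuous sn.
have nc : \forall s \near t, cdom c (sigma s) by exact/sc/near_cdom.
split.
  near=> s; apply: smooth_near_derivable => //; last by near: s.
  by near: s; exact: smooth_near_near.
have [c' [J [ac' oJ Jt cJ sm]]] := sn.
have nJ : \forall s \near t, J s by exact: open_nbhs_nbhs.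
have [smT _] := atlas_compatible ac' ac.
set Tr := c \o cinv c' in smT.
have smJ s : J s -> smooth_near sigma s by move=> Js; exists c', J.
have dE s : J s -> cdom c (sigma s) -> derive1 (c \o sigma : R -> vec) s =
    \sum_j (derive1 (c' \o sigma : R -> vec) s) 0 j *:
      'D_(delta_mx 0 j) Tr ((c' \o sigma) s).
  move=> Js cs.
  have dx : derivable (c' \o sigma : R -> vec) s 1.
    by apply/derivable1_diffP; exact: smooth_on_differentiable sm Js.
  have [_ ->] := chart_change (smooth_near_continuous (smJ s Js)) ac' ac (cJ s Js) cs dx.
  have dT := transition_differentiable ac' ac (cJ s Js) cs.
  rewrite -transition_jacobianE {1}(row_sum_delta (derive1 _ s)) linear_sum.
  by apply: eq_bigr => j _; rewrite linearZ deriveE.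
have cv : {for t, continuous (fun s => \sum_j (derive1 (c' \o sigma : R -> vec) s) 0 j *:
      'D_(delta_mx 0 j) Tr ((c' \o sigma) s))}.
  have cx : {for t, continuous (c' \o sigma : R -> vec)}.
    exact: smooth_on_continuous sm Jt.
  have smd : smooth_on J (fun s : R => 'D_1 (c' \o sigma : R -> vec) s).
    exact: smooth_on_derive.
  have E1 : derive1 (c' \o sigma : R -> vec) = (fun s : R => 'D_1 (c' \o sigma : R -> vec) s).
    by apply/funext => s; exact: derive1E.
  have cd : {for t, continuous (derive1 (c' \o sigma : R -> vec))}.
    by rewrite E1; exact: smooth_on_continuous smd Jt.
  apply: cvg_sum_seq => j; apply: cvgZ.
    exact: (cvg_comp _ _ cd (@coord_continuous _ _ _ 0 j _)).
  have cD : {for (c' \o sigma) t, continuous (fun y => 'D_(delta_mx 0 j) Tr y)}.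
    have im : cimg c' (cdom c) ((c' \o sigma) t).
      exact: (ex_intro2 _ _ (sigma t) (conj (cJ t Jt) ct) erefl).
    exact: smooth_on_continuous (smooth_on_derive _ smT) im.
  exact: (cvg_comp _ _ cx cD).
have E : {near t, (fun s => \sum_j (derive1 (c' \o sigma : R -> vec) s) 0 j *:
      'D_(delta_mx 0 j) Tr ((c' \o sigma) s)) =1 derive1 (c \o sigma : R -> vec)}.
  by near=> s; rewrite dE//; near: s.
suff H : derive1 (c \o sigma : R -> vec) @ t --> derive1 (c \o sigma : R -> vec) t by exact: H.
rewrite [X in _ --> X](dE t Jt ct).
by apply: cvg_trans cv; apply: near_eq_cvg; apply: filterS E => s ->.
Unshelve. all: end_near. Qed.

(** The geodesic equation is homogeneous of degree two in the velocity. The uses are subsegments and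
    time reversal. *)
Lemma geodesic_at_affine sigma (a b t : R) : b != 0 ->
  geodesic_at g sigma (a + b * t) -> geodesic_at g (fun s => sigma (a + b * s)) t.
Proof.
move=> b0 [c [J [ac oJ Jt cJ [sm ode]]]].
exists c, [set s | J (a + b * s)]; split => //.
- have : open ((fun s : R => a + b * s) @^-1` J); last by [].
  apply: open_comp => // s _; apply: continuousD; first exact: cst_continuous.
  by apply: continuousM => //; exact: cst_continuous.
- by move=> s /cJ.
set x := c \o sigma in sm ode.
have smx : smooth_on [set s | J (a + b * s)] (fun s => x (a + b * s)).
  by move=> k; exact: Ck_on_affine.
split=> // s Js k.
have d1 r : J (a + b * r) -> derive1 (fun s => x (a + b * s)) r = b *: derive1 x (a + b * r).
  move=> Jr; apply: (derive1_affine _).2; apply/derivable1_diffP.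
  exact: smooth_on_differentiable sm Jr.
have smd : smooth_on J (derive1 x).
  rewrite (_ : derive1 x = fun s => 'D_1 x s); first exact: smooth_on_derive.
  by apply/funext => r; rewrite derive1E.
have dd r : J r -> derivable (derive1 x) r 1.
  by move=> Jr; apply/derivable1_diffP; exact: smooth_on_differentiable smd Jr.
have nJ : \forall r \near s, J (a + b * r).
  have oJ' : open ((fun s : R => a + b * s) @^-1` J).
    apply: open_comp => // r _; apply: continuousD; first exact: cst_continuous.
    by apply: continuousM => //; exact: cst_continuous.
  exact: open_nbhs_nbhs.
have d2 : derive1 (derive1 (fun s => x (a + b * s))) s = b *: (b *: derive1 (derive1 x) (a + b * s)).
  have E : {near s, derive1 (fun s => x (a + b * s)) =1 (fun r => b *: derive1 x (a + b * r))}.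
    by apply: filterS nJ => r; exact: d1.
  have [dr dE] := derive1_affine (dd _ Js).
  by rewrite (near_eq_derive1 E) (derive1_scale b dr) dE.
rewrite d2 d1// !mxE.
under eq_bigr => i _. under eq_bigr => j _. rewrite !mxE. over. over.
have := ode _ Js k; set D2 := derive1 _ _ => H.
suff -> : \sum_i \sum_j christoffel g c k i j (x (a + b * s)) *
    (b * (derive1 x (a + b * s)) 0 i) * (b * (derive1 x (a + b * s)) 0 j) =
    b * (b * \sum_i \sum_j christoffel g c k i j (x (a + b * s)) *
      (derive1 x (a + b * s)) 0 i * (derive1 x (a + b * s)) 0 j).
  by rewrite -mulrDr -mulrDr H !mulr0.
rewrite !mulr_sumr; apply: eq_bigr => i _; rewrite !mulr_sumr; apply: eq_bigr => j _.
by ring.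
Qed.

End geodesics.

Section future_geodesics.
Context (R : realType) (n : nat) (M : topologicalType).
Variable g : lorentzianManifold R n M.
Implicit Types (c : chart R n M) (p q : M) (sigma : R -> M) (U : set M).
Local Notation vec := 'rV[R]_n.+1.

Definition future_geodesic U sigma : Prop :=
  [/\ convex_normal g U, geodesic01 g sigma & forall t : R, 0 <= t <= 1 ->
    U (sigma t) /\ future_vector g (sigma t) (velocity g sigma t)].

Lemma future_vectorZ p v (b : R) : 0 < b -> future_vector g p v ->
  future_vector g p (b *: v).
Proof.
move=> b0 [v0 vv ov]; split.
- by rewrite scaler_eq0 negb_or gt_eqF.
- by rewrite bformZl bformZr !pmulr_rle0.
- by rewrite bformZr pmulr_rlt0.
Qed.

Lemma velocity_affine sigma (a b t : R) : smooth_near g sigma (a + b * t) ->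
  velocity g (fun s => sigma (a + b * s)) t = b *: velocity g sigma (a + b * t).
Proof.
move=> sn; set c := chart_at g (sigma (a + b * t)).
have d := smooth_near_derivable sn (chart_at_atlas g _) (chart_at_dom g _).
exact: (derive1_affine d).2.
Qed.

Lemma future_geodesic_smooth U sigma t : future_geodesic U sigma -> 0 <= t <= 1 ->
  smooth_near g sigma t.
Proof. by move=> [_ geo _] t01; exact/geodesic_smooth_near/geo. Qed.

Lemma future_geodesic_affine U sigma (a b : R) : future_geodesic U sigma ->
  0 <= a -> 0 < b -> a + b <= 1 -> future_geodesic U (fun s => sigma (a + b * s)).
Proof.
move=> fg a0 b0 ab; have [cU geo fut] := fg.
have in01 (t : R) : 0 <= t <= 1 -> 0 <= a + b * t <= 1.
  by move=> /andP[t0 t1]; apply/andP; split; nra.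
split; first exact: cU.
  by move=> t t01; apply: geodesic_at_affine (geo _ (in01 t t01)); rewrite gt_eqF.
move=> t t01; have [Ut vt] := fut _ (in01 t t01); split; first exact: Ut.
rewrite velocity_affine; first exact: (future_vectorZ b0 vt).
exact: future_geodesic_smooth fg (in01 t t01).
Qed.

Lemma past_geodesic_rev U sigma : convex_normal g U -> geodesic01 g sigma ->
  (forall t : R, 0 <= t <= 1 -> U (sigma t) /\ past_vector g (sigma t) (velocity g sigma t)) ->
  future_geodesic U (fun s => sigma (1 + (- 1) * s)).
Proof.
move=> cU geo past.
have in01 (t : R) : 0 <= t <= 1 -> 0 <= 1 + (- 1) * t <= 1.
  by move=> /andP[t0 t1]; apply/andP; split; lra.
split; first exact: cU.
  by move=> t t01; apply: geodesic_at_affine (geo _ (in01 t t01)); rewrite oppr_eq0 oner_eq0.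
move=> t t01; have [Ut vt] := past _ (in01 t t01); split; first exact: Ut.
rewrite velocity_affine; first by rewrite scaleN1r; exact: vt.
exact: (geodesic_smooth_near (geo _ (in01 t t01))).
Qed.

Lemma smooth_near_injective sigma t c : smooth_near g sigma t -> atlas g c ->
  cdom c (sigma t) -> derive1 (c \o sigma : R -> vec) t != 0 ->
  exists2 d, 0 < d & forall s s', `|s - t| < d -> `|s' - t| < d -> s != s' ->
    sigma s <> sigma s'.
Proof.
move=> sn ac ct D0; have [nd cd] := smooth_near_C1 sn ac ct.
have e0 : 0 < `|derive1 (c \o sigma : R -> vec) t| / 2 by rewrite divr_gt0// normr_gt0.
have [d d0 Hd] := C1_increment nd cd e0; exists d => // s s' sd s'd ss' E.
have := Hd s s' sd s'd; rewrite /= E subrr sub0r normrN normrZ mulrC.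
have ss : 0 < `|s - s'| by rewrite normr_gt0 subr_eq0.
rewrite ler_pM2r//; have : 0 < `|derive1 (c \o sigma : R -> vec) t| by rewrite normr_gt0.
lra.
Qed.

(** The velocity does not vanish, so the geodesic is locally injective, and its affinely
    reparametrised subsegments are the geodesics demanded of a causal curve. Time functions and
    anti-Lipschitz bounds thereby apply to it. *)
Lemma future_geodesic_curve U sigma : future_geodesic U sigma ->
  future_curve g `[0, 1] sigma.
Proof.
move=> fg; have [cU geo fut] := fg; split.
  apply: continuous_in_subspaceT => t; rewrite inE/= in_itv/= => t01.
  exact/smooth_near_continuous/(future_geodesic_smooth fg).
move=> t /=; rewrite in_itv/= => t01.
have sn := future_geodesic_smooth fg t01.
have ac := chart_at_atlas g (sigma t); have ct := chart_at_dom g (sigma t).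
have D0 : derive1 (chart_at g (sigma t) \o sigma : R -> vec) t != 0.
  by have [_ [v0 _ _]] := fut t t01; exact: v0.
have [d d0 inj] := smooth_near_injective sn ac ct D0.
exists (ball t d), U; split.
- exact: nbhsx_ballx.
- exact: cU.
- exact: (fut t t01).1.
- by move=> s _; rewrite /= in_itv/= => s01; exact: (fut s s01).1.
move=> t1 t2 /=; rewrite /ball/= !in_itv/= => b1 /andP[t10 t11] b2 /andP[t20 t21] t12.
split; first by apply: inj; rewrite 1?distrC// lt_eqF.
exists (fun s => sigma (t1 + (t2 - t1) * s)).
have t210 : 0 < t2 - t1 by rewrite subr_gt0.
have le1 : t1 + (t2 - t1) <= 1 by rewrite addrC subrK.
have [_ geo' fut'] := future_geodesic_affine fg t10 t210 le1.
split; [exact: geo'|by rewrite mulr0 addr0|by rewrite mulr1 addrC subrK|exact: fut'].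
Qed.

Lemma future_geodesic_time U sigma (f : M -> R) (s t : R) : time_function g f ->
  future_geodesic U sigma -> 0 <= s -> s < t -> t <= 1 -> f (sigma s) < f (sigma t).
Proof.
move=> [_ tf] fg s0 st t1.
apply: (tf `[0, 1]%classic sigma) => //; rewrite /= ?in_itv/=.
- exact: interval_is_interval.
- exact: future_geodesic_curve fg.
- by rewrite s0 (ltW (lt_le_trans st t1)).
- by rewrite t1 (le_trans s0 (ltW st)).
Qed.

(** The convex set is quantified away, since it changes along a causal curve. *)
Definition geodesic_before p q : Prop := exists U sigma,
  [/\ future_geodesic U sigma, sigma 0 = p & sigma 1 = q].

Lemma future_directed_before U p q : convex_normal g U ->
  directed_geodesic g (future_vector g) U p q -> geodesic_before p q.
Proof. by move=> cU [sigma [geo s0 s1 fut]]; exists U, sigma; split; [split| |]. Qed.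

Lemma past_directed_before U p q : convex_normal g U ->
  directed_geodesic g (past_vector g) U p q -> geodesic_before q p.
Proof.
move=> cU [sigma [geo s0 s1 past]]; exists U, (fun s => sigma (1 + (- 1) * s)).
split; first exact: past_geodesic_rev geo past.
  by rewrite mulr0 addr0.
by rewrite mulr1 subrr.
Qed.

End future_geodesics.

(** * Constant Lorentz forms and their future cones *)

Section lorentz_algebra.
Context (R : realType) (n : nat).
Local Notation vec := 'rV[R]_n.+1.
Implicit Types (w z : vec).

Lemma sqr_sum_le (I : finType) (P : pred I) (a b : I -> R) :
  (\sum_(i | P i) a i * b i) ^+ 2 <=
  (\sum_(i | P i) a i ^+ 2) * (\sum_(i | P i) b i ^+ 2).
Proof.
set X := \sum_(i | P i) a i ^+ 2; set Y := \sum_(i | P i) a i * b i.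
set Z := \sum_(i | P i) b i ^+ 2.
have Z0 : 0 <= Z by apply: sumr_ge0 => i _; exact: sqr_ge0.
have [Z0' | Zn0] := eqVneq Z 0.
  suff -> : Y = 0 by rewrite Z0' mulr0 expr0n.
  apply: big1 => i Pi; have /eqP := Z0'; rewrite psumr_eq0; last by move=> j _; exact: sqr_ge0.
  by move=> /allP /(_ i (mem_index_enum _)); rewrite Pi/= sqrf_eq0 => /eqP ->; rewrite mulr0.
have Zp : 0 < Z by rewrite lt_neqAle eq_sym Zn0.
have : 0 <= \sum_(i | P i) (Z * a i - Y * b i) ^+ 2.
  by apply: sumr_ge0 => i _; exact: sqr_ge0.
rewrite (eq_bigr (fun i => Z ^+ 2 * a i ^+ 2 + (- (2 * Z * Y)) * (a i * b i) + Y ^+ 2 * b i ^+ 2)).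
  by rewrite !big_split/= -!mulr_sumr -/X -/Y -/Z => H; nra.
by move=> i _; ring.
Qed.

Definition ssum w z : R := \sum_(i | i != ord0) w 0 i * z 0 i.

Lemma ssumC w z : ssum w z = ssum z w.
Proof. by apply: eq_bigr => i _; rewrite mulrC. Qed.

Lemma ssumDl w w' z : ssum (w + w') z = ssum w z + ssum w' z.
Proof. by rewrite -big_split; apply: eq_bigr => i _; rewrite mxE mulrDl. Qed.

Lemma ssumZl a w z : ssum (a *: w) z = a * ssum w z.
Proof. by rewrite mulr_sumr; apply: eq_bigr => i _; rewrite mxE mulrA. Qed.

Lemma ssumDr w z z' : ssum w (z + z') = ssum w z + ssum w z'.
Proof. by rewrite ssumC ssumDl ssumC (ssumC z'). Qed.

Lemma ssumZr a w z : ssum w (a *: z) = a * ssum w z.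
Proof. by rewrite ssumC ssumZl ssumC. Qed.

Lemma ssum_ge0 z : 0 <= ssum z z.
Proof. by apply: sumr_ge0 => i _; rewrite -expr2 sqr_ge0. Qed.

Lemma ssum_cs w z : ssum w z ^+ 2 <= ssum w w * ssum z z.
Proof.
have E v : ssum v v = \sum_(i | i != ord0) v 0 i ^+ 2.
  by apply: eq_bigr => i _; rewrite expr2.
by rewrite !E; exact: sqr_sum_le.
Qed.

(* The quadratic form [A z_0^2 - B (z_1^2 + ... + z_n^2)], its polar form and
   its future cone. *)
Definition lb (A B : R) w z : R := A * (w 0 0 * z 0 0) - B * ssum w z.
Definition lcone (A B : R) z : Prop := 0 <= z 0 0 /\ 0 <= lb A B z z.

Variables (A B : R).
Hypotheses (A0 : 0 < A) (B0 : 0 < B).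

Lemma lbC w z : lb A B w z = lb A B z w.
Proof. by rewrite /lb ssumC (mulrC (w 0 0)). Qed.

Lemma lbDl w w' z : lb A B (w + w') z = lb A B w z + lb A B w' z.
Proof. by rewrite /lb ssumDl mxE; ring. Qed.

Lemma lbZl a w z : lb A B (a *: w) z = a * lb A B w z.
Proof. by rewrite /lb ssumZl mxE; ring. Qed.

Lemma lbDr w z z' : lb A B w (z + z') = lb A B w z + lb A B w z'.
Proof. by rewrite /lb ssumDr mxE; ring. Qed.

Lemma lbZr a w z : lb A B w (a *: z) = a * lb A B w z.
Proof. by rewrite /lb ssumZr mxE; ring. Qed.

Lemma lbBr w z z' : lb A B w (z - z') = lb A B w z - lb A B w z'.
Proof. by rewrite lbDr -scaleN1r lbZr mulN1r. Qed.

(** With [X], [Y], [Z] the spatial products of [w] and [z], the right side minus the left one is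
    [B * (A * V - B * D)], where [D = X * Z - Y ^+ 2] and [V] is the squared spatial norm of
    [w_0 z - z_0 w]. It is nonnegative because [X * V = w_0^2 * D + (w_0 Y - z_0 X)^2] and
    [B * X <= A * w_0^2]. *)
Lemma lb_reverse_cs w z : 0 <= lb A B w w ->
  lb A B w w * lb A B z z <= lb A B w z ^+ 2.
Proof.
rewrite /lb => hw; have cs := ssum_cs w z.
have V0 := ssum_ge0 (w 0 0 *: z - z 0 0 *: w).
have X0 := ssum_ge0 w; move: V0.
rewrite -scaleNr !(ssumDl, ssumDr, ssumZl, ssumZr) (ssumC z w).
move: (ssum w w) (ssum w z) (ssum z z) (w 0 0) (z 0 0) X0 hw cs => X Y Z w0 z0 X0 hw cs V0.
have [X00|Xn0] := eqVneq X 0.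
  have Y0 : Y = 0 by apply/eqP; rewrite -sqrf_eq0 eq_le sqr_ge0 andbT; move: cs; rewrite X00 mul0r.
  rewrite X00 Y0 in V0 *.
  have : 0 <= (A * B) * (w0 * (w0 * Z)) by apply: mulr_ge0; [exact: mulr_ge0 (ltW A0) (ltW B0)|lra].
  by move=> H; rewrite mulr0 !subr0; nra.
have Xp : 0 < X by rewrite lt_neqAle eq_sym Xn0.
set D := X * Z - Y ^+ 2; have D0 : 0 <= D by rewrite /D subr_ge0.
set V := w0 * (w0 * Z + - z0 * Y) + - z0 * (w0 * Y + - z0 * X) in V0.
have cs2 : w0 ^+ 2 * D <= X * V.
  rewrite -subr_ge0 (_ : _ - _ = (w0 * Y - z0 * X) ^+ 2) ?sqr_ge0//.
  by rewrite /D /V; ring.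
have BD : B * D <= A * V.
  have h1 : B * X * D <= A * w0 ^+ 2 * D.
    have h : B * X <= A * w0 ^+ 2 by rewrite expr2 -subr_ge0.
    exact: ler_wpM2r D0 _ _ h.
  have h2 : A * (w0 ^+ 2 * D) <= A * (X * V) by rewrite ler_pM2l.
  rewrite -(ler_pM2l Xp) (_ : X * (B * D) = B * X * D); last by ring.
  by apply: le_trans h1 _; rewrite -mulrA [leRHS]mulrCA.
have {}BD : B * (B * D) <= B * (A * V) by rewrite ler_pM2l.
rewrite /D /V in BD; nra.
Qed.

Lemma lb_ge0 w z : lcone A B w -> lcone A B z -> 0 <= lb A B w z.
Proof.
move=> [w0 hw] [z0 hz]; have cs := ssum_cs w z.
have X0 := ssum_ge0 w; have Z0 := ssum_ge0 z; move: w0 hw z0 hz cs X0 Z0; rewrite /lb.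
move: (ssum w w) (ssum w z) (ssum z z) (w 0 0) (z 0 0) => X Y Z w0 z0 w00 hw z00 hz cs X0 Z0.
rewrite subr_ge0.
have h1 : B * X * (B * Z) <= A * (w0 * w0) * (A * (z0 * z0)).
  apply: ler_pM; [exact: mulr_ge0 (ltW B0) X0|exact: mulr_ge0 (ltW B0) Z0|lra|lra].
have [|Yp] := leP Y 0.
  move=> Y0; apply: (@le_trans _ _ 0); first by rewrite pmulr_rle0.
  by rewrite mulr_ge0 ?(ltW A0)// mulr_ge0.
have h2 : (B * Y) ^+ 2 <= (A * (w0 * z0)) ^+ 2.
  have : B ^+ 2 * Y ^+ 2 <= B ^+ 2 * (X * Z) by rewrite ler_pM2l// exprn_gt0.
  by move=> h; nra.
by rewrite -ler_sqr// nnegrE mulr_ge0 ?(ltW A0) ?(ltW B0) ?mulr_ge0// ltW.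
Qed.

(** If [z] had nonnegative time component but lay outside the cone, the lightlike vector with the
    spatial part of [z] and a larger time component would pair negatively with it. *)
Lemma lcone_dual z : (forall w, lcone A B w -> 0 <= lb A B w z) -> lcone A B z.
Proof.
move=> H.
have lbe w : lb A B (delta_mx 0 0) w = A * w 0 0.
  rewrite /lb (_ : ssum _ w = 0); first by rewrite mulr0 subr0 mxE !eqxx mul1r.
  by apply: big1 => i i0; rewrite mxE (negbTE i0) andbF mul0r.
have e0 : lcone A B (delta_mx 0 0).
  by split; rewrite ?lbe mxE !eqxx// mulr1 ltW.
have z0 : 0 <= z 0 0 by have := H _ e0; rewrite lbe pmulr_rge0.
split => //; rewrite leNgt; apply/negP => qz.
set w0 := Num.sqrt (B / A * ssum z z).
have w00 : 0 <= B / A * ssum z z.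
  by rewrite mulr_ge0 ?ssum_ge0// divr_ge0 ?(ltW A0) ?(ltW B0).
have w0E : A * (w0 * w0) = B * ssum z z.
  by rewrite -expr2 sqr_sqrtr// mulrA; congr (_ * _); field; rewrite gt_eqF.
have lt : z 0 0 < w0.
  rewrite ltNge; apply/negP => le; move: qz; rewrite /lb -w0E.
  have : w0 * w0 <= z 0 0 * z 0 0 by apply: ler_pM; rewrite ?sqrtr_ge0.
  by move=> h; have : A * (w0 * w0) <= A * (z 0 0 * z 0 0) by [rewrite ler_pM2l]; lra.
set w := z + (w0 - z 0 0) *: delta_mx 0 0.
have ww : w 0 0 = w0 by rewrite !mxE !eqxx mulr1 addrC subrK.
have sw v : ssum w v = ssum z v.
  rewrite ssumDl ssumZl (_ : ssum (delta_mx 0 0) v = 0); first by rewrite mulr0 addr0.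
  by apply: big1 => i i0; rewrite mxE (negbTE i0) andbF mul0r.
have cw : lcone A B w.
  split; first by rewrite ww sqrtr_ge0.
  by rewrite /lb sw ssumC sw ww w0E subrr.
have := H w cw; rewrite /lb sw ww -w0E.
have : 0 < w0 by exact: le_lt_trans lt.
by move=> w0p; have : A * (w0 * z 0 0) < A * (w0 * w0) by [rewrite !ltr_pM2l]; lra.
Qed.

Definition tvec : vec := delta_mx 0 0.

Lemma lb_tvec w : lb A B tvec w = A * w 0 0.
Proof.
rewrite /lb (_ : ssum _ w = 0); first by rewrite mulr0 subr0 mxE !eqxx mul1r.
by apply: big1 => i i0; rewrite mxE (negbTE i0) andbF mul0r.
Qed.

Lemma lb_Dtvec (d : R) z : lb A B (z + d *: tvec) (z + d *: tvec) =
  lb A B z z + A * (2 * d * z 0 0 + d ^+ 2).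
Proof.
rewrite lbDl !lbDr !lbZl !lbZr (lbC z tvec) !lb_tvec.
have -> : tvec 0 0 = 1 :> R by rewrite mxE !eqxx.
by ring.
Qed.

Lemma lcone_Dtvec (d : R) z : 0 < d -> lcone A B z ->
  lcone A B (z + d *: tvec) /\ 0 < lb A B (z + d *: tvec) (z + d *: tvec).
Proof.
move=> d0 [z0 hz].
have h : 0 < lb A B (z + d *: tvec) (z + d *: tvec).
  rewrite lb_Dtvec; apply: ltr_wpDl hz _; apply: mulr_gt0 A0 _.
  apply: ltr_wpDl (exprn_gt0 _ d0).
  exact: mulr_ge0 (mulr_ge0 (ler0n _ 2) (ltW d0)) z0.
split=> //; split; last exact: ltW.
by rewrite !mxE !eqxx mulr1 addr_ge0// ltW.
Qed.

(* A linear majorant of the length on the cone, sharp up to [d] at [w]. *)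
Lemma lb_majorant w z : lcone A B w -> 0 < lb A B w w -> lcone A B z ->
  Num.sqrt (lb A B z z) <= lb A B w z / Num.sqrt (lb A B w w).
Proof.
move=> cw w0 cz; have s0 : 0 < Num.sqrt (lb A B w w) by rewrite sqrtr_gt0.
rewrite (ler_pdivlMr _ _ s0).
have h1 : 0 <= Num.sqrt (lb A B z z) * Num.sqrt (lb A B w w).
  by rewrite mulr_ge0 ?sqrtr_ge0.
rewrite -(@ler_sqr _ _ _ h1 (lb_ge0 cw cz)).
rewrite exprMn !sqr_sqrtr ?(ltW w0)//; last by have [] := cz.
by rewrite mulrC; exact: lb_reverse_cs (ltW w0).
Qed.

(** Replacing the argument [z] by [z + d *: tvec] adds [d] times a pairing of two cone vectors,
    which is nonnegative. *)
Lemma lb_majorant_le (d : R) z : 0 < d -> lcone A B z ->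
  lb A B (z + d *: tvec) z / Num.sqrt (lb A B (z + d *: tvec) (z + d *: tvec)) <=
  Num.sqrt (lb A B (z + d *: tvec) (z + d *: tvec)).
Proof.
move=> d0 cz; have [cw w0] := lcone_Dtvec d0 cz.
rewrite ler_pdivrMr ?sqrtr_gt0// -expr2 sqr_sqrtr ?(ltW w0)//.
rewrite [leRHS]lbDr lbZr lerDl mulr_ge0 ?(ltW d0)// lbC lb_tvec.
by rewrite mulr_ge0 ?(ltW A0)//; have [] := cw.
Qed.

End lorentz_algebra.

(** * Comparison of the metric with constant forms *)

Section bform_estimates.
Context (R : realType) (n : nat).
Local Notation vec := 'rV[R]_n.+1.
Local Notation mat := 'M[R]_n.+1.
Implicit Types (v w z : vec) (G Q : mat).

Lemma mx_coord_le_norm (G : mat) i j : `|G i j| <= `|G|.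
Proof.
rewrite [leRHS]mx_normrE.
exact: (@le_bigmax _ _ _ 0 (fun ij => `|G ij.1 ij.2|) (i, j)).
Qed.

Lemma bform_le G v w : `|bform G v w| <= n.+1%:R ^+ 2 * `|G| * (`|v| * `|w|).
Proof.
rewrite bformE; apply: le_trans (ler_norm_sum _ _ _) _.
have -> : n.+1%:R ^+ 2 * `|G| * (`|v| * `|w|) =
    \sum_(i < n.+1) n.+1%:R * (`|v| * `|G| * `|w|).
  by rewrite sumr_const card_ord -[RHS]mulr_natl; ring.
apply: ler_sum => i _; apply: le_trans (ler_norm_sum _ _ _) _.
have -> : n.+1%:R * (`|v| * `|G| * `|w|) = \sum_(j < n.+1) `|v| * `|G| * `|w|.
  by rewrite sumr_const card_ord -[RHS]mulr_natl; ring.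
apply: ler_sum => j _; rewrite !normrM.
apply: ler_pM; rewrite ?mulr_ge0//; last exact: rV_coord_le_norm.
by apply: ler_pM => //; [exact: rV_coord_le_norm|exact: mx_coord_le_norm].
Qed.

Lemma bformD G G' v w : bform (G + G') v w = bform G v w + bform G' v w.
Proof. by rewrite /bform mulmxDr mulmxDl mxE. Qed.

Lemma mulmx_norm_le (Q : mat) : exists2 K, 0 < K & forall v, `|v *m Q| <= K * `|v|.
Proof.
exists (n.+1%:R * (`|Q| + 1)) => [|v]; first by rewrite mulr_gt0// ltr_wpDl.
apply: rV_norm_le => [|j]; first by rewrite !mulr_ge0// addr_ge0.
rewrite mxE; apply: le_trans (ler_norm_sum _ _ _) _.
have -> : n.+1%:R * (`|Q| + 1) * `|v| = \sum_(i < n.+1) `|v| * (`|Q| + 1).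
  by rewrite sumr_const card_ord -[RHS]mulr_natl; ring.
apply: ler_sum => i _; rewrite normrM; apply: ler_pM => //.
  exact: rV_coord_le_norm.
by apply: le_trans (mx_coord_le_norm Q i j) _; rewrite lerDl.
Qed.

Lemma sqr_norm_le_ssum z : `|z| ^+ 2 <= z 0 0 ^+ 2 + ssum z z.
Proof.
have t0 : 0 <= z 0 0 ^+ 2 + ssum z z by rewrite addr_ge0 ?sqr_ge0 ?ssum_ge0.
rewrite -[leRHS](sqr_sqrtr t0) ler_sqr ?nnegrE ?sqrtr_ge0//.
apply: rV_norm_le => [|i]; first exact: sqrtr_ge0.
rewrite -ler_sqr ?nnegrE ?sqrtr_ge0// sqr_sqrtr// real_normK ?num_real//.
have [->|i0] := eqVneq i ord0; first by rewrite lerDl ssum_ge0.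
rewrite /ssum (bigD1 i)//= -expr2 addrCA lerDl addr_ge0 ?sqr_ge0//.
by apply: sumr_ge0 => j _; rewrite -expr2 sqr_ge0.
Qed.

Lemma ssum_le_norm z : z 0 0 ^+ 2 + ssum z z <= n.+1%:R * `|z| ^+ 2.
Proof.
have -> : z 0 0 ^+ 2 + ssum z z = \sum_i z 0 i ^+ 2.
  by rewrite (bigD1 ord0)//=; congr (_ + _); apply: eq_bigr => i _; rewrite expr2.
have -> : n.+1%:R * `|z| ^+ 2 = \sum_(i < n.+1) `|z| ^+ 2.
  by rewrite sumr_const card_ord -[RHS]mulr_natl; ring.
apply: ler_sum => i _; rewrite -(@real_normK _ (z 0 i)) ?num_real// ler_sqr ?nnegrE//.
exact: rV_coord_le_norm.
Qed.

Definition mink : mat := diag_mx (\row_j (if j == ord0 then -1 else 1)).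

Lemma mul_mink z i : (z *m mink) 0 i = if i == ord0 then - z 0 i else z 0 i.
Proof. by rewrite mul_mx_diag !mxE; case: ifP; rewrite ?mulrN1 ?mulr1. Qed.

Lemma bform_mink w z : bform mink w z = - lb 1 1 w z.
Proof.
rewrite /bform mxE (bigD1 ord0)//= mul_mink eqxx !mxE /lb /ssum.
rewrite !mul1r opprB addrC mulNr; congr (_ - _).
by apply: eq_bigr => i i0; rewrite mul_mink (negbTE i0) mxE.
Qed.

Lemma mink2 : mink *m mink = 1%:M.
Proof.
apply/row_matrixP => i; rewrite row_mul; apply/rowP => j.
rewrite mul_mink; rewrite !mxE; have [->|ij] := eqVneq i j.
  by rewrite ?eqxx !mulr1n; case: (j == ord0); rewrite ?opprK.
by rewrite ?(negbTE ij) !mulr0n oppr0 if_same.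
Qed.

Lemma tr_mink : mink^T = mink.
Proof. exact: tr_diag_mx. Qed.

Lemma lb_mono A B A' B' z : A <= A' -> B' <= B -> lb A B z z <= lb A' B' z z.
Proof.
move=> AA BB; rewrite /lb; apply: lerB.
  by apply: ler_wpM2r => //; rewrite -expr2 sqr_ge0.
by apply: ler_wpM2r => //; exact: ssum_ge0.
Qed.

Lemma lb_cvg (T : Type) (F : set_system T) (FF : Filter F) (A B : R)
    (z : T -> vec) (a : vec) : (forall i, (fun x => z x 0 i) @ F --> a 0 i) ->
  (fun x => lb A B (z x) (z x)) @ F --> lb A B a a.
Proof.
move=> za; rewrite /lb; apply: cvgB.
  by apply: cvgM; [exact: cvg_cst|exact: cvgM].
apply: cvgM; first exact: cvg_cst.
rewrite /ssum [X in _ --> X]big_mkcond/=; under eq_fun do rewrite big_mkcond/=.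
apply: cvg_sum_seq => i; case: (i != ord0); last exact: cvg_cst.
exact: cvgM.
Qed.

(* If [m] is timelike for the narrower cone then [m z < 0] picks out the future
   half of the wider one. *)
Lemma lcone_sign (e : R) (m z : vec) : 0 < e -> e < 1 -> m 0 0 < 0 ->
  0 < lb (1 - e) (1 + e) m m -> 0 <= lb (1 + e) (1 - e) z z ->
  m 0 0 * z 0 0 + ssum m z < 0 -> lcone (1 + e) (1 - e) z.
Proof.
move=> e0 e1 m0 hm hz hmz; split => //; rewrite leNgt; apply/negP => z0.
have cs := ssum_cs m z; have X0 := ssum_ge0 m; have Z0 := ssum_ge0 z.
move: m0 hm hz hmz z0 cs X0 Z0; rewrite /lb.
move: (ssum m m) (ssum m z) (ssum z z) (m 0 0) (z 0 0) => X Y Z m0 z0 m00 hm hz hmz z00 cs X0 Z0.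
have mz : 0 < m0 * z0 by rewrite nmulr_rgt0.
have Y2 : (m0 * z0) ^+ 2 < Y ^+ 2.
  rewrite -[ltRHS]sqrrN ltr_sqr ?nnegrE; lra.
have h1 : (1 + e) * X * ((1 - e) * Z) <= (1 - e) * (m0 * m0) * ((1 + e) * (z0 * z0)).
  apply: ler_pM; [apply: mulr_ge0 => //; lra|apply: mulr_ge0 => //; lra|lra|lra].
have k0 : 0 < (1 + e) * (1 - e) by apply: mulr_gt0; lra.
have h2 : (1 + e) * (1 - e) * (X * Z) <= (1 + e) * (1 - e) * (m0 * z0) ^+ 2 by lra.
rewrite ler_pM2l// in h2.
by have := lt_le_trans Y2 (le_trans cs h2); rewrite ltxx.
Qed.

End bform_estimates.

Section frames.
Context (R : realType) (n : nat) (M : topologicalType).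
Variable g : lorentzianManifold R n M.
Implicit Types (c : chart R n M) (p q : M).
Local Notation vec := 'rV[R]_n.+1.
Local Notation mat := 'M[R]_n.+1.

Lemma sym_tensor_cvg (U : set M) h c p : sym_tensor_on g U h -> atlas g c ->
  cdom c p -> U p -> (fun y => h c (cinv c y)) @ c p --> h c p.
Proof.
move=> [_ sm _] ac cp Up.
have im : cimg c U (c p) := ex_intro2 _ _ p (conj cp Up) erefl.
have H : {for c p, continuous (fun y => h c (cinv c y))} :=
  smooth_on_continuous (sm c ac) im.
have E : h c (cinv c (c p)) = h c p by rewrite (cmapK cp).
by rewrite -E; exact: H.
Qed.

Lemma mx_coord_cvg (F : set_system vec) (FF : Filter F) (G : vec -> mat) (G0 : mat) i j :
  G @ F --> G0 -> (fun y => G y i j) @ F --> G0 i j.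
Proof. by move=> GG; exact: (cvg_comp _ _ GG (@coord_continuous _ _ _ i j _)). Qed.

Lemma orientation_cvg c p : atlas g c -> cdom c p ->
  (fun y => orientation g c (cinv c y)) @ c p --> orientation g c p.
Proof.
move=> ac cp.
have H := @orientation_cont _ _ _ g c p ac cp.
have E : orientation g c (cinv c (c p)) = orientation g c p by rewrite (cmapK cp).
by rewrite -E; exact: H.
Qed.

(** A basis in signature normal form, with its time axis reversed by [mink] when [o] would point to
    the past. The last two conditions say that the covector [o *m G] is negative on the time axis
    and timelike, so that it picks out the future half of the cone. *)
Lemma adapted_basis (G : mat) (o : vec) : lorentz_signature G -> bform G o o < 0 ->
  exists Q : mat, [/\ Q \in unitmx, Q *m G *m Q^T = mink R n,
    (o *m G *m Q^T) 0 0 < 0 &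
    ssum (o *m G *m Q^T) (o *m G *m Q^T) < (o *m G *m Q^T) 0 0 ^+ 2].
Proof.
move=> [P uP PG] oo; rewrite -/(mink R n) in PG.
set w := o *m invmx P; have oE : o = w *m P by rewrite mulmxKV.
have mE : o *m G *m P^T = w *m mink R n by rewrite oE -PG !mulmxA.
have ww : ssum w w < w 0 0 ^+ 2.
  move: oo; rewrite oE -bform_mulmx PG bform_mink /lb !mul1r oppr_lt0 subr_gt0.
  by rewrite expr2.
have sE m : ssum (m *m mink R n) (m *m mink R n) = ssum m m.
  by apply: eq_bigr => i i0; rewrite !mul_mink (negbTE i0).
have nE (m : vec) : (m *m mink R n) 0 0 = - m 0 0 by rewrite mul_mink eqxx.
have w0 : w 0 0 != 0.
  apply/eqP => w0; move: ww; rewrite w0 expr0n/=.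
  by move=> /lt_geF; rewrite ssum_ge0.
have [wp|wn] := ltP 0 (w 0 0).
  by exists P; split=> //; rewrite mE ?sE ?nE ?sqrrN// oppr_lt0.
exists (mink R n *m P); split.
- rewrite unitmx_mul uP andbT; have := mink2 R n => /mulmx1_unit[] //.
- rewrite trmx_mul tr_mink !mulmxA -(mulmxA (mink R n)) -!mulmxA.
  rewrite (mulmxA P) (mulmxA (P *m G)) PG.
  by rewrite mink2 mulmx1.
- rewrite trmx_mul tr_mink mulmxA mE nE nE opprK.
  by rewrite lt_neqAle w0.
- by rewrite trmx_mul tr_mink mulmxA mE !sE !nE opprK.
Qed.

(** In the frame the metric is Minkowskian at [p0]; nearby it deviates by at most [d] times the
    Euclidean square, which moves both coefficients of the form by [d]. The orientation covector
    stays timelike nearby and decides the half of the cone. *)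
Lemma metric_frame c p0 : atlas g c -> cdom c p0 -> exists2 P : mat, P \in unitmx &
  forall e : R, 0 < e -> e < 1 -> \forall y \near c p0, forall v : vec,
    [/\ - bform (metric g c (cinv c y)) v v <= lb (1 + e) (1 - e) (v *m P) (v *m P),
        lb (1 - e) (1 + e) (v *m P) (v *m P) <= - bform (metric g c (cinv c y)) v v
      & future_in g c (cinv c y) v -> lcone (1 + e) (1 - e) (v *m P)].
Proof.
move=> ac cp.
have [Q [uQ QG m0 mm]] := adapted_basis (metric_signature ac cp) (orientation_timelike ac cp).
exists (invmx Q) => [|e e0 e1]; first by rewrite unitmx_inv.
set G0 := metric g c p0 in QG m0 mm; set o0 := orientation g c p0 in m0 mm.
set m := o0 *m G0 *m Q^T in m0 mm.
set X := ssum m m in mm; have X0 : 0 <= X := ssum_ge0 m.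
(* The second bound leaves at least half of [m 0 0 ^+ 2 - X] in the form with coefficients [1 - d]
   and [1 + d], so [m] is timelike for it. *)
set d := Num.min e ((m 0 0 ^+ 2 - X) / (2 * (m 0 0 ^+ 2 + X))).
have den : 0 < 2 * (m 0 0 ^+ 2 + X) by rewrite mulr_gt0// ltr_pwDl// exprn_even_gt0//= lt_eqF.
have d0 : 0 < d by rewrite lt_min e0 divr_gt0// subr_gt0.
have de : d <= e by rewrite ge_min lexx.
have d1 : d < 1 by exact: le_lt_trans e1.
have mpos : 0 < lb (1 - d) (1 + d) m m.
  have : d * (2 * (m 0 0 ^+ 2 + X)) <= m 0 0 ^+ 2 - X.
    by rewrite -ler_pdivlMr// ge_min lexx orbT.
  by rewrite /lb -expr2 -/X; lra.
have cG := sym_tensor_cvg (metric_tensor g) ac cp I.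
have cO := orientation_cvg ac cp.
pose mu y := orientation g c (cinv c y) *m metric g c (cinv c y) *m Q^T.
have FF : Filter (nbhs (c p0)) := nbhs_filter (c p0).
have cmu i : (fun y => mu y 0 i) @ nbhs (c p0) --> m 0 i.
  rewrite /mu [X in _ --> X]mxE; under eq_fun do rewrite mxE.
  apply: (@cvg_sum_seq _ _ _ FF) => k; apply: cvgM; last exact: cvg_cst.
  rewrite [X in _ --> X]mxE; under eq_fun do rewrite mxE.
  apply: (@cvg_sum_seq _ _ _ FF) => l; apply: cvgM; last exact: (@mx_coord_cvg _ FF _ _ l k cG).
  exact: (cvg_comp _ _ cO (@coord_continuous _ _ _ 0 l _)).
have n1 : \forall y \near c p0, mu y 0 0 < 0 by exact: (cvgr_lt _ (cmu 0) _ m0).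
have n2 : \forall y \near c p0, 0 < lb (1 - d) (1 + d) (mu y) (mu y).
  exact: (cvgr_gt _ (@lb_cvg R n _ _ FF (1 - d) (1 + d) _ _ cmu) _ mpos).
have [K K0 HK] := mulmx_norm_le Q.
have eta0 : 0 < d / (n.+1%:R ^+ 2 * K ^+ 2) by rewrite divr_gt0// mulr_gt0// exprn_gt0.
have n3 : \forall y \near c p0, `|G0 - metric g c (cinv c y)| < d / (n.+1%:R ^+ 2 * K ^+ 2).
  by move/cvgrPdist_lt: cG; apply.
near=> y.
have G3 : `|G0 - metric g c (cinv c y)| < d / (n.+1%:R ^+ 2 * K ^+ 2) by near: y.
have y1 : mu y 0 0 < 0 by near: y.
have y2 : 0 < lb (1 - d) (1 + d) (mu y) (mu y) by near: y.
move=> v; set z := v *m invmx Q; set G := metric g c (cinv c y) in G3 *.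
have vE : v = z *m Q by rewrite mulmxKV.
have est : `|bform G v v + lb 1 1 z z| <= d * (z 0 0 ^+ 2 + ssum z z).
  have -> : bform G v v + lb 1 1 z z = - bform (G0 - G) v v.
    rewrite bformD bformN (_ : bform G0 v v = - lb 1 1 z z); first by ring.
    by rewrite vE -bform_mulmx QG bform_mink.
  rewrite normrN; apply: le_trans (bform_le _ _ _) _.
  have vK : `|v| * `|v| <= K ^+ 2 * (z 0 0 ^+ 2 + ssum z z).
    apply: (@le_trans _ _ ((K * `|z|) * (K * `|z|))).
      by apply: ler_pM => //; rewrite vE; exact: HK.
    rewrite mulrACA -!expr2 ler_pM2l ?exprn_gt0//; exact: sqr_norm_le_ssum.
  apply: (@le_trans _ _ (n.+1%:R ^+ 2 * (d / (n.+1%:R ^+ 2 * K ^+ 2)) *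
      (K ^+ 2 * (z 0 0 ^+ 2 + ssum z z)))).
    by apply: ler_pM; rewrite ?mulr_ge0// ler_pM2l ?exprn_gt0//; exact: ltW.
  rewrite le_eqVlt; apply/orP; left; apply/eqP; field.
  by rewrite gt_eqF// nat1r pnatr_eq0.
have up : - bform G v v <= lb (1 + d) (1 - d) z z.
  move: est; rewrite ler_norml /lb expr2 => /andP[]; lra.
have lo : lb (1 - d) (1 + d) z z <= - bform G v v.
  move: est; rewrite ler_norml /lb expr2 => /andP[]; lra.
split.
- by apply: le_trans up _; apply: lb_mono; lra.
- by apply: le_trans _ lo; apply: lb_mono; lra.
move=> [_ vv ov].
have [z0 _] : lcone (1 + d) (1 - d) z.
  apply: (lcone_sign (m := mu y) d0 d1 y1 y2).
    by apply: le_trans _ up; rewrite oppr_ge0.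
  suff <- : bform G (orientation g c (cinv c y)) v = mu y 0 0 * z 0 0 + ssum (mu y) z by [].
  transitivity (\sum_j mu y 0 j * z 0 j); last by rewrite (bigD1 ord0).
  rewrite /bform {1}vE trmx_mul mulmxA mxE; apply: eq_bigr => j _.
  by rewrite [z^T _ _]mxE.
split => //; apply: (@le_trans _ _ (lb (1 + d) (1 - d) z z)).
  by apply: le_trans _ up; rewrite oppr_ge0.
by apply: lb_mono; lra.
Unshelve. all: end_near. Qed.

Lemma posdef_lower (H : mat) : (forall v : vec, v != 0 -> 0 < bform H v v) ->
  exists2 k, 0 < k & forall v : vec, k * `|v| ^+ 2 <= bform H v v.
Proof.
move=> pd; set Sp := [set v : vec | `|v| = 1].
have cSp : compact Sp.
  apply: bounded_closed_compact; first by exists 1; split => // x x1 v /= ->; exact: ltW.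
  have -> : Sp = (fun v : vec => `|v|) @^-1` [set (1 : R)] by [].
  by apply: closed_comp; [move=> v _; exact: norm_continuous|exact: closed_eq].
have cB : continuous (fun v : vec => bform H v v : R^o).
  move=> v; rewrite /continuous_at bformE; under eq_fun do rewrite bformE.
  have FF : Filter (nbhs v) := nbhs_filter v.
  apply: (@cvg_sum_seq _ _ _ FF) => i; apply: (@cvg_sum_seq _ _ _ FF) => j.
  by apply: cvgM; [apply: cvgM; [exact: coord_continuous|exact: cvg_cst]|exact: coord_continuous].
have Sp0 : Sp !=set0.
  exists (delta_mx 0 0); rewrite /Sp/=; apply/eqP; rewrite eq_le; apply/andP; split.
    by apply: rV_norm_le => // i; rewrite mxE eqxx; case: (i == 0); rewrite ?normr1 ?normr0.
  by have := rV_coord_le_norm (delta_mx 0 0 : vec) 0; rewrite mxE !eqxx normr1.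
have wB : {within Sp, continuous (fun v : vec => bform H v v : R^o)}.
  exact: continuous_subspaceT.
have [u Su Hu] := EVT_min_rV Sp0 cSp wB.
have u0 : u != 0 by apply/eqP => u0; move: Su; rewrite inE /Sp/= u0 normr0 => /eqP; rewrite eq_sym oner_eq0.
exists (bform H u u) => [|v]; first exact: pd.
have [->|v0] := eqVneq v 0.
  by rewrite normr0 expr0n/= mulr0 bformE big1// => i _; rewrite big1// => j _; rewrite mxE !mul0r.
have nv : 0 < `|v| by rewrite normr_gt0.
have Sv : (`|v|^-1 *: v) \in Sp.
  by rewrite inE /Sp/= normrZ gtr0_norm ?invr_gt0// mulVf ?gt_eqF.
have := Hu _ Sv; rewrite bformZl bformZr mulrA -expr2 exprVn mulrC ler_pdivlMr ?exprn_gt0//.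
Qed.

(** Half of the lower bound at [p0] absorbs the variation of the components nearby. *)
Lemma riemannian_lower (U : set M) h c p0 : riemannian_on g U h -> atlas g c ->
  cdom c p0 -> U p0 -> exists2 k, 0 < k &
    \forall y \near c p0, forall v : vec, k * `|v| ^+ 2 <= bform (h c (cinv c y)) v v.
Proof.
move=> [st pd] ac cp Up; have cH := sym_tensor_cvg st ac cp Up.
have [k k0 Hk] := posdef_lower (fun v => pd c p0 v ac cp Up).
exists (k / 2); first by rewrite divr_gt0.
have eta0 : 0 < (k / 2) / n.+1%:R ^+ 2 by rewrite !divr_gt0// exprn_gt0.
have nH : \forall y \near c p0, `|h c p0 - h c (cinv c y)| < (k / 2) / n.+1%:R ^+ 2.
  by move/cvgrPdist_lt: cH; apply.
apply: filterS nH => y Hy v; set H0 := h c p0 in Hk Hy *; set H := h c (cinv c y) in Hy *.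
have -> : bform H v v = bform H0 v v - bform (H0 - H) v v.
  by rewrite bformD bformN; ring.
have := Hk v; have : `|bform (H0 - H) v v| <= k / 2 * `|v| ^+ 2.
  apply: le_trans (bform_le _ _ _) _; rewrite -expr2; apply: ler_wpM2r; first exact: sqr_ge0.
  by rewrite mulrC -ler_pdivlMr ?exprn_gt0//; exact: ltW.
rewrite ler_norml => /andP[_]; lra.
Qed.

End frames.

Lemma within_continuousP (R : realType) (T : topologicalType) (I : set R) (h : R -> T) :
  {within I, continuous h} <-> forall t W, I t -> nbhs (h t) W ->
    exists2 d, 0 < d & forall s, I s -> `|s - t| < d -> W (h s).
Proof.
rewrite subspace_continuousP; split=> H t.
  move=> W It nW; have [d /= d0 Hd] := H t It W nW.
  by exists d => // s Is sd; apply: Hd => //; rewrite /ball/= distrC.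
move=> It W nW; have [d d0 Hd] := H t W It nW.
by exists d => //= s; rewrite /ball/= distrC => sd Is; exact: Hd.
Qed.

(** * Trapping of curves in chart balls *)

Section trap.
Context (R : realType) (n : nat) (M : topologicalType).
Variable S : smoothManifold R n M.
Implicit Types (c : chart R n M) (p q : M) (sigma : R -> M).
Local Notation vec := 'rV[R]_n.+1.

Definition chart_ball c (y : vec) (r : R) : set M :=
  [set q | cdom c q /\ `|c q - y| < r].

Lemma near_chart_ball c y r p : chart_ball c y r p -> nbhs p (chart_ball c y r).
Proof.
move=> [cp pr].
have cc : c @ p --> c p := @cmap_cont _ _ _ c p cp.
have n1 : \forall q \near p, `|c p - c q| < r - `|c p - y|.
  by move/cvgrPdist_lt: cc; apply; rewrite subr_gt0.
apply: filterS (filterI (near_cdom cp) n1) => q [cq H]; split => //.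
have := ler_normB (c p - y) (c p - c q).
rewrite (_ : c p - y - (c p - c q) = c q - y); last by apply/rowP => i; rewrite !mxE; ring.
by move=> le; apply: le_lt_trans le _; rewrite -ltrBrDl.
Qed.

Lemma compact_chart_ball c y r : (forall z, `|z - y| <= r -> (c @` cdom c) z) ->
  compact [set q | cdom c q /\ `|c q - y| <= r].
Proof.
move=> im; set B := [set z : vec | `|z - y| <= r].
have -> : [set q | cdom c q /\ `|c q - y| <= r] = cinv c @` B.
  apply/seteqP; split=> q /=.
    by move=> [cq qr]; exists (c q) => //; exact: cmapK.
  by move=> [z zr <-]; have [E D] := cinvK (im z zr); rewrite E.
apply: continuous_compact.
  apply: continuous_in_subspaceT => z; rewrite inE => /im zi; exact: cinv_cont.
apply: bounded_closed_compact.
  exists (r + `|y|); split; first by rewrite num_real.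
  move=> x rx z /= zr; apply: le_trans (ltW rx).
  by rewrite -{1}(subrK y z); apply: le_trans (ler_normD _ _) _; rewrite lerD2r.
have -> : B = (fun z : vec => `|z - y|) @^-1` [set t : R | t <= r] by [].
apply: closed_comp; last exact: closed_le.
move=> z _; apply: (@continuous_comp _ _ _ (fun z : vec => z - y) (fun v : vec => `|v|)).
  by apply: continuousB; [exact: cvg_id|exact: cst_continuous].
exact: norm_continuous.
Qed.

Lemma closed_chart_ball c y r : (forall z, `|z - y| <= r -> (c @` cdom c) z) ->
  closed [set q | cdom c q /\ `|c q - y| <= r].
Proof.
by move=> im; apply: compact_closed; [exact: (manifold_hausdorff S)|exact: compact_chart_ball].
Qed.

(** While the curve is in the ball its displacement is paid for by the increase of [F], so it is in
    a smaller closed ball and cannot escape. The smaller ball is closed in [M], being compact in a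
    Hausdorff space; this excludes leaving the chart domain without crossing a coordinate sphere. *)
Lemma curve_trap c y (r : R) sigma (F : R -> R) (u v : R) : u <= v ->
  (forall z, `|z - y| <= r -> (c @` cdom c) z) ->
  {within `[u, v], continuous sigma} ->
  (forall s t, u <= s -> s <= t -> t <= v -> F s <= F t) ->
  cdom c (sigma u) -> `|c (sigma u) - y| + (F v - F u) < r ->
  (forall t, u < t -> t <= v ->
    (forall s, u <= s <= t -> chart_ball c y r (sigma s)) ->
    `|c (sigma t) - c (sigma u)| <= F t - F u) ->
  forall t, u <= t <= v ->
    chart_ball c y r (sigma t) /\ `|c (sigma t) - c (sigma u)| <= F t - F u.
Proof.
move=> uv im /within_continuousP sc Fm cu ur H.
set B := chart_ball c y r.
have Bu : B (sigma u).
  by split=> //; apply: le_lt_trans ur; rewrite lerDl subr_ge0 Fm.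
pose P t := forall s, u <= s <= t -> B (sigma s).
have est t : u <= t -> t <= v -> P t -> `|c (sigma t) - c (sigma u)| <= F t - F u.
  rewrite le_eqVlt => /predU1P[<-|ut] tv Pt; first by rewrite !subrr normr0.
  exact: H.
suff Pv : P v.
  move=> t /andP[ut tv]; split; first by apply: Pv; rewrite ut.
  by apply: est => // s /andP[us st]; apply: Pv; rewrite us (le_trans st).
set r' := `|c (sigma u) - y| + (F v - F u) in ur.
have Br t : u <= t -> t <= v -> P t -> `|c (sigma t) - y| <= r'.
  move=> ut tv Pt; rewrite -(subrK (c (sigma u)) (c (sigma t))) -addrA addrC.
  apply: le_trans (ler_normD _ _) _; rewrite lerD2l.
  by apply: le_trans (est _ ut tv Pt) _; rewrite lerD2r Fm.
apply: (@real_induction _ P u v uv).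
- by move=> s /andP[us su]; have -> : s = u by [apply/eqP; rewrite eq_le su].
- move=> t ut tv Pt; have tI : `[u, v]%classic t by rewrite /= in_itv/= ut ltW.
  have Bt : B (sigma t) by apply: Pt; rewrite ut lexx.
  have [d d0 Hd] := sc t B tI (near_chart_ball Bt).
  exists d => // s ts std sv z /andP[uz zs].
  have [zt|tz] := leP z t; first by apply: Pt; rewrite uz.
  apply: Hd; first by rewrite /= in_itv/= uz (le_trans zs).
  by rewrite ger0_norm ?subr_ge0 1?ltW//; lra.
move=> t ut tv Ht z /andP[uz zt].
move: zt; rewrite le_eqVlt => /predU1P[->|zt]; last by apply: (Ht z uz zt); rewrite uz lexx.
have tI : `[u, v]%classic t by rewrite /= in_itv/= tv ltW.
have im' z' : `|z' - y| <= r' -> (c @` cdom c) z'.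
  by move=> h; apply: im; apply: le_trans h (ltW ur).
have cB := closed_chart_ball im'.
apply: contrapT => nB.
have nt : ~ [set q | cdom c q /\ `|c q - y| <= r'] (sigma t).
  by move=> [h1 h2]; apply: nB; split => //; exact: le_lt_trans ur.
have oN : nbhs (sigma t) (~` [set q | cdom c q /\ `|c q - y| <= r']).
  by apply: open_nbhs_nbhs; split => //; exact: closed_openC.
have [d d0 Hd] := sc t _ tI oN.
pose s := Num.max u (t - d / 2).
have st : s < t by rewrite gt_max ut/= ltrBlDr ltrDl divr_gt0.
have us : u <= s by rewrite le_max lexx.
have Ps := Ht s us st.
have sv : s <= v by rewrite (le_trans (ltW st)).
apply: (Hd s); first by rewrite /= in_itv/= us.
  rewrite ltr0_norm ?subr_lt0// opprB.
  have : t - d / 2 <= s by rewrite le_max lexx orbT.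
  lra.
split; last exact: Br.
by have [] := Ps s (introT andP (conj us (lexx s))).
Qed.

End trap.

(** * Linear functionals along curves and lower bounds for lengths *)

Section linear_functional.
Context (R : realType) (n : nat).
Local Notation vec := 'rV[R]_n.+1.

Lemma linear_derive1 (L : vec -> R) (K : R) (x : R -> vec) t :
  {morph L : a b / a - b} -> (forall a v, L (a *: v) = a * L v) ->
  (forall v, `|L v| <= K * `|v|) -> derivable x t 1 ->
  derivable (fun s => L (x s)) t 1 /\ derive1 (fun s => L (x s)) t = L (derive1 x t).
Proof.
move=> LB LZ LK dx; apply: increment_derivable => e e0.
have K0 : 0 < `|K| + 1 by rewrite ltr_wpDl.
have [d d0 Hd] := derivable_increment dx (divr_gt0 e0 K0).
exists d => // s sd; have := Hd s sd; set D := _ - _ - _ => HD.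
have -> : L (x s) - L (x t) - (s - t) *: L (derive1 x t) = L D.
  by rewrite /D !LB LZ.
apply: le_trans (LK D) _; apply: (@le_trans _ _ ((`|K| + 1) * `|D|)).
  by apply: ler_wpM2r => //; apply: le_trans (ler_norm K) _; rewrite lerDl.
rewrite mulrC -ler_pdivlMr//; apply: le_trans HD _.
by rewrite mulrAC.
Qed.

Lemma lb_mulmx_bound (A B : R) w (P : 'M[R]_n.+1) :
  exists K, forall v : vec, `|lb A B w (v *m P)| <= K * `|v|.
Proof.
have [K K0 HK] := mulmx_norm_le P.
pose k := `|A| * `|w 0 0| + `|B| * \sum_(i | i != ord0) `|w 0 i|.
have k0 : 0 <= k by rewrite addr_ge0 ?mulr_ge0// sumr_ge0.
exists (k * K) => v; rewrite -mulrA; apply: le_trans (ler_wpM2l k0 (HK v)).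
set z := v *m P; rewrite /lb; apply: le_trans (ler_normB _ _) _; rewrite mulrDl; apply: lerD.
  by rewrite !normrM mulrA; apply: ler_wpM2l; [exact: mulr_ge0|exact: rV_coord_le_norm].
rewrite normrM -mulrA; apply: ler_wpM2l => //; rewrite mulr_suml.
apply: le_trans (ler_norm_sum _ _ _) _; apply: ler_sum => i _.
by rewrite normrM; apply: ler_wpM2l => //; exact: rV_coord_le_norm.
Qed.

Lemma lb_mulmxB A B w (P : 'M[R]_n.+1) : {morph (fun v : vec => lb A B w (v *m P)) : a b / a - b}.
Proof. by move=> a b; rewrite mulmxBl lbBr. Qed.

Lemma lb_mulmxZ A B w (P : 'M[R]_n.+1) a (v : vec) :
  lb A B w ((a *: v) *m P) = a * lb A B w (v *m P).
Proof. by rewrite -scalemxAl lbZr. Qed.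

Lemma lb_mulmx_derive1 A B w (P : 'M[R]_n.+1) (x : R -> vec) t : derivable x t 1 ->
  derivable (fun s => lb A B w (x s *m P)) t 1 /\
  derive1 (fun s => lb A B w (x s *m P)) t = lb A B w (derive1 x t *m P).
Proof.
move=> dx; have [K HK] := lb_mulmx_bound A B w P.
exact: (linear_derive1 (@lb_mulmxB A B w P) (@lb_mulmxZ A B w P) HK dx).
Qed.

(** Paired with a cone vector, the curve becomes a scalar function with nonnegative derivative; the
    mean value theorem and self-duality conclude. *)
Lemma lcone_increment (A B : R) (P : 'M[R]_n.+1) (x : R -> vec) u v : 0 < A -> 0 < B ->
  u < v -> (forall t, u <= t <= v -> derivable x t 1 /\ lcone A B (derive1 x t *m P)) ->
  lcone A B ((x v - x u) *m P).
Proof.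
move=> A0 B0 uv H; apply: lcone_dual => // w cw.
rewrite mulmxBl lbBr subr_ge0.
have dL t : u <= t <= v -> derivable (fun s => lb A B w (x s *m P)) t 1 /\
    0 <= derive1 (fun s => lb A B w (x s *m P)) t.
  move=> /H[dx cx]; have [d1 ->] := lb_mulmx_derive1 A B w P dx; split => //.
  exact: lb_ge0.
have [r rI E] : exists2 r, r \in `]u, v[ &
    lb A B w (x v *m P) - lb A B w (x u *m P) =
    derive1 (fun s => lb A B w (x s *m P)) r * (v - u).
  apply: (@MVT _ (fun s => lb A B w (x s *m P)) _ u v uv).
    move=> r; rewrite in_itv/= => /andP[r1 r2].
    have [dr _] := dL r (introT andP (conj (ltW r1) (ltW r2))).
    by rewrite derive1E; exact: derivableP.
  by apply: derivable_within_continuous => r; rewrite in_itv/= => /dL[].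
rewrite -subr_ge0 E mulr_ge0 ?subr_ge0 ?(ltW uv)//.
by move: rI; rewrite in_itv/= => /andP[r1 r2]; have [] := dL r (introT andP (conj (ltW r1) (ltW r2))).
Qed.

End linear_functional.

Section qlength_lower.
Context (R : realType) (n : nat) (M : topologicalType).
Variable g : lorentzianManifold R n M.
Implicit Types (c : chart R n M) (p q : M) (sigma : R -> M) (U : set M).
Local Notation vec := 'rV[R]_n.+1.
Local Notation leb := (@lebesgue_measure R).

Lemma enorm_le_norm (v : vec) : enorm v <= n.+1%:R * `|v|.
Proof.
have n1 : 1 <= n.+1%:R :> R by rewrite ler1n.
rewrite /enorm -[leRHS]ger0_norm ?mulr_ge0// -sqrtr_sqr; apply: ler_wsqrtr.
have := ssum_le_norm v; have -> : v 0 0 ^+ 2 + ssum v v = \sum_i v 0 i ^+ 2.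
  by rewrite (bigD1 ord0)//=; congr (_ + _); apply: eq_bigr => i _; rewrite expr2.
move=> /le_trans; apply; rewrite exprMn ler_wpM2r ?sqr_ge0//.
by rewrite expr2 ler_peMl.
Qed.

Lemma C1_lipschitz (x : R -> vec) t : (\forall s \near t, derivable x s 1) ->
  {for t, continuous (derive1 x)} ->
  exists2 d, 0 < d & forall s s', `|s - t| < d -> `|s' - t| < d ->
    `|x s - x s'| <= (`|derive1 x t| + 1) * `|s - s'|.
Proof.
move=> nd cd; have [d d0 Hd] := C1_increment nd cd ltr01; exists d => // s s' sd s'd.
rewrite -(subrK ((s - s') *: derive1 x t) (x s - x s')).
apply: le_trans (ler_normD _ _) _; rewrite mulrDl addrC mul1r normrZ mulrC lerD2l.
by have := Hd s s' sd s'd; rewrite mul1r.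
Qed.

Lemma smooth_near_lipschitz (I : set R) sigma :
  (forall t, I t -> smooth_near g sigma t) -> lipschitz_curve g I sigma.
Proof.
move=> sm t It; set c := chart_at g (sigma t).
have ac : atlas g c := chart_at_atlas g _; have ct : cdom c (sigma t) := chart_at_dom g _.
have [nd cd] := smooth_near_C1 (sm t It) ac ct.
have [d d0 Hd] := C1_lipschitz nd cd.
have nc : \forall s \near t, cdom c (sigma s).
  exact: (smooth_near_continuous (sm t It) (near_cdom ct)).
exists c, (ball t d `&` [set s | cdom c (sigma s)]), (n.+1%:R * (`|derive1 (c \o sigma : R -> vec) t| + 1)).
split.
- exact: ac.
- by apply: filterI => //; exact: nbhsx_ballx.
- by move=> s [].
move=> s s' [sd _] _ [s'd _] _; apply: le_trans (enorm_le_norm _) _.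
rewrite -mulrA; apply: ler_wpM2l => //; apply: Hd.
  by move: sd; rewrite /ball/= distrC.
by move: s'd; rewrite /ball/= distrC.
Qed.

Lemma reparam_id (u v : R) : u <= v -> reparam id u v u v.
Proof.
move=> uv; split=> //; apply: continuous_subspaceT => x; exact: cvg_id.
Qed.

Lemma speed_ge0 (Q : chart R n M -> M -> 'M[R]_n.+1) sigma t : 0 <= speed g Q sigma t.
Proof. by rewrite /speed; case: ifP => _; [exact: sqrtr_ge0|]. Qed.

Lemma speed_integral_le_qlength (Q : chart R n M -> M -> 'M[R]_n.+1) sigma u v : u <= v ->
  lipschitz_curve g `[u, v] sigma ->
  (\int[leb]_(t in `[u, v]) (speed g Q sigma t)%:E <= qlength g Q sigma u v)%E.
Proof.
move=> uv lc; apply: ereal_sup_ubound; exists id, u, v.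
by split; [exact: reparam_id|exact: lc|].
Qed.

Lemma increment_le_integral (y : R -> R) (F : R -> R) u v : u < v ->
  (forall t, u <= t <= v -> derivable y t 1 /\ {for t, continuous (derive1 y)}) ->
  (forall t, 0 <= F t) -> (forall t, u <= t <= v -> `|derive1 y t| <= F t) ->
  (`|y v - y u|%:E <= \int[leb]_(t in `[u, v]) (F t)%:E)%E.
Proof.
move=> uv Hy F0 HF.
have cy t : u <= t <= v -> {for t, continuous y}.
  by move=> t01; exact: (derivable_continuous_at (Hy t t01).1).
have uI : u <= u <= v by rewrite lexx ltW.
have vI : u <= v <= v by rewrite lexx andbT ltW.
have cdy : {within `[u, v], continuous (derive1 y)}.
  by apply: continuous_in_subspaceT => t; rewrite inE/= in_itv/= => t01; exact: (Hy t t01).2.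
have LR : derivable_oo_LRcontinuous y u v.
  split.
  - move=> t; rewrite in_itv/= => /andP[t1 t2].
    exact: (Hy t (introT andP (conj (ltW t1) (ltW t2)))).1.
  - by apply: cvg_at_right_filter; exact: cy.
  - by apply: cvg_at_left_filter; exact: cy.
have E := continuous_FTC2 uv cdy LR (fun t _ => erefl).
rewrite -abse_EFin EFinB -E.
have mdy : measurable_fun (`[u, v] : set R) (derive1 y).
  by apply: subspace_continuous_measurable_fun => //; exact: measurable_itv.
apply: (@le_trans _ _ (\int[leb]_(t in `[u, v]) `|(derive1 y t)%:E|)%E).
  apply: le_abse_integral; first exact: measurable_itv.
  exact/measurable_EFinP.
apply: ge0_le_integral_fun => t /=; first by rewrite lee_fin.
by rewrite in_itv/= lee_fin => /HF.
Qed.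

(** The norm is the largest coordinate, so it is enough to integrate each coordinate derivative,
    which is at most the speed divided by [Num.sqrt k]. *)
Lemma qlength_lower (Q : chart R n M -> M -> 'M[R]_n.+1) c k sigma :
  0 < k -> atlas g c ->
  (forall t, 0 <= t <= 1 -> smooth_near g sigma t /\ cdom c (sigma t)) ->
  (forall t, 0 <= t <= 1 -> covariant_at g Q (sigma t) /\
    forall v : vec, k * `|v| ^+ 2 <= bform (Q c (sigma t)) v v) ->
  ((Num.sqrt k * `|c (sigma 1) - c (sigma 0)|)%:E <= qlength g Q sigma 0 1)%E.
Proof.
move=> k0 ac sm HQ; have sk0 : 0 < Num.sqrt k by rewrite sqrtr_gt0.
have lc : lipschitz_curve g `[0, 1] sigma.
  by apply: smooth_near_lipschitz => t /=; rewrite in_itv/= => /sm[].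
apply: le_trans (speed_integral_le_qlength Q ler01 lc).
set x := (c \o sigma : R -> vec).
have spE t : 0 <= t <= 1 -> Num.sqrt k * `|derive1 x t| <= speed g Q sigma t.
  move=> t01; have [sn ct] := sm t t01; have [cQ HQt] := HQ t t01.
  have dx := smooth_near_derivable sn ac ct.
  rewrite (speedE cQ (smooth_near_continuous sn) ac ct) (if_asboolT _ _ dx).
  rewrite -[leLHS]ger0_norm ?mulr_ge0 ?sqrtr_ge0// -sqrtr_sqr; apply: ler_wsqrtr.
  by rewrite exprMn sqr_sqrtr ?(ltW k0).
have H i : ((Num.sqrt k * `|x 1 0 i - x 0 0 i|)%:E <=
    \int[leb]_(t in `[0%R, 1%R]) (speed g Q sigma t)%:E)%E.
  have -> : Num.sqrt k * `|x 1 0 i - x 0 0 i| =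
      `|(Num.sqrt k *: (fun t => x t 0 i)) 1 - (Num.sqrt k *: (fun t => x t 0 i)) 0|.
    have -> : (Num.sqrt k *: (fun t => x t 0 i)) 1 - (Num.sqrt k *: (fun t => x t 0 i)) 0 =
      Num.sqrt k * (x 1 0 i - x 0 0 i) by rewrite mulrBr.
    by rewrite normrM (ger0_norm (ltW sk0)).
  have dxi t : 0 <= t <= 1 -> derivable (fun t => x t 0 i) t 1 /\
      derive1 (fun t => x t 0 i) t = (derive1 x t) 0 i.
    move=> t01; have [sn ct] := sm t t01.
    by apply: derivable_coord_at; exact: smooth_near_derivable sn ac ct.
  apply: increment_le_integral; [exact: ltr01| |by move=> t; exact: speed_ge0|].
    move=> t t01; have [sn ct] := sm t t01; have [nd cd] := smooth_near_C1 sn ac ct.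
    split; first by apply: derivableZ; exact: (dxi t t01).1.
    have ci : {for t, continuous (fun s => Num.sqrt k * (derive1 x s) 0 i)}.
      apply: continuousM; first exact: cst_continuous.
      exact: (cvg_comp _ _ cd (@coord_continuous _ _ _ 0 i _)).
    have Es s : derivable x s 1 -> derive1 (Num.sqrt k *: (fun t => x t 0 i)) s =
        Num.sqrt k * (derive1 x s) 0 i.
      move=> dx; have [d1 d2] := derivable_coord_at i dx.
      by rewrite (derive1_scale _ d1) d2.
    have Et : derive1 (Num.sqrt k *: (fun t => x t 0 i)) t = Num.sqrt k * (derive1 x t) 0 i.
      by apply: Es; exact: nbhs_singleton nd.
    suff H : derive1 (Num.sqrt k *: (fun t => x t 0 i)) @ t -->
        derive1 (Num.sqrt k *: (fun t => x t 0 i)) t by exact: H.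
    rewrite [X in _ --> X]Et; apply: cvg_trans ci; apply: near_eq_cvg.
    by apply: filterS nd => s ds; rewrite (Es s ds).
  move=> t t01; have [d1 d2] := dxi t t01.
  rewrite (derive1_scale _ d1) d2 normrM (ger0_norm (ltW sk0)).
  apply: le_trans (spE t t01); apply: ler_wpM2l; [exact: ltW|exact: rV_coord_le_norm].
move: H; case: (integral _ _ _) => [r| |] H; last by have := H 0; rewrite leeNy_eq.
  rewrite lee_fin mulrC -ler_pdivlMr//; apply: rV_norm_le => [|i].
    by have := H 0; rewrite lee_fin => h; rewrite divr_ge0// ?(ltW sk0)//; apply: le_trans h; rewrite mulr_ge0.
  by rewrite ler_pdivlMr// mulrC; have := H i; rewrite lee_fin !mxE.
exact: leey.
Qed.

End qlength_lower.

(** * Balls on which time and cones control the chart *)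

Section good_balls.
Context (R : realType) (n : nat) (M : topologicalType).
Variable g : lorentzianManifold R n M.
Variable f : M -> R.
Hypothesis f_time : time_function g f.
Implicit Types (c : chart R n M) (p q : M) (sigma : R -> M) (U : set M).
Local Notation vec := 'rV[R]_n.+1.

Lemma near_closed_ball (y : vec) (P : vec -> Prop) : (\forall z \near y, P z) ->
  exists2 r, 0 < r & forall z, `|z - y| <= r -> P z.
Proof.
move=> /nbhs_ballP[r /= r0 H]; exists (r / 2); first by rewrite divr_gt0.
move=> z zr; apply: H; rewrite -ball_normE /= distrC; apply: le_lt_trans zr _.
by rewrite ltr_pdivrMr// ltr_pMr// ltr1n.
Qed.

(** [C] is the inverse square root of a lower bound [k] for the Riemannian metric of the
    anti-Lipschitz condition: displacement in the chart is at most [C] times Riemannian length,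
    hence at most [C] times the increase of [f]. The trap is needed because the convex set of the
    geodesic is unrelated to the chart ball. *)
Lemma geodesic_estimate p0 : locally_anti_lipschitz g f ->
  let c := chart_at g p0 in
  exists C rho, [/\ 0 < C, 0 < rho, forall z, `|z - c p0| <= rho -> (c @` cdom c) z
    & forall U sigma r, r <= rho -> future_geodesic g U sigma -> cdom c (sigma 0) ->
      `|c (sigma 0) - c p0| < r / 2 -> C * (f (sigma 1) - f (sigma 0)) < r / 2 ->
      forall t, 0 <= t <= 1 -> chart_ball c (c p0) r (sigma t) /\
        `|c (sigma t) - c (sigma 0)| <= C * (f (sigma t) - f (sigma 0))].
Proof.
move=> al c; have ac : atlas g c := chart_at_atlas g _.
have cp : cdom c p0 := chart_at_dom g _.
have [U [oU Up [h rh HU]]] := al p0.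
have [k k0 Hk] := riemannian_lower rh ac cp Up.
have nU : \forall y \near c p0, U (cinv c y).
  exact: (cinv_continuous_at cp (open_nbhs_nbhs (conj oU Up))).
have [rho rho0 Hr] := near_closed_ball (filterI (near_cimg cp) (filterI nU Hk)).
have sk0 : 0 < Num.sqrt k by rewrite sqrtr_gt0.
exists (Num.sqrt k)^-1, rho; split; [by rewrite invr_gt0|exact: rho0|by move=> z /Hr[]|].
move=> V sigma r rr fg cs0 s0r dfr.
have C0 : 0 < (Num.sqrt k)^-1 by rewrite invr_gt0.
have [cV geo fut] := fg.
have cont : {within `[0, 1], continuous sigma}.
  by have [] := future_geodesic_curve fg.
have mono s t : 0 <= s -> s <= t -> t <= 1 -> f (sigma s) <= f (sigma t).
  move=> s0; rewrite le_eqVlt => /predU1P[-> //|st] t1.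
  exact: ltW (future_geodesic_time f_time fg s0 st t1).
have C0' := ltW C0.
pose F t := (Num.sqrt k)^-1 * f (sigma t).
have FE s t : F t - F s = (Num.sqrt k)^-1 * (f (sigma t) - f (sigma s)) by rewrite mulrBr.
have im z : `|z - c p0| <= r -> (c @` cdom c) z by move=> zr; have [] := Hr z (le_trans zr rr).
have monoF s t : 0 <= s -> s <= t -> t <= 1 -> F s <= F t.
  by move=> s0 st t1; apply: ler_wpM2l => //; exact: mono.
have st0 : `|c (sigma 0) - c p0| + (F 1 - F 0) < r by rewrite FE; lra.
move=> t t01; rewrite -FE.
apply: (curve_trap (smooth_of g) ler01 im cont monoF cs0 st0 _ t01) => {t t01} t t0 t1 pre.
(* Anti-Lipschitz bounds are stated on [[0, 1]], so the initial segment up to [t] is rescaled. *)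
have t1' : 0 + t <= 1 by rewrite add0r.
have fg' := future_geodesic_affine fg (lexx 0) t0 t1'.
set sg := fun s => sigma (0 + t * s) in fg'.
have in0t s : 0 <= s <= 1 -> 0 <= 0 + t * s <= t.
  by move=> /andP[s0 s1]; rewrite add0r mulr_ge0 ?(ltW t0)// ler_piMr// ltW.
have Bs s : 0 <= s <= 1 -> chart_ball c (c p0) r (sg s) by move=> /in0t /pre.
have inr q : chart_ball c (c p0) r q -> U q /\ (forall v : vec, k * `|v| ^+ 2 <= bform (h c q) v v).
  move=> [cq qr]; have [_ [+ +]] := Hr (c q) (le_trans (ltW qr) rr).
  by rewrite (cmapK cq).
have al1 := HU sg (future_geodesic_curve fg') (fun s s01 => (inr _ (Bs s s01)).1).
have low : ((Num.sqrt k * `|c (sg 1) - c (sg 0)|)%:E <= qlength g h sg 0 1)%E.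
  apply: (qlength_lower k0 ac) => s s01.
    split; last by have [] := Bs s s01.
    exact: future_geodesic_smooth fg' s01.
  have [Us Hs] := inr _ (Bs s s01); split; last exact: Hs.
  by have [st _] := rh; exact: (covariant_sym_tensor st Us).
have := le_trans low al1; rewrite lee_fin /sg mulr0 mulr1 !add0r FE => H.
by rewrite mulrC ler_pdivlMr// mulrC.
Qed.

(* [P] is a frame adapted to [g] at [p0]; on the ball of radius [r] the cones of
   [g] are compared with the constant ones. *)
Definition good_ball p0 (P : 'M[R]_n.+1) (C e r : R) : Prop :=
  let c := chart_at g p0 in
  [/\ forall z, `|z - c p0| <= r -> (c @` cdom c) z,
      forall q v, chart_ball c (c p0) r q ->
        - bform (metric g c q) v v <= lb (1 + e) (1 - e) (v *m P) (v *m P) /\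
        lb (1 - e) (1 + e) (v *m P) (v *m P) <= - bform (metric g c q) v v
    & forall p q, geodesic_before g p q -> chart_ball c (c p0) (r / 2) p ->
        C * (f q - f p) < r / 2 ->
        [/\ chart_ball c (c p0) r q, `|c q - c p| <= C * (f q - f p)
          & lcone (1 + e) (1 - e) ((c q - c p) *m P)]].

Lemma future_geodesic_in U sigma t c : future_geodesic g U sigma -> 0 <= t <= 1 ->
  atlas g c -> cdom c (sigma t) -> derivable (c \o sigma : R -> vec) t 1 /\
  future_in g c (sigma t) (derive1 (c \o sigma : R -> vec) t).
Proof.
move=> fg t01 ac ct; have sn := future_geodesic_smooth fg t01.
have dx := smooth_near_derivable sn ac ct; split; first exact: dx.
apply: (future_velocityP (smooth_near_continuous sn) ac ct dx).1.
by have [_ _ fut] := fg; exact: (fut t t01).2.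
Qed.

(** The frame and the constant [C] are fixed before [e], and only the radius depends on it: later
    errors are [e] times a quantity built from [P] and [C], and have to become small. *)
Lemma good_ball_exists p0 : locally_anti_lipschitz g f ->
  exists P C, [/\ P \in unitmx, 0 < C & forall e, 0 < e -> e < 1 ->
    exists2 r, 0 < r & good_ball p0 P C e r].
Proof.
move=> al; set c := chart_at g p0.
have ac : atlas g c := chart_at_atlas g _.
have cp : cdom c p0 := chart_at_dom g _.
have [P uP HP] := metric_frame ac cp.
have [C [rho [C0 rho0 im Hgeo]]] := geodesic_estimate p0 al.
rewrite -/c in im Hgeo.
exists P, C; split=> // e e0 e1.
have [r1 r10 Hr] := near_closed_ball (HP e e0 e1).
exists (Num.min rho r1); first by rewrite lt_min rho0.
set r := Num.min rho r1.
have rr : r <= rho by rewrite ge_min lexx.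
have rr1 : r <= r1 by rewrite ge_min lexx orbT.
have frame q v : chart_ball c (c p0) r q ->
  [/\ - bform (metric g c q) v v <= lb (1 + e) (1 - e) (v *m P) (v *m P),
      lb (1 - e) (1 + e) (v *m P) (v *m P) <= - bform (metric g c q) v v
    & future_in g c q v -> lcone (1 + e) (1 - e) (v *m P)].
  by move=> [cq qr]; have := Hr (c q) (le_trans (ltW qr) rr1) v; rewrite (cmapK cq).
split.
- by move=> z zr; apply: im; exact: le_trans zr rr.
- by move=> q v /(frame q v)[].
move=> p q [U [sigma [fg s0 s1]]] [cps pr] dfr.
rewrite -s0 -s1 -/c in cps pr dfr *.
have H := Hgeo U sigma r rr fg cps pr dfr.
have [B1 E1] := H 1 (introT andP (conj ler01 (lexx 1))).
split; [exact: B1|exact: E1|].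
apply: (@lcone_increment _ _ _ _ _ (c \o sigma : R -> vec) 0 1); [lra|lra|exact: ltr01|].
move=> t t01; have [Bt _] := H t t01; have [ct _] := Bt.
have [dx fi] := future_geodesic_in fg t01 ac ct; split; first exact: dx.
by have [_ _] := frame _ (derive1 (c \o sigma : R -> vec) t) Bt; apply.
Qed.

End good_balls.

(** * Causal chains and the null distance *)

Section chains.
Context (R : realType) (n : nat) (M : topologicalType).
Variable g : lorentzianManifold R n M.
Variable f : M -> R.
Hypothesis f_time : time_function g f.
Implicit Types (c : chart R n M) (p q : M) (sigma : R -> M) (U : set M) (b : bool).
Local Notation vec := 'rV[R]_n.+1.

(* [b = true] stands for past directed. *)
Definition before b p q : Prop :=
  if b then geodesic_before g q p else geodesic_before g p q.

(** Weaker than a directed curve: each pair of nearby points may use its own convex set. The notion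
    survives restriction, reversal and change of parameter. *)
Definition chain b (I : set R) sigma : Prop := {within I, continuous sigma} /\
  forall t, I t -> exists2 d, 0 < d & forall s s', I s -> I s' -> `|s - t| < d ->
    `|s' - t| < d -> s < s' -> before b (sigma s) (sigma s').

(** The time function with the sign that makes it increase along chains of orientation [b]. *)
Definition height b (p : M) : R := (-1) ^+ b * f p.

Lemma geodesic_before_time p q : geodesic_before g p q -> f p < f q.
Proof.
move=> [U [sigma [fg <- <-]]].
exact: (future_geodesic_time f_time fg (lexx 0) ltr01 (lexx 1)).
Qed.

Lemma before_height b p q : before b p q -> height b p < height b q.
Proof.
by case: b => /geodesic_before_time; rewrite /height ?expr0 ?expr1 ?mulN1r ?mul1r ?ltrN2.
Qed.

Lemma height_norm b p q : `|height b p - height b q| = `|f p - f q|.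
Proof. by rewrite -mulrBr normrM normrX normrN1 expr1n mul1r. Qed.

Lemma directed_curve_near C (I : set R) sigma t : directed_curve g C I sigma -> I t ->
  exists U d, [/\ convex_normal g U, 0 < d & forall s s', I s -> I s' ->
    `|s - t| < d -> `|s' - t| < d -> s < s' -> directed_geodesic g C U (sigma s) (sigma s')].
Proof.
move=> [_ dc] It; have [N [U [nN cU _ _ HN]]] := dc t It.
have [d /= d0 Hd] := nN; exists U, d; split; [exact: cU|exact: d0|].
move=> s s' Is Is' sd s'd ss'.
have Ns r : `|r - t| < d -> N r by move=> rd; apply: Hd; rewrite /ball/= distrC.
exact: (HN s s' (Ns _ sd) Is (Ns _ s'd) Is' ss').2.
Qed.

Lemma past_curve_chain (I : set R) sigma : past_curve g I sigma -> chain true I sigma.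
Proof.
move=> pc; split; first by have [] := pc.
move=> t It; have [U [d [cU d0 Hd]]] := directed_curve_near pc It.
exists d; first exact: d0.
by move=> s s' Is Is' sd s'd ss'; apply: past_directed_before cU (Hd s s' Is Is' sd s'd ss').
Qed.

Lemma future_curve_chain (I : set R) sigma : future_curve g I sigma -> chain false I sigma.
Proof.
move=> fc; split; first by have [] := fc.
move=> t It; have [U [d [cU d0 Hd]]] := directed_curve_near fc It.
exists d; first exact: d0.
by move=> s s' Is Is' sd s'd ss'; apply: future_directed_before cU (Hd s s' Is Is' sd s'd ss').
Qed.

Lemma chain_sub b (I J : set R) sigma : J `<=` I -> chain b I sigma -> chain b J sigma.
Proof.
move=> JI [sc ch]; split; first exact: continuous_subspaceW sc.
move=> t Jt; have [d d0 Hd] := ch t (JI t Jt); exists d; first exact: d0.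
by move=> s s' Js Js'; apply: Hd; exact: JI.
Qed.

Lemma chain_rev b u v sigma : chain b `[u, v] sigma ->
  chain (~~ b) `[- v, - u] (fun t => sigma (- t)).
Proof.
have inN t : `[- v, - u]%classic t -> `[u, v]%classic (- t).
  by rewrite /= !in_itv/= => /andP[h1 h2]; apply/andP; split; lra.
have dN (s t : R) : `|- s - - t| = `|s - t| by rewrite -opprD normrN.
move=> [/within_continuousP sc ch]; split.
  apply/within_continuousP => t W It nW; have [d d0 Hd] := sc (- t) W (inN t It) nW.
  exists d; first exact: d0.
  by move=> s Is sd; apply: Hd; [exact: inN|rewrite dN].
move=> t It; have [d d0 Hd] := ch (- t) (inN t It); exists d; first exact: d0.
move=> s s' Is Is' sd s'd ss'.
have := Hd (- s') (- s) (inN _ Is') (inN _ Is); rewrite !dN ltrN2 => /(_ s'd sd ss').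
by case: (b).
Qed.

Lemma chain_time b u v sigma : u < v -> chain b `[u, v] sigma ->
  height b (sigma u) < height b (sigma v).
Proof.
move=> uv [_ ch].
apply: (interval_patch (Q := fun s t => height b (sigma s) < height b (sigma t)) uv).
  by move=> s w t _ _ _ _; exact: lt_trans.
move=> t ut tv; have tI : `[u, v]%classic t by rewrite /= in_itv/= ut.
have [d d0 Hd] := ch t tI; exists d; first exact: d0.
move=> s s' us ss' s'v sd s'd; apply: before_height; apply: Hd.
- by rewrite /= in_itv/= us (le_trans (ltW ss') s'v).
- by rewrite /= in_itv/= s'v (le_trans us (ltW ss')).
- by rewrite ltr_norml; apply/andP; split; lra.
- by rewrite ltr_norml; apply/andP; split; lra.
- exact: ss'.
Qed.

Lemma lconeD (A B : R) (z z' : vec) : 0 < A -> 0 < B -> lcone A B z -> lcone A B z' ->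
  lcone A B (z + z').
Proof.
move=> A0 B0 cz cz'; have h := lb_ge0 A0 B0 cz cz'; have h' := lb_ge0 A0 B0 cz' cz.
move: cz cz' => [z0 hz] [z0' hz']; split; first by rewrite mxE addr_ge0.
by rewrite lbDl !lbDr; apply: addr_ge0; apply: addr_ge0.
Qed.

Section in_good_ball.
Variables (p0 : M) (P : 'M[R]_n.+1) (C e r : R).
Hypotheses (C0 : 0 < C) (e0 : 0 < e) (e1 : e < 1) (r0 : 0 < r).
Hypothesis gb : good_ball g f p0 P C e r.
Local Notation c := (chart_at g p0).
Local Notation y0 := (chart_at g p0 p0).

Let pe : 0 < 1 + e. Proof. by rewrite addr_gt0. Qed.
Let me : 0 < 1 - e. Proof. by rewrite subr_gt0. Qed.

(** Both conclusions add up along consecutive intervals, by the triangle inequality and the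
    convexity of the cone, so the estimates of the good ball for nearby points patch together. *)
Lemma chain_local b u v sigma : u < v -> chain b `[u, v] sigma ->
  (forall t, u <= t <= v -> chart_ball c y0 (r / 2) (sigma t)) ->
  `|c (sigma v) - c (sigma u)| <= C * (height b (sigma v) - height b (sigma u)) /\
  lcone (1 + e) (1 - e) (((-1) ^+ b *: (c (sigma v) - c (sigma u))) *m P).
Proof.
have r_gt0 := r0; move=> uv [/within_continuousP sc ch] inB; have [_ _ gb3] := gb.
pose Q s t := `|c (sigma t) - c (sigma s)| <= C * (height b (sigma t) - height b (sigma s)) /\
  lcone (1 + e) (1 - e) (((-1) ^+ b *: (c (sigma t) - c (sigma s))) *m P).
apply: (interval_patch (Q := Q) uv).
  move=> s w t _ _ _ _ [n1 c1] [n2 c2]; split.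
    have -> : c (sigma t) - c (sigma s) = (c (sigma w) - c (sigma s)) + (c (sigma t) - c (sigma w)).
      by apply/rowP => i; rewrite !mxE; ring.
    by apply: le_trans (ler_normD _ _) _; apply: le_trans (lerD n1 n2) _; lra.
  have -> : c (sigma t) - c (sigma s) = (c (sigma w) - c (sigma s)) + (c (sigma t) - c (sigma w)).
    by apply/rowP => i; rewrite !mxE; ring.
  by rewrite scalerDr mulmxDl; exact: (lconeD pe me c1 c2).
move=> t ut tv; have tI : `[u, v]%classic t by rewrite /= in_itv/= ut.
have [d1 d10 H1] := ch t tI.
(* The good ball asks for a small time difference, which continuity of [f] provides for nearby
   parameters. *)
have fc : {for sigma t, continuous f} by have [fc _] := f_time; exact: fc.
have eta0 : 0 < r / 4 / C by rewrite !divr_gt0.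
have nf : nbhs (sigma t) [set q | `|f (sigma t) - f q| < r / 4 / C].
  by have /cvgrPdist_lt := fc; apply.
have [d2 d20 H2] := sc t _ tI nf.
exists (Num.min d1 d2); first by rewrite lt_min d10.
move=> s s' us ss' s'v sd s'd.
have sI : `[u, v]%classic s by rewrite /= in_itv/= us (le_trans (ltW ss') s'v).
have s'I : `[u, v]%classic s' by rewrite /= in_itv/= s'v (le_trans us (ltW ss')).
have near1 : `|s - t| < Num.min d1 d2 by rewrite ltr_norml; apply/andP; split; lra.
have near2 : `|s' - t| < Num.min d1 d2 by rewrite ltr_norml; apply/andP; split; lra.
move: near1 near2; rewrite !lt_min => /andP[n11 n12] /andP[n21 n22].
have fs : `|f (sigma t) - f (sigma s)| < r / 4 / C := H2 s sI n12.
have fs' : `|f (sigma t) - f (sigma s')| < r / 4 / C := H2 s' s'I n22.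
have df : C * `|f (sigma s') - f (sigma s)| < r / 2.
  rewrite mulrC -ltr_pdivlMr//.
  have := ler_normB (f (sigma t) - f (sigma s)) (f (sigma t) - f (sigma s')).
  rewrite (_ : f (sigma t) - f (sigma s) - (f (sigma t) - f (sigma s')) = f (sigma s') - f (sigma s)); last by ring.
  move=> h; apply: le_lt_trans h _; apply: lt_le_trans (ltrD fs fs') _.
  by rewrite -mulrDl; apply: ler_wpM2r; [rewrite invr_ge0 ltW|lra].
have bf := H1 s s' sI s'I n11 n21 ss'.
have Bs : chart_ball c y0 (r / 2) (sigma s) by apply: inB; move: sI; rewrite /= in_itv.
have Bs' : chart_ball c y0 (r / 2) (sigma s') by apply: inB; move: s'I; rewrite /= in_itv.
rewrite /Q /height; case: (b) bf => bf.
  have df' : C * (f (sigma s) - f (sigma s')) < r / 2.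
    apply: le_lt_trans df; rewrite ler_pM2l// distrC; exact: ler_norm.
  have [_ h1 h2] := gb3 _ _ bf Bs' df'.
  rewrite expr1 !mulN1r scaleN1r !opprB distrC; split; last exact: h2.
  by apply: le_trans h1 _; rewrite ler_pM2l//; lra.
have df' : C * (f (sigma s') - f (sigma s)) < r / 2.
  by apply: le_lt_trans df; rewrite ler_pM2l//; exact: ler_norm.
have [_ h1 h2] := gb3 _ _ bf Bs df'.
by rewrite expr0 !mul1r scale1r.
Qed.

(** The local estimate feeds the trap with [C] times the height as budget: starting within [r / 4]
    and spending less than [r / 4], the chain stays within [r / 2]. *)
Lemma chain_trap b u v sigma : u <= v -> chain b `[u, v] sigma ->
  chart_ball c y0 (r / 4) (sigma u) -> C * `|f (sigma v) - f (sigma u)| < r / 4 ->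
  forall t, u <= t <= v -> chart_ball c y0 (r / 2) (sigma t) /\
    `|c (sigma t) - c (sigma u)| <= C * `|f (sigma t) - f (sigma u)|.
Proof.
have r_gt0 := r0; move=> uv ch [cu ur] df.
have mono s t : u <= s -> s <= t -> t <= v -> height b (sigma s) <= height b (sigma t).
  move=> us; rewrite le_eqVlt => /predU1P[->//|st] tv; apply/ltW/(chain_time st).
  apply: chain_sub ch => z /=; rewrite !in_itv/= => /andP[z1 z2].
  by rewrite (le_trans us z1) (le_trans z2 tv).
pose F t := C * height b (sigma t).
have FE s t : u <= s -> s <= t -> t <= v -> F t - F s = C * `|f (sigma t) - f (sigma s)|.
  move=> us st tv; rewrite -mulrBr -(height_norm b) ger0_norm// subr_ge0; exact: mono.
have monoF s t : u <= s -> s <= t -> t <= v -> F s <= F t.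
  by move=> us st tv; rewrite ler_pM2l//; exact: mono.
have [im _ _] := gb.
have im' z : `|z - y0| <= r / 2 -> (c @` cdom c) z.
  by move=> zr; apply: im; apply: le_trans zr _; lra.
have ur' : `|c (sigma u) - y0| + (F v - F u) < r / 2 by rewrite FE//; lra.
move=> t /andP[ut tv]; have := @curve_trap _ _ _ (smooth_of g) c y0 (r / 2) sigma F u v uv im' ch.1 monoF cu ur'.
move=> H; have [] := H _ t (introT andP (conj ut tv)); last by move=> h1 h2; rewrite -FE.
move=> s us sv pre; rewrite FE ?(ltW us)//.
have ch' : chain b `[u, s] sigma.
  apply: chain_sub ch => z /=; rewrite !in_itv/= => /andP[z1 z2].
  by rewrite z1 (le_trans z2 sv).
have [h _] := chain_local us ch' pre.
apply: le_trans h _; rewrite ler_pM2l//; apply: le_trans (ler_norm _) _.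
by rewrite height_norm.
Qed.

Lemma alternating_near beta k tau i : (i < k)%N -> Defs.alternating g beta k tau ->
  exists b, chain b `[tau i, tau i.+1] beta.
Proof.
have r_gt0 := r0; move=> ik [_ /(_ i ik)[_ _ [fc|pc]]]; first by exists false; exact: future_curve_chain.
by exists true; exact: past_curve_chain.
Qed.

(** An alternating curve of null length below [d] is followed backwards from [q], each piece being
    trapped in turn. The budget [r / 8] keeps the start of every piece within [r / 4], as the trap
    requires. *)
Lemma null_distance_near p q (d : R) : chart_ball c y0 (r / 8) q -> C * d <= r / 8 ->
  (null_distance g f p q < d%:E)%E ->
  chart_ball c y0 (r / 4) p /\ `|c p - c q| <= C * d.
Proof.
have r_gt0 := r0; move=> [cq qr] dr /ereal_inf_lt[_ [beta [k [tau [alt bp bq ->]]]]].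
rewrite lte_fin => Ld.
pose df i := `|f (beta (tau i.+1)) - f (beta (tau i))|.
have df0 i : 0 <= df i := normr_ge0 _.
have tail m : (\sum_(k - m <= i < k) df i <= null_length f beta k tau).
  rewrite /null_length -(big_mkord xpredT df) (@big_cat_nat _ _ _ (k - m)%N 0 k)//=; last exact: leq_subr.
  by rewrite lerDr sumr_ge0.
(* [m] counts the pieces from the end at [q]. *)
have claim m : (m <= k)%N -> cdom c (beta (tau (k - m)%N)) /\
    `|c (beta (tau (k - m)%N)) - c q| <= C * \sum_(k - m <= i < k) df i.
  elim: m => [_|m IH mk].
    by rewrite subn0 big_geq// mulr0 bq subrr normr0.
  have [cm Hm] := IH (ltnW mk).
  set i := (k - m.+1)%N.
  have iE : (k - m)%N = i.+1 by rewrite /i subnSK.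
  have ik : (i < k)%N by rewrite -iE leq_subr.
  have [b ch] := alternating_near ik alt.
  have [_ /(_ i ik)[tlt _ _]] := alt.
  have sumE : \sum_(i <= j < k) df j = df i + \sum_(i.+1 <= j < k) df j by rewrite big_ltn.
  have tl := tail m.+1; rewrite -/i sumE in tl; rewrite iE in cm Hm.
  have S0 : 0 <= \sum_(i.+1 <= j < k) df j by apply: sumr_ge0.
  have CL x : x <= null_length f beta k tau -> C * x < r / 8.
    by move=> xl; apply: lt_le_trans dr; rewrite ltr_pM2l//; exact: le_lt_trans xl Ld.
  (* The piece is traversed in reverse, with negated parameter; this accounts for the double
     negations. *)
  have start : chart_ball c y0 (r / 4) (beta (- - tau i.+1)).
    rewrite opprK; split; first exact: cm.
    rewrite -(subrK (c q) (c (beta (tau i.+1)))) -addrA.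
    apply: le_lt_trans (ler_normD _ _) _.
    have h : C * \sum_(i.+1 <= j < k) df j < r / 8 by apply: CL; apply: le_trans tl; rewrite lerDr.
    by have := le_lt_trans Hm h; lra.
  have dfi : C * `|f (beta (- - tau i)) - f (beta (- - tau i.+1))| < r / 4.
    rewrite !opprK distrC; have : C * df i < r / 8 by apply: CL; apply: le_trans tl; rewrite lerDl.
    by rewrite /df; lra.
  have uv : - tau i.+1 <= - tau i by rewrite lerN2 ltW.
  have [[ci _]] := chain_trap uv (chain_rev ch) start dfi (introT andP (conj uv (lexx (- tau i)))).
  rewrite !opprK => Hi; rewrite opprK in ci; split; first exact: ci.
  rewrite sumE mulrDr -(subrK (c (beta (tau i.+1))) (c (beta (tau i)))) -addrA.
  apply: le_trans (ler_normD _ _) _; apply: lerD Hm.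
  by apply: le_trans Hi _; rewrite distrC.
have [cp Hp] := claim k (leqnn k); rewrite subnn bp in cp Hp.
have Hpd : `|c p - c q| <= C * d.
  apply: le_trans Hp _; rewrite ler_pM2l//; apply: le_trans (ltW Ld).
  by have := tail k; rewrite subnn.
split; last exact: Hpd; split; first exact: cp.
rewrite -(subrK (c q) (c p)) -addrA; apply: le_lt_trans (ler_normD _ _) _; lra.
Qed.

End in_good_ball.
End chains.

(** * Local description of the limit curve *)

Section within_continuity.
Context (R : realType).

Lemma within_interior (T : topologicalType) (h : R -> T) (u v t : R) :
  {within `[u, v], continuous h} -> u < t -> t < v -> {for t, continuous h}.
Proof.
move=> /within_continuousP hc ut tv W nW.
have tI : `[u, v]%classic t by rewrite /= in_itv/= !ltW.
have [d d0 Hd] := hc t W tI nW.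
exists (Num.min d (Num.min (t - u) (v - t))) => /=; first by rewrite !lt_min d0 !subr_gt0 ut.
move=> s; rewrite /ball/= !lt_min => /and3P[s1 s2 s3]; apply: Hd; last by rewrite distrC.
by move: s2 s3; rewrite !ltr_norml /= in_itv/= => /andP[? ?] /andP[? ?]; apply/andP; split; lra.
Qed.

Lemma within_comp (T : topologicalType) (h : R -> T) (phi : R -> R) (I J : set R) :
  {within I, continuous h} -> {within J, continuous phi} ->
  (forall t, J t -> I (phi t)) -> {within J, continuous (h \o phi)}.
Proof.
move=> /within_continuousP hc /within_continuousP pc JI; apply/within_continuousP.
move=> t W Jt nW; have [d d0 Hd] := hc (phi t) W (JI t Jt) nW.
have [d' d'0 Hd'] := pc t (ball (phi t) d) Jt (nbhsx_ballx _ _ d0).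
exists d' => // s Js sd; apply: Hd; first exact: JI.
by rewrite distrC; exact: Hd'.
Qed.

Lemma mulmx_cvg (n : nat) (T : Type) (F : set_system T) {FF : Filter F}
    (x : T -> 'rV[R]_n.+1) (a : 'rV[R]_n.+1) (P : 'M[R]_n.+1) i : x @ F --> a ->
  (fun k => (x k *m P) 0 i) @ F --> (a *m P) 0 i.
Proof.
move=> xa; rewrite [X in _ --> X]mxE; under eq_fun do rewrite mxE.
apply: cvg_sum_seq => j; apply: cvgM; last exact: cvg_cst.
exact: (cvg_comp _ _ xa (@coord_continuous _ _ _ 0 j _)).
Qed.

End within_continuity.

Section local_limits.
Context (R : realType) (n : nat) (M : topologicalType).
Variable g : lorentzianManifold R n M.
Variable f : M -> R.
Hypotheses (f_time : time_function g f) (f_al : locally_anti_lipschitz g f).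
Implicit Types (c : chart R n M) (p q : M) (U : set M).
Local Notation vec := 'rV[R]_n.+1.

(** Modelled on past directed curves parametrised by [-f]: the earlier point minus the later one
    lies in the future cone, and the displacement is bounded by elapsed time. *)
Definition cone_curve p0 (P : 'M[R]_n.+1) (C e r : R) (I : set R) (beta : R -> M) : Prop :=
  let c := chart_at g p0 in
  (forall t, I t -> chart_ball c (c p0) r (beta t)) /\
  forall s t, I s -> I t -> s < t ->
    `|c (beta s) - c (beta t)| <= C * (t - s) /\
    lcone (1 + e) (1 - e) ((c (beta s) - c (beta t)) *m P).

(** [P] and [C] precede [e], which precedes the radius and the time scale. Pointwise convergence in
    the chart suffices for semicontinuity, given cone and Lipschitz bounds that are uniform in
    [k]. *)
Definition local_limit (T : R) (B : nat -> R -> M) (G : R -> M) : Prop :=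
  forall t0, 0 <= t0 <= T -> let c := chart_at g (G t0) in
  exists P C, [/\ P \in unitmx, 0 < C & forall e, 0 < e -> e < 1 ->
    exists r d, let I := [set t | 0 <= t <= T /\ `|t - t0| < d] in
    [/\ 0 < r, 0 < d & good_ball g f (G t0) P C e r] /\
    [/\ cone_curve (G t0) P C e r I G,
        \forall k \near \oo, cone_curve (G t0) P C e r I (B k)
      & forall t, I t -> (fun k => c (B k t)) @ \oo --> c (G t)]].

(** Lets estimates for the sequence be read as estimates for the limit curve alone. *)
Lemma local_limit_cst T B G : local_limit T B G -> local_limit T (fun=> G) G.
Proof.
move=> H t0 t0T; have [P [C [uP C0 He]]] := H t0 t0T.
exists P, C; split; [exact: uP|exact: C0|] => e e0 e1.
have [r [d [h1 [h2 _ _]]]] := He e e0 e1; exists r, d; split; first exact: h1.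
split; [exact: h2|exact: nearW|].
by move=> t _; exact: cvg_cst.
Qed.

(** Smallness of the null distance gives convergence in the chart. It also places [B k u] near
    [G u], where the trap takes over on [[u, v]], and the remaining conditions on a cone curve are
    closed and pass to [G]. *)
Lemma local_limit_of_chains T B G :
  (\forall k \near \oo, chain g true `[0, T] (B k) /\
     forall s t, 0 <= s <= T -> 0 <= t <= T -> f (B k s) - f (B k t) = t - s) ->
  (forall eps : R, 0 < eps -> \forall k \near \oo, forall t, 0 <= t <= T ->
     (null_distance g f (B k t) (G t) < eps%:E)%E) ->
  {within `[0, T], continuous G} -> local_limit T B G.
Proof.
move=> HB Hd /within_continuousP Gc t0 t0T c.
have [P [C [uP C0 He]]] := good_ball_exists f_time (G t0) f_al.
exists P, C; split; [exact: uP|exact: C0|] => e e0 e1.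
have [r r0 gb] := He e e0 e1.
have cp : cdom c (G t0) := chart_at_dom g _.
have r80 : 0 < r / 8 by rewrite divr_gt0.
have nB : nbhs (G t0) (chart_ball c (c (G t0)) (r / 8)).
  by apply: near_chart_ball; split; [exact: cp|rewrite subrr normr0].
have t0I : `[0, T]%classic t0 by rewrite /= in_itv.
have [d1 d10 Hd1] := Gc t0 _ t0I nB.
(* [d1 / 2] keeps [G] within [r / 8]; the second bound makes the elapsed time, at most [2 * d], cost
   at most [r / 8], less than the trap allows. *)
set d := Num.min (d1 / 2) (r / 16 / C).
have d0 : 0 < d by rewrite lt_min !divr_gt0.
have dd1 : d < d1.
  by apply: (@le_lt_trans _ _ (d1 / 2)); [rewrite ge_min lexx|lra].
have dC : C * d <= r / 16 by rewrite mulrC -ler_pdivlMr// ge_min lexx orbT.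
pose u := Num.max 0 (t0 - d); pose v := Num.min T (t0 + d).
have /andP[t00 t0T'] := t0T.
have u0 : 0 <= u by rewrite le_max lexx.
have vT : v <= T by rewrite ge_min lexx.
have ut0 : u <= t0 by rewrite ge_max t00/= lerBlDr lerDl ltW.
have t0v : t0 <= v by rewrite le_min t0T'/= lerDl ltW.
have uv : u <= v by exact: le_trans t0v.
have uT : 0 <= u <= T by rewrite u0 (le_trans uv).
have vT' : 0 <= v <= T by rewrite vT (le_trans u0).
have udist : t0 - d <= u by rewrite le_max lexx orbT.
have vdist : v <= t0 + d by rewrite ge_min lexx orbT.
have Iuv t : 0 <= t <= T -> `|t - t0| < d -> u <= t <= v.
  move=> /andP[t1 t2]; rewrite ltr_norml => /andP[t3 t4].
  rewrite ge_max t1/= le_min t2/=; apply/andP; split; lra.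
have Gr t : u <= t <= v -> chart_ball c (c (G t0)) (r / 8) (G t).
  move=> /andP[t1 t2]; apply: Hd1.
    by rewrite /= in_itv/= (le_trans u0 t1) (le_trans t2 vT).
  by apply: le_lt_trans dd1; rewrite ler_norml; apply/andP; split; lra.
have uvT t : u <= t <= v -> 0 <= t <= T.
  by move=> /andP[t1 t2]; rewrite (le_trans u0 t1) (le_trans t2 vT).
have cvg t : u <= t <= v -> (fun k => c (B k t)) @ \oo --> c (G t).
  move=> tuv; apply/cvgrPdist_le => eps eps0.
  pose eta := Num.min (eps / C) (r / 8 / C).
  have eta0 : 0 < eta by rewrite lt_min !divr_gt0.
  have h1 : C * eta <= r / 8 by rewrite mulrC -ler_pdivlMr// ge_min lexx orbT.
  have h2 : C * eta <= eps by rewrite mulrC -ler_pdivlMr// ge_min lexx.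
  apply: filterS (Hd eta eta0) => k /(_ t (uvT t tuv)) nd.
  have [_ h] := null_distance_near f_time C0 e0 e1 r0 gb (Gr t tuv) h1 nd.
  by rewrite distrC; exact: le_trans h h2.
have Beta0 : 0 < r / 8 / C by rewrite !divr_gt0.
have wcB : \forall k \near \oo,
    cone_curve (G t0) P C e r [set t | 0 <= t <= T /\ `|t - t0| < d] (B k) /\
    forall t, u <= t <= v -> chart_ball c (c (G t0)) (r / 2) (B k t).
  apply: filterS (filterI HB (Hd _ Beta0)) => k [[ch fB] nd].
  have h1 : C * (r / 8 / C) <= r / 8 by rewrite mulrC divfK ?gt_eqF.
  have [Bu _] := null_distance_near f_time C0 e0 e1 r0 gb (Gr u (introT andP (conj (lexx u) uv))) h1 (nd u uT).
  have chuv : chain g true `[u, v] (B k).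
    by apply: chain_sub ch => t /=; rewrite !in_itv/= => /uvT.
  have fuv : C * `|f (B k v) - f (B k u)| < r / 4.
    rewrite distrC fB// ger0_norm ?subr_ge0//.
    have : C * (v - u) <= C * (2 * d) by rewrite ler_pM2l//; lra.
    lra.
  have tr := chain_trap f_time C0 e0 e1 r0 gb uv chuv Bu fuv.
  have inr t : u <= t <= v -> chart_ball c (c (G t0)) (r / 2) (B k t) by move=> /tr[].
  split; last exact: inr.
  split=> [t [tT td]|s t [sT sd] [tT td] st].
    by have [h2 h3] := inr t (Iuv t tT td); split; [exact: h2|apply: lt_trans h3 _; lra].
  have /andP[us _] := Iuv s sT sd; have /andP[_ tv] := Iuv t tT td.
  have chst : chain g true `[s, t] (B k).
    by apply: chain_sub chuv => z /=; rewrite !in_itv/= => /andP[z1 z2]; rewrite (le_trans us z1) (le_trans z2 tv).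
  have inst z : s <= z <= t -> chart_ball c (c (G t0)) (r / 2) (B k z).
    by move=> /andP[z1 z2]; apply: inr; rewrite (le_trans us z1) (le_trans z2 tv).
  have [h2 h3] := chain_local f_time C0 e0 e1 r0 gb st chst inst; split.
    rewrite distrC; apply: le_trans h2 _; rewrite /height expr1 !mulN1r opprK addrC.
    by rewrite fB.
  by move: h3; rewrite expr1 scaleN1r opprB.
exists r, d; split; first by split; [exact: r0|exact: d0|exact: gb].
have wcB1 : \forall k \near \oo,
    cone_curve (G t0) P C e r [set t | 0 <= t <= T /\ `|t - t0| < d] (B k).
  by apply: filterS wcB => k [].
split; [|exact: wcB1|by move=> t [tT td]; apply: cvg; exact: Iuv].
split=> [t [tT td]|s t [sT sd] [tT td] st].
  have [h1 h2] := Gr t (Iuv t tT td); split; [exact: h1|apply: lt_trans h2 _; lra].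
have Is : [set t | 0 <= t <= T /\ `|t - t0| < d] s by [].
have It : [set t | 0 <= t <= T /\ `|t - t0| < d] t by [].
have cst : (fun k => c (B k s) - c (B k t)) @ \oo --> c (G s) - c (G t).
  by apply: cvgB; [exact: cvg s (Iuv s sT sd)|exact: cvg t (Iuv t tT td)].
have zi i : (fun k => ((c (B k s) - c (B k t)) *m P) 0 i) @ \oo --> ((c (G s) - c (G t)) *m P) 0 i.
  exact: mulmx_cvg.
have zl : (fun k => lb (1 + e) (1 - e) ((c (B k s) - c (B k t)) *m P) ((c (B k s) - c (B k t)) *m P)) @ \oo
    --> lb (1 + e) (1 - e) ((c (G s) - c (G t)) *m P) ((c (G s) - c (G t)) *m P).
  exact: lb_cvg.
split; last split.
- apply: (ler_cvg_to (cvg_norm cst) (cvg_cst (C * (t - s)))).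
  by apply: filterS wcB1 => k [_ /(_ s t Is It st)[]].
- have c0 : (fun _ : nat => 0 : R) @ \oo --> (0 : R) by exact: cvg_cst.
  apply: (ler_cvg_to c0 (zi 0)).
  by apply: filterS wcB1 => k [_ /(_ s t Is It st)[_ []]].
- have c0 : (fun _ : nat => 0 : R) @ \oo --> (0 : R) by exact: cvg_cst.
  apply: (ler_cvg_to c0 zl).
  by apply: filterS wcB1 => k [_ /(_ s t Is It st)[_ []]].
Qed.

Lemma cone_curve_continuous p0 P C e r (I : set R) beta : 0 < C ->
  (forall z, `|z - chart_at g p0 p0| <= r -> (chart_at g p0 @` cdom (chart_at g p0)) z) ->
  cone_curve p0 P C e r I beta -> {within I, continuous beta}.
Proof.
move=> C0 im [inB wc]; set c := chart_at g p0 in im inB wc.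
apply/within_continuousP => t W It nW; have [ct _] := inB t It.
have nc := cinv_continuous_at ct nW.
have [eta eta0 Heta] := near_closed_ball nc.
exists (eta / C); first by rewrite divr_gt0.
move=> s Is sd; have [cs _] := inB s Is; rewrite -(cmapK cs); apply: Heta.
have CS : C * `|s - t| <= eta by rewrite mulrC -ler_pdivlMr// ltW.
have [st|ts|->] := ltgtP s t.
- have [h _] := wc s t Is It st; apply: le_trans h _; apply: le_trans CS.
  by rewrite ltr0_norm ?subr_lt0// opprB.
- have [h _] := wc t s It Is ts; rewrite distrC; apply: le_trans h _; apply: le_trans CS.
  by rewrite gtr0_norm ?subr_gt0.
- by rewrite subrr normr0 ltW.
Qed.

Lemma cone_curve_sub p0 P C e r (I J : set R) beta : J `<=` I ->
  cone_curve p0 P C e r I beta -> cone_curve p0 P C e r J beta.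
Proof.
move=> JI [h1 h2]; split=> [t /JI|s t /JI Is /JI]; first exact: h1.
exact: h2.
Qed.

End local_limits.

(** * Upper bounds for lengths of cone curves *)

Section length_bound.
Context (R : realType) (n : nat) (M : topologicalType).
Variable g : lorentzianManifold R n M.
Variable f : M -> R.
Implicit Types (c : chart R n M) (p q : M) (beta sigma : R -> M).
Local Notation vec := 'rV[R]_n.+1.
Local Notation leb := (@lebesgue_measure R).
Local Notation mQ := (fun c p => - metric g c p).

(** If the pairing of the derivative with a cone vector had the wrong sign, so would the pairing of
    a short increment to the right. *)
Lemma cone_derivative (A B : R) (P : 'M[R]_n.+1) (x : R -> vec) t d : 0 < A -> 0 < B ->
  0 < d -> derivable x t 1 ->
  (forall s, t < s -> s < t + d -> lcone A B ((x t - x s) *m P)) ->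
  lcone A B ((- derive1 x t) *m P).
Proof.
move=> A0 B0 d0 dx H; apply: lcone_dual => // w cw.
rewrite -scaleN1r lb_mulmxZ mulN1r oppr_ge0.
have [dL EL] := lb_mulmx_derive1 A B w P dx.
rewrite -EL leNgt; apply/negP => L0.
have [d' d'0 Hd'] := derivable_increment dL (divr_gt0 L0 (ltr0n R 2)).
set s := t + Num.min d d' / 2.
have m0 : 0 < Num.min d d' by rewrite lt_min d0.
have ts : t < s by rewrite ltrDl divr_gt0.
have sm : s - t < Num.min d d' by rewrite /s addrC addKr ltr_pdivrMr// ltr_pMr// ltr1n.
have [sd sd'] : s - t < d /\ s - t < d' by move: sm; rewrite lt_min => /andP[].
have std : s < t + d by rewrite addrC -ltrBlDr.
have st0 : 0 < s - t by rewrite subr_gt0.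
have std' : `|s - t| < d' by rewrite gtr0_norm.
have := Hd' s std'; rewrite (gtr0_norm st0) ler_norml => /andP[+ _].
have := lb_ge0 A0 B0 cw (H s ts std); rewrite mulmxBl lbBr.
set L := derive1 _ t in L0 *; rewrite /GRing.scale/=.
have : 0 < (s - t) * L by rewrite mulr_gt0.
lra.
Qed.

(** The reverse triangle inequality in integrated form. The speed is at most the derivative of a
    linear functional, the majorant at [w], whose increase depends only on the endpoints; so the
    bound holds for every reparametrisation. The summand [d *: tvec] makes [w] timelike even when
    the increment is lightlike or zero. *)
Lemma cone_curve_length p0 (P : 'M[R]_n.+1) (C e r u v : R) beta (d : R) :
  0 < C -> 0 < e -> e < 1 -> good_ball g f p0 P C e r -> u <= v ->
  cone_curve g p0 P C e r `[u, v] beta -> 0 < d ->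
  forall w, w = (chart_at g p0 (beta u) - chart_at g p0 (beta v)) *m P + d *: tvec R n ->
  (lorentz_length g beta u v <= (Num.sqrt (lb (1 + e) (1 - e) w w))%:E)%E.
Proof.
move=> C0 e0 e1 gb uv wc d0 w; set c := chart_at g p0 => wE.
have ac : atlas g c := chart_at_atlas g _.
have A0 : 0 < 1 + e by rewrite addr_gt0.
have B0 : 0 < 1 - e by rewrite subr_gt0.
set D := (c (beta u) - c (beta v)) *m P in wE.
have [inB wcone] := wc; have [im frame _] := gb.
have cD : lcone (1 + e) (1 - e) D.
  have uI : `[u, v]%classic u by rewrite /= in_itv/= lexx.
  have vI : `[u, v]%classic v by rewrite /= in_itv/= lexx andbT.
  move: uv; rewrite le_eqVlt => /predU1P[E|lt]; last exact: (wcone u v uI vI lt).2.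
  rewrite /D E subrr mul0mx; split; first by rewrite mxE.
  by rewrite /lb mxE /ssum big1 ?mulr0 ?subr0// => i _; rewrite mxE mul0r.
have [cw w0] := lcone_Dtvec A0 d0 cD; rewrite -wE in cw w0.
set N := Num.sqrt (lb (1 + e) (1 - e) w w).
have N0 : 0 < N by rewrite sqrtr_gt0.
apply: ub_ereal_sup => _ [phi [u' [v' [[u'v' phu phv phc phm] lip ->]]]].
have phI t : `[u', v']%classic t -> `[u, v]%classic (phi t).
  rewrite /= !in_itv/= => /andP[t1 t2].
  have mono s s' : u' <= s -> s <= s' -> s' <= v' -> phi s <= phi s'.
    move=> us; rewrite le_eqVlt => /predU1P[->//|ss'] s'v; apply/ltW/phm => //.
      by rewrite in_itv/= us (le_trans (ltW ss')).
    by rewrite in_itv/= s'v (le_trans us (ltW ss')).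
  by rewrite -{1}phu -{1}phv !mono.
set sg := beta \o phi.
pose y := fun t => c (sg t).
pose h t := N^-1 * lb (1 + e) (1 - e) w ((- y t) *m P).
have hinc s t : u' <= s -> s <= t -> t <= v' -> h s <= h t.
  move=> us; rewrite le_eqVlt => /predU1P[->//|st] tv.
  rewrite /h ler_pM2l ?invr_gt0// -subr_ge0 -lbBr -mulmxBl.
  rewrite (_ : - y t - - y s = y s - y t); last by rewrite opprK addrC.
  have sI : `[u', v']%classic s by rewrite /= in_itv/= us (le_trans (ltW st)).
  have tI : `[u', v']%classic t by rewrite /= in_itv/= tv (le_trans us (ltW st)).
  apply: (lb_ge0 A0 B0 cw); apply: (wcone _ _ (phI s sI) (phI t tI) _).2.
  by apply: phm; [move: sI|move: tI|].
apply: (@le_trans _ _ (h v' - h u')%:E).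
  apply: ge0_integral_le_increment => //.
    by move=> t; exact: speed_ge0.
  apply: aeW => t /andP[ut tv].
  have tI : `[u', v']%classic t by rewrite /= in_itv/= !ltW.
  have sc : {for t, continuous sg}.
    apply: (within_interior _ ut tv).
    exact: within_comp (cone_curve_continuous C0 im wc) phc phI.
  have Bt := inB _ (phI t tI); have [ct _] := Bt.
  have cN : covariant_at g mQ (sg t) by exact: covariant_metricN.
  rewrite (speedE cN sc ac ct).
  have [dx|ndx] := pselect (derivable (c \o sg : R -> vec) t 1); last first.
    by left; exact: (if_asboolF _ _ ndx).
  right; set z := derive1 (c \o sg : R -> vec) t.
  have dny : derivable ((-1) *: (c \o sg : R -> vec)) t 1 by exact: derivableZ.
  have dyE : derive1 ((-1) *: (c \o sg : R -> vec)) t = - z.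
    by rewrite (derive1_scale _ dx) scaleN1r.
  have [dL EL] := lb_mulmx_derive1 (1 + e) (1 - e) w P dny.
  have hE : h = N^-1 *: (fun s => lb (1 + e) (1 - e) w (((-1) *: (c \o sg : R -> vec)) s *m P)).
    apply/funext => s; congr (_ * lb _ _ _ (_ *m _)).
    by rewrite -[LHS]scaleN1r.
  split; first by rewrite hE; exact: derivableZ.
  rewrite hE (derive1_scale _ dL) EL dyE.
  rewrite (if_asboolT _ _ dx) -/z.
  have cz : lcone (1 + e) (1 - e) ((- z) *m P).
    have vt : 0 < v' - t by rewrite subr_gt0.
    apply: (cone_derivative A0 B0 vt dx) => s ts; rewrite addrC subrK => sv.
    have sI : `[u', v']%classic s by rewrite /= in_itv/= !ltW// (lt_trans ut).
    apply: (wcone _ _ (phI t tI) (phI s sI) _).2.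
    by apply: phm; [move: tI|move: sI|].
  have [up _] := frame _ z Bt.
  have maj := lb_majorant A0 B0 cw w0 cz.
  rewrite [leRHS]mulrC; apply: le_trans maj; apply: ler_wsqrtr.
  by rewrite bformN mulNmx -!(scaleN1r (z *m P)) lbZl lbZr !mulN1r opprK.
rewrite lee_fin /h -mulrBr -lbBr -mulmxBl.
rewrite (_ : - y v' - - y u' = c (beta u) - c (beta v)); last first.
  by rewrite opprK addrC /y /sg /= phu phv.
rewrite -/D mulrC.
by rewrite /N wE; exact: lb_majorant_le.
Qed.

(** A reparametrisation passes through [w] by the intermediate value theorem and restricts to both
    sides. *)
Lemma qlength_split (Q : chart R n M -> M -> 'M[R]_n.+1) beta u w v : u <= w -> w <= v ->
  (qlength g Q beta u v <= qlength g Q beta u w + qlength g Q beta w v)%E.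
Proof.
move=> uw wv; apply: ub_ereal_sup => _ [phi [u' [v' [[u'v' phu phv phc phm] lip ->]]]].
have minmax : Num.min (phi u') (phi v') <= w <= Num.max (phi u') (phi v').
  by rewrite phu phv ge_min uw le_max wv orbT.
have [w' + phw] := IVT u'v' phc minmax; rewrite in_itv/= => /andP[uw' wv'].
rewrite (@ge0_integral_itv_split _ _ u' w' v' uw' wv'); last first.
  by move=> t; rewrite lee_fin speed_ge0.
have sub1 : `[u', w'] `<=` (`[u', v'] : set R).
  by move=> t /=; rewrite !in_itv/= => /andP[-> h]; rewrite (le_trans h).
have sub2 : `[w', v'] `<=` (`[u', v'] : set R).
  by move=> t /=; rewrite !in_itv/= => /andP[h ->]; rewrite (le_trans uw').
have lips (I J : set R) sigma : J `<=` I -> lipschitz_curve g I sigma -> lipschitz_curve g J sigma.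
  move=> JI L t Jt; have [c [N [K [ac nN cN lN]]]] := L t (JI t Jt).
  exists c, N, K; split; [exact: ac|exact: nN|by move=> s Ns /JI; exact: cN|].
  by move=> s s' Ns /JI Is Ns' /JI Is'; exact: lN.
apply: leeD; apply: ereal_sup_ubound.
- exists phi, u', w'; split; [|exact: lips sub1 lip|by []].
  split=> //; first exact: continuous_subspaceW phc.
  by move=> s t /sub1 sI /sub1 tI; exact: phm.
- exists phi, w', v'; split; [|exact: lips sub2 lip|by []].
  split=> //; first exact: continuous_subspaceW phc.
  by move=> s t /sub2 sI /sub2 tI; exact: phm.
Qed.

Lemma qlength_sum (Q : chart R n M -> M -> 'M[R]_n.+1) beta (tau : nat -> R) m :
  {homo tau : i j / (i <= j)%N >-> i <= j} ->
  (qlength g Q beta (tau 0%N) (tau m.+1) <=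
   \sum_(j < m.+1) qlength g Q beta (tau j) (tau j.+1))%E.
Proof.
move=> mono; elim: m => [|m IH]; first by rewrite big_ord_recr/= big_ord0 add0e.
rewrite big_ord_recr/=; apply: le_trans (leeD IH (lexx _)).
by apply: qlength_split; exact: mono.
Qed.

(* Extend the curve by constants before applying Lebesgue's theorem. *)
Lemma lipschitz_itv_ae_derivable (x : R -> vec) u v K : u <= v ->
  (forall s t, u <= s <= v -> u <= t <= v -> `|x s - x t| <= K * `|s - t|) ->
  {ae leb, forall t, u < t < v -> derivable x t 1}.
Proof.
move=> uv xK; pose clip t := Num.max u (Num.min v t).
have clipI t : u <= clip t <= v by rewrite le_max lexx ge_max uv ge_min lexx.
have K0 : 0 <= `|K| by [].
have maxL (w a b : R) : `|Num.max w a - Num.max w b| <= `|a - b|.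
  have [h1|h1] := leP w a; have [h2|h2] := leP w b; rewrite ?subrr ?normr0//.
    by rewrite !ger0_norm ?subr_ge0//; lra.
  by rewrite !ler0_norm ?subr_le0//; lra.
have minL (w a b : R) : `|Num.min w a - Num.min w b| <= `|a - b|.
  have [h1|h1] := leP w a; have [h2|h2] := leP w b; rewrite ?subrr ?normr0//.
    by rewrite !ger0_norm ?subr_ge0//; lra.
  by rewrite !ler0_norm ?subr_le0//; lra.
have clipL s t : `|clip s - clip t| <= `|s - t| by exact: le_trans (maxL _ _ _) (minL _ _ _).
have ae1 (k : nat) : {ae leb, forall t, derivable (fun s => x (clip s) 0 (inord k : 'I_n.+1)) t 1}.
  apply: (@lipschitz_ae_derivable _ _ `|K|) => s t.
  have := rV_coord_le_norm (x (clip s) - x (clip t)) (inord k : 'I_n.+1); rewrite !mxE.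
  move=> /le_trans; apply; apply: le_trans (xK _ _ (clipI s) (clipI t)) _.
  apply: (@le_trans _ _ (`|K| * `|clip s - clip t|)).
    by apply: ler_wpM2r => //; exact: ler_norm.
  exact: ler_wpM2l.
apply: ae_imply (ae_foralln ae1) => t Ht /andP[ut tv].
have dc : derivable (fun s => x (clip s)) t 1.
  apply/derivable_mxP => i j; rewrite (ord1 i) -(inord_val j); exact: Ht.
apply: near_eq_derivable dc.
exists (Num.min (t - u) (v - t)) => /=; first by rewrite lt_min !subr_gt0 ut.
move=> s; rewrite /ball/= lt_min !ltr_norml => /andP[/andP[h1 h2] /andP[h3 h4]].
have us : u <= s by lra.
have sv : s <= v by lra.
by rewrite /clip (min_idPr sv) (max_idPr us).
Qed.

End length_bound.

(** * Upper semicontinuity of length on short intervals *)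

Section semicontinuity.
Context (R : realType) (n : nat) (M : topologicalType).
Variable g : lorentzianManifold R n M.
Variable f : M -> R.
Implicit Types (c : chart R n M) (p q : M) (beta sigma : R -> M).
Local Notation vec := 'rV[R]_n.+1.
Local Notation leb := (@lebesgue_measure R).
Local Notation mQ := (fun c p => - metric g c p).

Lemma derive1_le_lipschitz (x : R -> vec) t C d : 0 < d -> derivable x t 1 ->
  (forall s, `|s - t| < d -> `|x s - x t| <= C * `|s - t|) -> `|derive1 x t| <= C.
Proof.
move=> d0 dx xC; apply/ler_addgt0Pr => e e0.
have [d' d'0 Hd'] := derivable_increment dx e0.
have m0 : 0 < Num.min d d' by rewrite lt_min d0.
set s := t + Num.min d d' / 2.
have sE : s - t = Num.min d d' / 2 by rewrite /s addrC addKr.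
have st0 : 0 < s - t by rewrite sE divr_gt0.
have sm : s - t < Num.min d d' by rewrite sE ltr_pdivrMr// ltr_pMr// ltr1n.
have [sd sd'] : `|s - t| < d /\ `|s - t| < d'.
  by move: sm; rewrite (gtr0_norm st0) lt_min => /andP[].
have h1 := xC s sd; have h2 := Hd' s sd'.
rewrite -(ler_pM2l st0) -{1}(gtr0_norm st0) -normrZ.
rewrite -(subrK (x s - x t) ((s - t) *: derive1 x t)); apply: le_trans (ler_normD _ _) _.
rewrite distrC mulrDr addrC; move: h1 h2; rewrite (gtr0_norm st0) => h1 h2.
by apply: lerD; rewrite mulrC.
Qed.

Lemma sqrt_add_sqr (a s E : R) : 0 <= s -> 0 <= E -> a <= s ^+ 2 + E ^+ 2 ->
  Num.sqrt a <= s + E.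
Proof.
move=> s0 E0 aE; rewrite -[leRHS]ger0_norm ?addr_ge0// -sqrtr_sqr; apply: ler_wsqrtr.
by apply: le_trans aE _; rewrite sqrrD; have := mulr_ge0 s0 E0; lra.
Qed.

Lemma le_sqr_sqrt (a : R) : a <= Num.sqrt a ^+ 2.
Proof.
have [a0|/ltW a0] := leP 0 a; first by rewrite sqr_sqrtr.
exact: le_trans a0 (sqr_ge0 _).
Qed.

Lemma lb_le_time (e : R) (z : vec) : 0 < e -> e < 1 ->
  lb (1 + e) (1 - e) z z <= 2 * z 0 0 ^+ 2.
Proof.
move=> e0 e1; rewrite /lb -expr2; have := ssum_ge0 z; have := sqr_ge0 (z 0 0) => h1 h2.
have : 0 <= (1 - e) * ssum z z by apply: mulr_ge0 => //; lra.
have : 0 <= (1 - e) * z 0 0 ^+ 2 by apply: mulr_ge0 => //; lra.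
lra.
Qed.

(* The derivative of a cone curve has almost the right length for the constant
   Lorentz form of the frame. *)
Lemma cone_speed_bound p0 (P : 'M[R]_n.+1) (C e r K E d : R) q (a : vec) :
  0 < C -> 0 < e -> e < 1 -> 0 < K -> 0 < E -> 0 < d -> good_ball g f p0 P C e r ->
  (forall v : vec, `|v *m P| <= K * `|v|) ->
  4 * e * n.+1%:R * (K * C) ^+ 2 <= E ^+ 2 ->
  4 * d * (K * C) + 2 * d ^+ 2 <= E ^+ 2 / 2 ->
  chart_ball (chart_at g p0) (chart_at g p0 p0) r q -> `|a| <= C ->
  Num.sqrt (lb (1 + e) (1 - e) ((- a) *m P + d *: tvec R n) ((- a) *m P + d *: tvec R n))
    <= Num.sqrt (bform (- metric g (chart_at g p0) q) a a) + E.
Proof.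
move=> C0 e0 e1 K0 E0 d0 [_ frame _] HK He Hd qB aC.
have [_ lo] := frame q (- a) qB.
set G := metric g (chart_at g p0) q in lo *.
have bE : bform (- G) a a = - bform G (- a) (- a).
  by rewrite bformN -!(scaleN1r a) bformZl bformZr !mulN1r opprK.
rewrite bE; set z := (- a) *m P in lo *; set s := Num.sqrt (- bform G (- a) (- a)).
(* The square root is not Lipschitz at zero, so the error is estimated for squares, where [E ^+ 2]
   may be spent. *)
apply: sqrt_add_sqr; [exact: sqrtr_ge0|exact: ltW|].
have hs : lb (1 - e) (1 + e) z z <= s ^+ 2 := le_trans lo (le_sqr_sqrt _).
have zK : `|z| <= K * C.
  by apply: le_trans (HK _) _; rewrite normrN ler_pM2l.
have z2 : `|z| ^+ 2 <= (K * C) ^+ 2.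
  by rewrite ler_sqr ?nnegrE//; apply: mulr_ge0; exact: ltW.
have T1 : z 0 0 ^+ 2 + ssum z z <= n.+1%:R * (K * C) ^+ 2.
  by apply: le_trans (ssum_le_norm z) _; rewrite ler_pM2l.
have z00 : z 0 0 <= K * C.
  by apply: le_trans (ler_norm _) _; apply: le_trans zK; exact: rV_coord_le_norm.
have A0 : 0 < 1 + e by rewrite addr_gt0.
rewrite lb_Dtvec.
have h1 : lb (1 + e) (1 - e) z z = lb (1 - e) (1 + e) z z + 2 * e * (z 0 0 ^+ 2 + ssum z z).
  by rewrite /lb; ring.
have h2 : 2 * e * (z 0 0 ^+ 2 + ssum z z) <= E ^+ 2 / 2.
  apply: (@le_trans _ _ (2 * e * (n.+1%:R * (K * C) ^+ 2))); last lra.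
  by apply: ler_wpM2l => //; rewrite mulr_ge0// ltW.
have h3 : (1 + e) * (2 * d * z 0 0 + d ^+ 2) <= E ^+ 2 / 2.
  apply: le_trans Hd; have -> : 4 * d * (K * C) + 2 * d ^+ 2 = 2 * (2 * d * (K * C) + d ^+ 2) by ring.
  have h : 2 * d * z 0 0 + d ^+ 2 <= 2 * d * (K * C) + d ^+ 2.
    by rewrite lerD2r ler_pM2l// mulr_gt0.
  have h' : 0 <= 2 * d * (K * C) + d ^+ 2.
    by rewrite addr_ge0 ?sqr_ge0// mulr_ge0 ?mulr_ge0 ?(ltW d0) ?(ltW K0) ?(ltW C0).
  apply: (@le_trans _ _ ((1 + e) * (2 * d * (K * C) + d ^+ 2))).
    by rewrite ler_pM2l.
  by apply: ler_wpM2r => //; lra.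
rewrite h1; lra.
Qed.

(** The length of [B k] is at most that of its polygon on a grid, measured by the wider form; these
    polygons converge to that of [G], whose length is a sum of difference quotients. The three
    errors come from the comparison of forms, the choice of the grid and the convergence of the
    polygons. *)
Lemma cone_usc p0 (P : 'M[R]_n.+1) (C e r K E u v : R) (B : nat -> R -> M) (G : R -> M) :
  0 < C -> 0 < e -> e < 1 -> 0 < K -> 0 < E -> good_ball g f p0 P C e r ->
  (forall v : vec, `|v *m P| <= K * `|v|) ->
  4 * e * n.+1%:R * (K * C) ^+ 2 <= E ^+ 2 -> u < v ->
  cone_curve g p0 P C e r `[u, v] G ->
  (\forall k \near \oo, cone_curve g p0 P C e r `[u, v] (B k)) ->
  (forall t, u <= t <= v -> (fun k => chart_at g p0 (B k t)) @ \oo --> chart_at g p0 (G t)) ->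
  \forall k \near \oo, (lorentz_length g (B k) u v <=
    \int[leb]_(t in `[u, v]) (speed g mQ G t)%:E + (3 * E * (v - u))%:E)%E.
Proof.
move=> C0 e0 e1 K0 E0 gb HK He uv wcG wcB BG; set c := chart_at g p0 in BG *.
have ac : atlas g c := chart_at_atlas g _.
have [im _ _] := gb; have [inG coneG] := wcG.
have KC0 : 0 < K * C by rewrite mulr_gt0.
have A0 : 0 < 1 + e by rewrite addr_gt0.
have B0 : 0 < 1 - e by rewrite subr_gt0.
have den : 0 < 2 * (4 * (K * C) + 2) by rewrite mulr_gt0// addr_gt0// mulr_gt0.
(* Chosen for [Hd], through [d ^+ 2 <= d]. *)
pose d := Num.min 1 (E ^+ 2 / (2 * (4 * (K * C) + 2))).
have d0 : 0 < d by rewrite lt_min ltr01 divr_gt0// exprn_gt0.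
have d1 : d <= 1 by rewrite ge_min lexx.
have Hd : 4 * d * (K * C) + 2 * d ^+ 2 <= E ^+ 2 / 2.
  have : d * (2 * (4 * (K * C) + 2)) <= E ^+ 2 by rewrite -ler_pdivlMr// ge_min lexx orbT.
  have : d ^+ 2 <= d by rewrite expr2 ler_piMr// ltW.
  lra.
move: d d0 d1 Hd => d d0 d1 Hd {den}.
pose x := (c \o G : R -> vec).
pose h (m : nat) := (v - u) / m.+1%:R.
have h0 m : 0 < h m by rewrite divr_gt0// subr_gt0.
pose gp (m j : nat) := grid_point u v m.+1 j.
have gpS m j : gp m j.+1 = gp m j + h m by exact: grid_pointS.
have dgp m j : gp m j.+1 - gp m j = h m by rewrite gpS addrC addKr.
have gpI m j : (j <= m.+1)%N -> `[u, v]%classic (gp m j).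
  by move=> jm; rewrite /= in_itv/=; apply: grid_point_itv; rewrite ?ltW.
(* The negated difference quotient of [G] on a cell, in the frame and pushed off the light cone;
   [cc] is its length for the wider form. *)
pose Z m j := (- ((h m)^-1 *: (x (gp m j.+1) - x (gp m j)))) *m P + d *: tvec R n.
pose cc m j := Num.sqrt (lb (1 + e) (1 - e) (Z m j) (Z m j)).
have xL s t : u <= s <= v -> u <= t <= v -> `|x s - x t| <= C * `|s - t|.
  move=> sI tI; have sI' : `[u, v]%classic s by rewrite /= in_itv.
  have tI' : `[u, v]%classic t by rewrite /= in_itv.
  have [st|ts|->] := ltgtP s t.
  - by have [H _] := coneG s t sI' tI' st; rewrite ltr0_norm ?subr_lt0// opprB.
  - by have [H _] := coneG t s tI' sI' ts; rewrite distrC gtr0_norm ?subr_gt0.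
  - by rewrite !subrr !normr0 mulr0.
have qn m j : (j < m.+1)%N -> `|(h m)^-1 *: (x (gp m j.+1) - x (gp m j))| <= C.
  move=> jm; have := gpI m j (ltnW jm); have := gpI m j.+1 jm.
  rewrite /= !in_itv/= => g1 g2; have := xL _ _ g1 g2.
  rewrite dgp (gtr0_norm (h0 m)) => H.
  by rewrite normrZ gtr0_norm ?invr_gt0// mulrC ler_pdivrMr.
(* A bound independent of the grid, as the reverse Fatou argument requires. *)
have ccB m j : (j < m.+1)%N -> 0 <= cc m j <= Num.sqrt (2 * (K * C + d) ^+ 2).
  move=> jm; rewrite sqrtr_ge0/=; apply: ler_wsqrtr.
  apply: le_trans (lb_le_time _ e0 e1) _; rewrite ler_pM2l//.
  rewrite -(@real_normK _ (Z m j 0 0)) ?num_real//.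
  rewrite ler_sqr ?nnegrE ?addr_ge0 ?(ltW d0) ?(ltW KC0)//.
  apply: le_trans (rV_coord_le_norm _ _) _; apply: le_trans (ler_normD _ _) _.
  apply: lerD.
    apply: le_trans (HK _) _; rewrite normrN ler_pM2l//; exact: qn.
  rewrite normrZ (gtr0_norm d0) ler_piMr ?(ltW d0)//.
  apply: rV_norm_le => // i; rewrite mxE eqxx/=; case: (i == 0); rewrite ?normr1 ?normr0//.
have aed : {ae leb, forall t, u < t < v -> derivable x t 1}.
  exact: lipschitz_itv_ae_derivable (ltW uv) xL.
have limit : {ae leb, forall t, u < t < v -> forall rr, 0 < rr ->
    \forall m \near \oo, step_fun u v m.+1 (cc m) t <= speed g mQ G t + E + rr}.
  apply: ae_imply aed => t dt /andP[ut tv] rr rr0.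
  have tI : `[u, v]%classic t by rewrite /= in_itv/= !ltW.
  have {}dt : derivable x t 1 by apply: dt; rewrite ut.
  have sc : {for t, continuous G}.
    exact: within_interior (cone_curve_continuous C0 im wcG) ut tv.
  have Bt := inG t tI; have [ct _] := Bt.
  have cN : covariant_at g mQ (G t) by exact: covariant_metricN.
  have spE : speed g mQ G t = Num.sqrt (bform (- metric g c (G t)) (derive1 x t) (derive1 x t)).
    by rewrite (speedE cN sc ac ct); exact: (if_asboolT _ _ dt).
  have aC : `|derive1 x t| <= C.
    have m0 : 0 < Num.min (t - u) (v - t) by rewrite lt_min !subr_gt0 ut.
    apply: (derive1_le_lipschitz m0 dt) => s.
    rewrite lt_min !ltr_norml => /andP[/andP[h1 h2] /andP[h3 h4]].
    by apply: xL; apply/andP; split; lra.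
  have key := cone_speed_bound C0 e0 e1 K0 E0 d0 gb HK He Hd Bt aC.
  rewrite -spE in key.
  pose ph (a : vec) := Num.sqrt (lb (1 + e) (1 - e) ((- a) *m P + d *: tvec R n)
    ((- a) *m P + d *: tvec R n)).
  have phc : ph a @[a --> derive1 x t] --> ph (derive1 x t).
    have FF : Filter (nbhs (derive1 x t)) := nbhs_filter _.
    have lc : lb (1 + e) (1 - e) ((- a) *m P + d *: tvec R n) ((- a) *m P + d *: tvec R n)
        @[a --> nbhs (derive1 x t)] --> lb (1 + e) (1 - e) ((- derive1 x t) *m P + d *: tvec R n)
          ((- derive1 x t) *m P + d *: tvec R n).
      apply: lb_cvg => i; rewrite [X in _ --> X]mxE; under eq_fun do rewrite mxE.
      apply: cvgD; last exact: cvg_cst.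
      apply: mulmx_cvg; apply: cvgN; exact: cvg_id.
    exact: (cvg_comp _ _ lc (@sqrt_continuous R _)).
  have nph : \forall a \near derive1 x t, `|ph (derive1 x t) - ph a| <= rr.
    by move/(@cvgrPdist_le _ R^o _ _ (nbhs_filter (derive1 x t))): phc; apply.
  have [eta eta0 Heta] := near_closed_ball nph.
  have [d' d'0 Hd'] := derivable_straddle dt eta0.
  apply: filterS (step_width_small (ltW uv) d'0) => m hm.
  have [j jm tj] := @grid_cell _ u v m.+1 t isT (introT andP (conj (ltW ut) tv)).
  rewrite (step_funE _ (ltW uv) jm tj).
  move: tj => /andP[tj1 tj2].
  have := Hd' (gp m j) (gp m j.+1) tj1 (ltW tj2).
  rewrite dgp gpS ltrDl h0 => /(_ isT hm) /Heta.
  rewrite -/(cc m j) -gpS => H.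
  have -> : cc m j = ph ((h m)^-1 *: (x (gp m j.+1) - x (gp m j))) by [].
  move: H; rewrite distrC ler_norml => /andP[_]; rewrite -/(ph _) in key *.
  by move: key; lra.
have Euv : 0 < E * (v - u) by rewrite mulr_gt0// subr_gt0.
have sp0 t : 0 <= speed g mQ G t by exact: speed_ge0.
have [m Hm] := step_sums_le_integral uv (ltW E0) Euv ccB sp0 limit.
(* The perturbation [d * h m] scales with the cell, so that the limit [W0 j] is [h m *: Z m j]. *)
pose W k j := (c (B k (gp m j)) - c (B k (gp m j.+1))) *m P + (d * h m) *: tvec R n.
pose W0 j := (x (gp m j) - x (gp m j.+1)) *m P + (d * h m) *: tvec R n.
have W0E j : Num.sqrt (lb (1 + e) (1 - e) (W0 j) (W0 j)) = cc m j * h m.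
  have -> : W0 j = h m *: Z m j.
    rewrite /W0 /Z scalerDr scalerA (mulrC d); congr (_ + _).
    by rewrite scalemxAl; congr (_ *m _); rewrite scalerN scalerA mulfV ?gt_eqF// scale1r opprB.
  rewrite lbZl lbZr mulrA -expr2 sqrtrM ?sqr_ge0// sqrtr_sqr (gtr0_norm (h0 m)).
  by rewrite mulrC.
have cvgW : (fun k => \sum_(j < m.+1) Num.sqrt (lb (1 + e) (1 - e) (W k j) (W k j))) @ \oo
    --> \sum_(j < m.+1) cc m j * h m.
  apply: cvg_sum_seq => j; rewrite -W0E.
  have lc : (fun k => lb (1 + e) (1 - e) (W k j) (W k j)) @ \oo --> lb (1 + e) (1 - e) (W0 j) (W0 j).
    apply: lb_cvg => i; rewrite [X in _ --> X]mxE; under eq_fun do rewrite mxE.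
    apply: cvgD; last exact: cvg_cst.
    apply: mulmx_cvg; apply: cvgB; apply: BG.
      by have := gpI m j (ltnW (ltn_ord j)); rewrite /= in_itv.
    by have := gpI m j.+1 (ltn_ord j); rewrite /= in_itv.
  exact: (cvg_comp _ _ lc (@sqrt_continuous R _)).
have nW : \forall k \near \oo, `|\sum_(j < m.+1) cc m j * h m -
    \sum_(j < m.+1) Num.sqrt (lb (1 + e) (1 - e) (W k j) (W k j))| <= E * (v - u).
  by move/cvgrPdist_le: cvgW; apply.
apply: filterS (filterI wcB nW) => k [wck nk].
apply: (@le_trans _ _ (\sum_(j < m.+1) Num.sqrt (lb (1 + e) (1 - e) (W k j) (W k j)))%:E).
  have mono : {homo gp m : i j / (i <= j)%N >-> i <= j}.
    by move=> i j ij; apply: le_grid_point ij; exact: ltW.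
  have := @qlength_sum _ _ _ g mQ (B k) (gp m) m mono.
  rewrite {1}/gp grid_point0 {1}/gp grid_point_last// => /le_trans; apply.
  rewrite -sumEFin; apply: lee_sum => j _.
  have gj : gp m j <= gp m j.+1 by rewrite gpS lerDl ltW.
  have sub : `[gp m j, gp m j.+1] `<=` (`[u, v] : set R).
    have := gpI m j (ltnW (ltn_ord j)); have := gpI m j.+1 (ltn_ord j).
    rewrite /= !in_itv/= => /andP[_ g1] /andP[g2 _] s /=; rewrite !in_itv/= => /andP[s1 s2].
    by rewrite (le_trans g2 s1) (le_trans s2 g1).
  apply: (cone_curve_length C0 e0 e1 gb gj (cone_curve_sub sub wck) (mulr_gt0 d0 (h0 m))).
  by [].
apply: (@le_trans _ _ (\sum_(j < m.+1) cc m j * h m + E * (v - u))%:E).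
  by rewrite lee_fin; move: nk; rewrite ler_norml => /andP[+ _]; lra.
rewrite EFinD; apply: le_trans (leeD Hm (lexx _)) _.
rewrite -addeA; apply: leeD => //; rewrite -EFinD lee_fin; lra.
Qed.

End semicontinuity.

(** * Length of the limit curve on compact intervals *)

Section limit_lengths.
Context (R : realType) (n : nat) (M : topologicalType).
Variable g : lorentzianManifold R n M.
Variable f : M -> R.
Local Notation vec := 'rV[R]_n.+1.
Local Notation leb := (@lebesgue_measure R).
Local Notation mQ := (fun c p => - metric g c p).

(** The bound adds up over adjacent intervals, the integral exactly and the length subadditively. It
    is therefore enough to work near each point, where [e] can be chosen after [K] and [C]. *)
Lemma limit_usc T B G E u v : local_limit g f T B G -> 0 <= u -> u < v -> v <= T -> 0 < E ->
  \forall k \near \oo, (lorentz_length g (B k) u v <=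
    \int[leb]_(t in `[u, v]) (speed g mQ G t)%:E + (E * (v - u))%:E)%E.
Proof.
move=> ll u0 uv vT E0.
apply: (interval_patch (Q := fun s t => \forall k \near \oo, (lorentz_length g (B k) s t <=
    \int[leb]_(t in `[s, t]) (speed g mQ G t)%:E + (E * (t - s))%:E)%E) uv).
  move=> s w t _ sw wt _ h1 h2; apply: filterS (filterI h1 h2) => k [k1 k2].
  apply: le_trans (qlength_split _ _ _ (ltW sw) (ltW wt)) _.
  apply: le_trans (leeD k1 k2) _.
  rewrite [X in (_ <= X + _)%E](@ge0_integral_itv_split _ _ s w t (ltW sw) (ltW wt)); last first.
    by move=> z; rewrite lee_fin speed_ge0.
  rewrite addeACA; apply: leeD => //; rewrite -EFinD lee_fin; lra.
move=> t0 ut0 t0v.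
have t0T : 0 <= t0 <= T by rewrite (le_trans u0 ut0) (le_trans t0v vT).
have [P [C [uP C0 He]]] := ll t0 t0T.
have [K K0 HK] := mulmx_norm_le P.
have KC0 : 0 < K * C by rewrite mulr_gt0.
have E30 : 0 < E / 3 by rewrite divr_gt0.
have den : 0 < 4 * n.+1%:R * (K * C) ^+ 2 by rewrite mulr_gt0 ?exprn_gt0// mulr_gt0.
pose e := Num.min (1 / 2) ((E / 3) ^+ 2 / (4 * n.+1%:R * (K * C) ^+ 2)).
have e0 : 0 < e by rewrite lt_min !divr_gt0// exprn_gt0.
have e1 : e < 1 by apply: (@le_lt_trans _ _ (1 / 2)); [rewrite ge_min lexx|lra].
have eE : 4 * e * n.+1%:R * (K * C) ^+ 2 <= (E / 3) ^+ 2.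
  have : e * (4 * n.+1%:R * (K * C) ^+ 2) <= (E / 3) ^+ 2.
    by rewrite -ler_pdivlMr// ge_min lexx orbT.
  by rewrite (_ : 4 * e * n.+1%:R * (K * C) ^+ 2 = e * (4 * n.+1%:R * (K * C) ^+ 2)); last ring.
have [r [d [[r0 d0 gb] [wcG wcB BG]]]] := He e e0 e1.
exists d; first exact: d0.
move=> s t us st tv sd td.
have sub : `[s, t] `<=` [set t | 0 <= t <= T /\ `|t - t0| < d].
  move=> z /=; rewrite in_itv/= => /andP[sz zt]; split.
    by rewrite (le_trans u0 (le_trans us sz)) (le_trans zt (le_trans tv vT)).
  by rewrite ltr_norml; apply/andP; split; lra.
have wcB' : \forall k \near \oo, cone_curve g (G t0) P C e r `[s, t] (B k).
  by apply: filterS wcB => k; exact: cone_curve_sub.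
have BG' z : s <= z <= t -> (fun k => chart_at g (G t0) (B k z)) @ \oo --> chart_at g (G t0) (G z).
  by move=> zI; apply: BG; apply: sub; rewrite /= in_itv.
have := cone_usc C0 e0 e1 K0 E30 gb HK eE st (cone_curve_sub sub wcG) wcB' BG'.
by rewrite (_ : 3 * (E / 3) * (t - s) = E * (t - s)); last by field.
Qed.

(** Semicontinuity for the constant sequence. With the lemma that follows, it evaluates the supremum
    over reparametrisations in the given parameter. *)
Lemma length_le_speed T B G u v : local_limit g f T B G -> 0 <= u -> u < v -> v <= T ->
  (lorentz_length g G u v <= \int[leb]_(t in `[u, v]) (speed g mQ G t)%:E)%E.
Proof.
move=> ll u0 uv vT; apply/lee_addgt0Pr => e e0.
have uv0 : 0 < v - u by rewrite subr_gt0.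
have [k] := filter_ex (limit_usc (local_limit_cst ll) u0 uv vT (divr_gt0 e0 uv0)).
by rewrite divfK ?gt_eqF.
Qed.

Lemma speed_le_length T B G u v : local_limit g f T B G -> 0 <= u -> u <= v -> v <= T ->
  (\int[leb]_(t in `[u, v]) (speed g mQ G t)%:E <= lorentz_length g G u v)%E.
Proof.
move=> ll u0 uv vT; apply: speed_integral_le_qlength => // t0 t0I.
have /andP[ut0 t0v] : u <= t0 <= v by move: t0I; rewrite /= in_itv.
have t0T : 0 <= t0 <= T by rewrite (le_trans u0 ut0) (le_trans t0v vT).
have [P [C [uP C0 He]]] := ll t0 t0T.
have h1 : 0 < 1 / 2 :> R by lra.
have h2 : 1 / 2 < 1 :> R by lra.
have [r [d [[r0 d0 gb] [[inG cG] _ _]]]] := He _ h1 h2.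
have sub s : ball t0 d s -> `[u, v]%classic s -> 0 <= s <= T /\ `|s - t0| < d.
  rewrite /ball/= in_itv/= distrC => sd /andP[us sv]; split => //.
  by rewrite (le_trans u0 us) (le_trans sv vT).
exists (chart_at g (G t0)), (ball t0 d), (n.+1%:R * C); split.
- exact: chart_at_atlas.
- exact: nbhsx_ballx.
- by move=> s sd sI; have [] := inG s (sub s sd sI).
move=> s s' sd sI s'd s'I; apply: le_trans (enorm_le_norm _) _.
rewrite -mulrA; apply: ler_wpM2l => //.
have [st|ts|->] := ltgtP s s'; last by rewrite !subrr !normr0 mulr0.
- by have [h _] := cG s s' (sub s sd sI) (sub s' s'd s'I) st; rewrite ltr0_norm ?subr_lt0// opprB.
- by have [h _] := cG s' s (sub s' s'd s'I) (sub s sd sI) ts; rewrite distrC gtr0_norm ?subr_gt0.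
Qed.

End limit_lengths.

(** * Gradient bound and monotonicity of the time function in charts *)

Section calculus.
Context (R : realType).

Lemma diff_near_eq (V W : normedModType R) (F F' : V -> W) z : {near z, F =1 F'} ->
  differentiable F' z -> differentiable F z /\ 'd F z = 'd F' z :> (V -> W).
Proof.
move=> E dF'; apply: increment_differentiable; first exact: diff_continuous.
move=> e e0; have [d d0 Hd] := differentiable_increment dF' e0.
have [d' /= d'0 Hd'] := (iffLR (nbhs_ballP _ _)) E.
exists (Num.min d d'); first by rewrite lt_min d0.
move=> y; rewrite lt_min => /andP[yd yd'].
rewrite (Hd' (z + y)); last by rewrite -ball_normE /ball_/= opprD addrA subrr sub0r normrN.
by rewrite (Hd' z); [exact: Hd|exact: ballxx].
Qed.

Lemma derive1_comp_diff (V W : normedModType R) (x : R -> V) (F : V -> W) t :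
  derivable x t 1 -> differentiable F (x t) ->
  derivable (F \o x) t 1 /\ derive1 (F \o x) t = 'd F (x t) (derive1 x t).
Proof.
move=> dx dF; have dX : differentiable x t by exact/derivable1_diffP.
have dC : differentiable (F \o x) t by exact: differentiable_comp.
have dC1 : derivable (F \o x) t 1 by exact/derivable1_diffP.
split; first exact: dC1.
by rewrite (derive1_diff dC1) (derive1_diff dx) (diff_comp dX dF).
Qed.

Lemma line_derivable (V : normedModType R) (z v : V) t :
  derivable (fun s : R => z + s *: v) t 1 /\ derive1 (fun s : R => z + s *: v) t = v.
Proof.
apply: increment_derivable => e e0; exists 1 => // s _.
rewrite (_ : _ - _ - _ = 0); first by rewrite normr0 mulr_ge0 ?(ltW e0).
by rewrite opprD addrACA subrr add0r -scalerBl subrr.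
Qed.

Lemma derive1_ge0_right (h : R -> R) t d : 0 < d -> derivable h t 1 ->
  (forall s, t < s -> s < t + d -> h t <= h s) -> 0 <= derive1 h t.
Proof.
move=> d0 dh H; rewrite leNgt; apply/negP => L0.
have L0' : 0 < - derive1 h t / 2 by rewrite divr_gt0// oppr_gt0.
have [d' d'0 Hd'] := derivable_increment dh L0'.
have m0 : 0 < Num.min d d' by rewrite lt_min d0.
set s := t + Num.min d d' / 2.
have sE : s - t = Num.min d d' / 2 by rewrite /s addrC addKr.
have st0 : 0 < s - t by rewrite sE divr_gt0.
have [sd sd'] : s - t < d /\ s - t < d'.
  have : s - t < Num.min d d' by rewrite sE ltr_pdivrMr// ltr_pMr// ltr1n.
  by rewrite lt_min => /andP[].
have ts : t < s by rewrite -subr_gt0.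
have std : s < t + d by rewrite addrC -ltrBlDr.
have std' : `|s - t| < d' by rewrite gtr0_norm.
have := Hd' s std'; rewrite (gtr0_norm st0) ler_norml => /andP[_].
have := H s ts std; set L := derive1 _ _ in L0 *; rewrite /GRing.scale/=.
have : (s - t) * L < 0 by rewrite pmulr_rlt0.
lra.
Qed.

Lemma bform_cvg (n : nat) (T : Type) (F : set_system T) (FF : Filter F)
    (G : T -> 'M[R]_n.+1) (G0 : 'M[R]_n.+1) (o : T -> 'rV[R]_n.+1) (o0 w : 'rV[R]_n.+1) :
  G @ F --> G0 -> o @ F --> o0 ->
  (fun y => bform (G y) (o y) w) @ F --> bform G0 o0 w.
Proof.
move=> GG oo; rewrite bformE; under eq_fun do rewrite bformE.
apply: cvg_sum_seq => i; apply: cvg_sum_seq => j.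
apply: cvgM; last exact: cvg_cst.
apply: cvgM; first exact: (cvg_comp _ _ oo (@coord_continuous _ _ _ 0 i _)).
exact: (cvg_comp _ _ GG (@coord_continuous _ _ _ i j _)).
Qed.

Lemma lorentz_reverse_cs (n : nat) (G : 'M[R]_n.+1) (X Y : 'rV[R]_n.+1) :
  lorentz_signature G -> bform G X X <= 0 ->
  bform G X X * bform G Y Y <= bform G X Y ^+ 2.
Proof.
move=> [P uP PG]; rewrite -/(mink R n) in PG.
have E Z W : bform G Z W = - lb 1 1 (Z *m invmx P) (W *m invmx P).
  by rewrite -bform_mink -PG bform_mulmx !mulmxKV.
rewrite !E oppr_le0 mulrNN sqrrN => h.
exact: (lb_reverse_cs ltr01 ltr01 _ h).
Qed.

End calculus.

Section speed_bound.
Context (R : realType) (n : nat) (M : topologicalType).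
Variable g : lorentzianManifold R n M.
Variable f : M -> R.
Hypothesis f_time : time_function g f.
Variable b0 : R.
Hypothesis b0_gt0 : 0 < b0.
Hypothesis f_grad : forall p, has_gradient g f p ->
  bform (metric g (chart_at g p) p) (gradient g f p) (gradient g f p) <= - b0 ^+ 2.
Implicit Types (c : chart R n M) (p q : M) (beta sigma : R -> M) (U : set M).
Local Notation vec := 'rV[R]_n.+1.
Local Notation mQ := (fun c p => - metric g c p).

(** Pairing the gradient with [v] gives the differential of [f], and the gradient is timelike, so
    the reverse Cauchy-Schwarz inequality applies. *)
Lemma gradient_bound p (v : vec) : has_gradient g f p ->
  bform (metric g (chart_at g p) p) v v <= 0 ->
  b0 ^+ 2 * - bform (metric g (chart_at g p) p) v v <=
    ('d (f \o cinv (chart_at g p) : vec -> R) (chart_at g p p) v) ^+ 2.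
Proof.
move=> hg vv; set c := chart_at g p in hg vv *.
have sig := metric_signature (chart_at_atlas g p) (chart_at_dom g p).
rewrite -/c in sig; set G := metric g c p in sig vv *.
have gg := f_grad hg; rewrite -/c -/G in gg.
set X := gradient g f p in gg.
have uG : G \in unitmx.
  have [P uP PG] := sig; rewrite -/(mink R n) in PG; have [_] := mulmx1_unit (mink2 R n); rewrite -PG.
  by rewrite !unitmx_mul => /andP[/andP[_ ->]].
have XvE : bform G X v = 'd (f \o cinv c : vec -> R) (c p) v.
  rewrite /bform /X /gradient -/c -/G mulmxKV// mxE.
  rewrite {2}(row_sum_delta v) linear_sum; apply: eq_bigr => j _.
  by rewrite linearZ /partial_coord !mxE deriveE// mulrC.
rewrite -XvE; have XX : bform G X X <= 0.
  by apply: le_trans gg _; rewrite oppr_le0 sqr_ge0.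
apply: le_trans (lorentz_reverse_cs v sig XX).
rewrite mulrN -mulNr; apply: ler_wnM2r => //.
Qed.

Lemma chart_line c z (v : vec) : (c @` cdom c) z ->
  let sigma := fun s : R => cinv c (z + s *: v) in
  [/\ {for 0, continuous sigma}, sigma 0 = cinv c z,
      derivable (c \o sigma : R -> vec) 0 1 & derive1 (c \o sigma : R -> vec) 0 = v].
Proof.
move=> im sigma.
have z0 : z + 0 *: v = z by rewrite scale0r addr0.
have [dl El] := line_derivable z v (0 : R).
have lc : (fun s : R => z + s *: v) @ 0 --> z.
  rewrite -[X in _ --> X]z0; exact: (derivable_continuous_at dl).
have nim : \forall y \near z, (c @` cdom c) y.
  by apply: open_nbhs_nbhs; split; [exact: cimg_open|].
have E : {near (0 : R), (fun s : R => z + s *: v) =1 (c \o sigma : R -> vec)}.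
  have H : \forall s \near (0 : R), (c @` cdom c) (z + s *: v) by exact: (lc _ nim).
  by apply: filterS H => s h; rewrite /= (cinvK h).1.
split.
- suff H : sigma @ 0 --> sigma 0 by exact: H.
  rewrite [X in _ --> X](_ : _ = cinv c z); last by rewrite /sigma z0.
  apply: (cvg_comp _ _ lc).
  exact: (@cinv_cont _ _ _ c z im).
- by rewrite /sigma z0.
- exact: (near_eq_derivable E dl).
by rewrite -(near_eq_derive1 E).
Qed.

(** The gradient hypothesis speaks of the selected chart at each point, while the mean value
    inequality needs one chart on a whole ball. The coordinate line through [z] in direction [v]
    carries the components of [v] from one chart to the other. *)
Lemma chart_gradient_bound c z (v : vec) : atlas g c -> (c @` cdom c) z ->
  differentiable (f \o cinv c : vec -> R) z -> bform (metric g c (cinv c z)) v v <= 0 ->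
  b0 ^+ 2 * - bform (metric g c (cinv c z)) v v <= ('d (f \o cinv c : vec -> R) z v) ^+ 2.
Proof.
move=> ac im dF vv; have [cqE cq] := cinvK im.
pose sigma := fun s : R => cinv c (z + s *: v).
have [sc s0 ds Es] : [/\ {for 0, continuous sigma}, sigma 0 = cinv c z,
  derivable (c \o sigma : R -> vec) 0 1 & derive1 (c \o sigma : R -> vec) 0 = v] := chart_line v im.
set q := cinv c z in cqE cq vv s0 *.
set c0 := chart_at g q; have ac0 : atlas g c0 := chart_at_atlas g _.
have c0q : cdom c0 q := chart_at_dom g _.
have cs : cdom c (sigma 0) by rewrite s0.
have c0s : cdom c0 (sigma 0) by rewrite s0.
have [d0 E0] := chart_change sc ac ac0 cs c0s ds.
have [_ E1] := chart_change sc ac0 ac c0s cs d0.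
rewrite Es s0 in E0; rewrite Es s0 in E1.
set w := derive1 (c0 \o sigma : R -> vec) 0 in E0 E1.
have bE : bform (metric g c q) v v = bform (metric g c0 q) w w.
  by rewrite (covariant_metric ac ac0 cq c0q) bform_mulmx -E0.
have dT := transition_differentiable ac0 ac c0q cq.
have Tq : (c \o cinv c0) (c0 q) = z by rewrite /= (cmapK c0q).
have dF' : differentiable (f \o cinv c : vec -> R) ((c \o cinv c0) (c0 q)) by rewrite Tq.
have nE : {near c0 q, (f \o cinv c0 : vec -> R) =1 (f \o cinv c) \o (c \o cinv c0)}.
  have : \forall y \near c0 q, cdom c (cinv c0 y).
    exact: (cinv_continuous_at c0q (near_cdom cq)).
  by apply: filterS => y cy /=; rewrite (cmapK cy).
have [hg dE] := diff_near_eq nE (differentiable_comp dT dF').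
have E2 : 'd (c \o cinv c0) (c0 q) w = v by rewrite transition_jacobianE -E1.
have E3 : 'd (f \o cinv c0 : vec -> R) (c0 q) w = 'd (f \o cinv c : vec -> R) z v.
  apply: (etrans (congr1 (fun h => h w) dE)).
  apply: (etrans (congr1 (fun h => h w) (diff_comp dT dF'))).
  exact: (etrans (congr1 (fun y => 'd (f \o cinv c : vec -> R) ((c \o cinv c0) (c0 q)) y) E2)
    (congr1 (fun y => 'd (f \o cinv c : vec -> R) y v) Tq)).
have vv' : bform (metric g c0 q) w w <= 0 by rewrite -bE.
have := gradient_bound hg vv'; rewrite -/c0 -bE => GB.
exact: (eq_ind _ (fun r => b0 ^+ 2 * - bform (metric g c q) v v <= r ^+ 2) GB _ E3).
Qed.

(** [f] increases along the future geodesic with initial direction [v]. In the normal chart centred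
    at the point this geodesic is a ray, and close to the centre its constant components stay future
    directed. *)
Lemma chart_time_derivative c z (v : vec) U : atlas g c -> (c @` cdom c) z ->
  convex_normal g U -> U (cinv c z) -> differentiable (f \o cinv c : vec -> R) z ->
  bform (metric g c (cinv c z)) v v < 0 ->
  bform (metric g c (cinv c z)) (orientation g c (cinv c z)) v < 0 ->
  0 <= 'd (f \o cinv c : vec -> R) z v.
Proof.
move=> ac im cU Uq dF vv ov; have [cqE cq] := cinvK im.
pose sigma := fun s : R => cinv c (z + s *: v).
have [sc s0 ds Es] : [/\ {for 0, continuous sigma}, sigma 0 = cinv c z,
  derivable (c \o sigma : R -> vec) 0 1 & derive1 (c \o sigma : R -> vec) 0 = v] := chart_line v im.
set q := cinv c z in cqE cq vv ov s0 Uq *.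
have [c1 [ac1 c1U _ c1q geo]] := cU.2 q Uq.
have c1d : cdom c1 q by rewrite c1U.
have cs : cdom c (sigma 0) by rewrite s0.
have c1s : cdom c1 (sigma 0) by rewrite s0.
have [d0 E0] := chart_change sc ac ac1 cs c1s ds.
have [_ E1] := chart_change sc ac1 ac c1s cs d0.
rewrite Es s0 in E0; rewrite Es s0 in E1.
set w := derive1 (c1 \o sigma : R -> vec) 0 in E0 E1.
have ww : bform (metric g c1 q) w w < 0.
  by rewrite E0 -bform_mulmx -(covariant_metric ac ac1 cq c1d).
have ow : bform (metric g c1 q) (orientation g c1 q) w < 0.
  by rewrite E0 (orientation_vector ac ac1 cq c1d) -bform_mulmx -(covariant_metric ac ac1 cq c1d).
have w0 : w != 0.
  by apply/eqP => w0; move: ww; rewrite w0 -(scale0r (0 : vec)) bformZl mul0r ltxx.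
have cG := sym_tensor_cvg (metric_tensor g) ac1 c1d I.
have cO := orientation_cvg ac1 c1d.
have FF : Filter (nbhs (c1 q)) := nbhs_filter _.
have n1 : \forall y \near c1 q, bform (metric g c1 (cinv c1 y)) w w < 0.
  have cw : w @[_ --> nbhs (c1 q)] --> w by exact: cvg_cst.
  have cb : (fun y => bform (metric g c1 (cinv c1 y)) w w) @ nbhs (c1 q) -->
    bform (metric g c1 q) w w .
    exact: (@bform_cvg R n _ _ FF (fun y => metric g c1 (cinv c1 y)) _ (fun=> w) w w cG cw).
  by apply: (cvgr_lt _ cb); exact: ww.
have n2 : \forall y \near c1 q,
    bform (metric g c1 (cinv c1 y)) (orientation g c1 (cinv c1 y)) w < 0.
  have cb : (fun y => bform (metric g c1 (cinv c1 y)) (orientation g c1 (cinv c1 y)) w)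
    @ nbhs (c1 q) --> bform (metric g c1 q) (orientation g c1 q) w.
    exact: (@bform_cvg R n _ _ FF (fun y => metric g c1 (cinv c1 y)) _ (fun y => orientation g c1 (cinv c1 y)) _ w cG cO).
  by apply: (cvgr_lt _ cb); exact: ow.
have [rho rho0 Hr] := near_closed_ball (filterI (near_cimg c1d) (filterI n1 n2)).
have nw : 0 < 2 * (`|w| + 1) by rewrite mulr_gt0// ltr_wpDl.
(* Keeps [s *: (tau *: w)] in the ball for [s] in []-2, 2[], a neighbourhood of the parameter
   interval. *)
pose tau := rho / (2 * (`|w| + 1)).
have tau0 : 0 < tau by rewrite divr_gt0.
have small s : `|s| < 2 -> `|s *: (tau *: w) - c1 q| <= rho.
  move=> s2; rewrite c1q subr0 scalerA normrZ normrM (gtr0_norm tau0).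
  have h : tau * (2 * (`|w| + 1)) = rho by rewrite divfK ?gt_eqF.
  have h2 : tau * `|w| <= tau * (`|w| + 1) by rewrite ler_pM2l// lerDl.
  apply: (@le_trans _ _ (2 * (tau * `|w|))); last lra.
  by rewrite -mulrA; apply: ler_wpM2r; [rewrite mulr_ge0// ltW|exact: ltW].
have one2 : `|1 : R| < 2 by rewrite normr1 ltr1n.
have [im1 _] := Hr _ (small 1 one2); rewrite scale1r in im1.
have [c1q' dq'] := cinvK im1; rewrite c1U in dq'.
have [_ geo1] := geo _ dq'; rewrite c1q' in geo1.
set s1 := fun t : R => cinv c1 (t *: (tau *: w)) in geo1.
have ins (t : R) : 0 <= t <= 1 -> `|t| < 2.
  by move=> /andP[t0 t1]; rewrite ger0_norm// (le_lt_trans t1)// ltr1n.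
have c1E s : `|s| < 2 -> c1 (s1 s) = s *: (tau *: w) /\ cdom c1 (s1 s).
  by move=> s2; have [h _] := Hr _ (small s s2); exact: cinvK.
have dl t : `|t| < 2 -> derivable (c1 \o s1 : R -> vec) t 1 /\
    derive1 (c1 \o s1 : R -> vec) t = tau *: w.
  move=> t2; have [dl El] := line_derivable 0 (tau *: w) t.
  have E : {near t, (fun s : R => 0 + s *: (tau *: w)) =1 (c1 \o s1 : R -> vec)}.
    exists (2 - `|t|) => /=; first by rewrite subr_gt0.
    move=> s; rewrite /ball/= => st; rewrite add0r.
    have s2 : `|s| < 2.
      rewrite -(subrK t s); apply: le_lt_trans (ler_normD _ _) _.
      by rewrite distrC -ltrBrDr.
    by have [-> _] := c1E s s2.
  split; first exact: (near_eq_derivable E dl).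
  by rewrite -(near_eq_derive1 E).
have fg : future_geodesic g U s1.
  split; [exact: cU|exact: geo1|] => t t01; have t2 := ins t t01.
  have [c1t dt] := c1E t t2; split; first by rewrite -c1U.
  have sct := smooth_near_continuous (geodesic_smooth_near (geo1 t t01)).
  have [dd Ed] := dl t t2.
  apply: (future_velocityP sct ac1 dt dd).2; rewrite Ed.
  have [_ [h1 h2]] := Hr _ (small t t2).
  split; first by rewrite scaler_eq0 negb_or gt_eqF.
    by rewrite bformZl bformZr; apply: mulr_ge0_le0 (ltW tau0) _; apply: mulr_ge0_le0 (ltW tau0) (ltW h1).
  by rewrite bformZr pmulr_rlt0.
have z2 : `|0 : R| < 2 by rewrite normr0.
have z01 : 0 <= (0 : R) <= 1 by rewrite lexx ler01.
have s10 : s1 0 = q by rewrite /s1 scale0r -c1q (cmapK c1d).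
have sc1 := smooth_near_continuous (geodesic_smooth_near (geo1 0 z01)).
have [dd Ed] := dl 0 z2.
have cs1 : cdom c (s1 0) by rewrite s10.
have c1s1 : cdom c1 (s1 0) by rewrite s10.
have [dc Ec] := chart_change sc1 ac1 ac c1s1 cs1 dd.
rewrite Ed s10 -scalemxAl -E1 in Ec.
have czs : (c \o s1) 0 = z by rewrite /= s10.
have dF' : differentiable (f \o cinv c : vec -> R) ((c \o s1) 0) by rewrite czs.
have [dh Eh] := derive1_comp_diff dc dF'.
have nE : {near (0 : R), ((f \o cinv c) \o (c \o s1)) =1 f \o s1}.
  have : \forall s \near (0 : R), cdom c (s1 s) by exact: (sc1 _ (near_cdom cs1)).
  by apply: filterS => s h /=; rewrite (cmapK h).
have dfs : derivable (f \o s1) 0 1 := near_eq_derivable nE dh.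
have : 0 <= derive1 (f \o s1) 0.
  apply: (derive1_ge0_right ltr01 dfs) => s ps; rewrite add0r => s1'.
  exact/ltW/(future_geodesic_time f_time fg (lexx 0) ps (ltW s1')).
rewrite -(near_eq_derive1 nE) Eh Ec czs linearZ.
by rewrite pmulr_rge0.
Qed.

End speed_bound.

Section ball_mean_value.
Context (R : realType) (n : nat).
Local Notation vec := 'rV[R]_n.+1.

(* Balls of the sup norm are boxes, onto which coordinatewise truncation is a
   1-Lipschitz retraction. *)
Lemma lipschitz_ball_extension (F : vec -> R) (y0 : vec) (rho L : R) : 0 < rho -> 0 <= L ->
  (forall z z', `|z - y0| <= rho -> `|z' - y0| <= rho -> `|F z - F z'| <= L * `|z - z'|) ->
  exists F' : vec -> R, (forall x y, `|F' x - F' y| <= L * `|x - y|) /\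
    forall z, `|z - y0| <= rho -> F' z = F z.
Proof.
move=> rho0 L0 FL.
pose tr (a : R) := Num.max (- rho) (Num.min rho a).
have trI a : - rho <= tr a <= rho.
  by rewrite le_max lexx ge_max ge_min lexx/= andbT; lra.
have trL a b : `|tr a - tr b| <= `|a - b|.
  have maxL (w x y : R) : `|Num.max w x - Num.max w y| <= `|x - y|.
    have [h1|h1] := leP w x; have [h2|h2] := leP w y; rewrite ?subrr ?normr0//.
      by rewrite !ger0_norm ?subr_ge0//; lra.
    by rewrite !ler0_norm ?subr_le0//; lra.
  have minL (w x y : R) : `|Num.min w x - Num.min w y| <= `|x - y|.
    have [h1|h1] := leP w x; have [h2|h2] := leP w y; rewrite ?subrr ?normr0//.
      by rewrite !ger0_norm ?subr_ge0//; lra.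
    by rewrite !ler0_norm ?subr_le0//; lra.
  exact: le_trans (maxL _ _ _) (minL _ _ _).
pose cl (y : vec) : vec := \row_i (y0 0 i + tr (y 0 i - y0 0 i)).
have clI y : `|cl y - y0| <= rho.
  apply: rV_norm_le => [|i]; first exact: ltW.
  by rewrite !mxE addrC addKr ler_norml.
exists (F \o cl); split=> [x y|z zr] /=.
  apply: le_trans (FL _ _ (clI x) (clI y)) _; apply: ler_wpM2l => //.
  apply: rV_norm_le => // i; rewrite !mxE opprD addrACA subrr add0r.
  apply: le_trans (trL _ _) _; rewrite opprB addrA subrK.
  by have := rV_coord_le_norm (x - y) i; rewrite !mxE.
congr F; apply/rowP => i; rewrite mxE.
have := le_trans (rV_coord_le_norm (z - y0) i) zr; rewrite !mxE ler_norml => /andP[h1 h2].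
by rewrite /tr (min_idPr h2) (max_idPr h1); ring.
Qed.

(** [F] is Lipschitz only on the ball; its global extension has the same differentials in the
    interior. *)
Lemma ball_mean_value (F : vec -> R) (y0 v : vec) (rho L m : R) : 0 < rho -> 0 <= L ->
  (forall z z', `|z - y0| <= rho -> `|z' - y0| <= rho -> `|F z - F z'| <= L * `|z - z'|) ->
  `|v| < rho ->
  (forall z, `|z - y0| < rho -> differentiable F z -> m <= 'd F z v) ->
  m <= F (y0 + v) - F y0.
Proof.
move=> rho0 L0 FL vr Hm.
have [F' [F'L F'E]] := lipschitz_ball_extension rho0 L0 FL.
have h1 : `|y0 - y0| < rho by rewrite subrr normr0.
have h2 : `|y0 + v - y0| < rho by rewrite addrC addKr.
rewrite -(F'E _ (ltW h1)) -(F'E _ (ltW h2)).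
apply: (lipschitz_mean_value F'L h1 h2) => z zr dF'.
have nE : {near z, F =1 F'}.
  apply/nbhs_ballP; exists (rho - `|z - y0|) => /=; first by rewrite subr_gt0.
  move=> w; rewrite -ball_normE /= => zw; rewrite F'E//.
  rewrite -(subrK z w) -addrA; apply: le_trans (ler_normD _ _) _.
  by rewrite distrC -lerBrDr ltW.
have [dF dE] := diff_near_eq nE dF'.
by rewrite -(congr1 (fun h => h v) dE); exact: Hm.
Qed.

End ball_mean_value.

(** * Speed of curves parametrised by time *)

Section speed_le_inv.
Context (R : realType) (n : nat) (M : topologicalType).
Variable g : lorentzianManifold R n M.
Variable f : M -> R.
Hypothesis f_time : time_function g f.
Hypothesis f_lip : locally_lipschitz g f.
Variable b0 : R.
Hypothesis b0_gt0 : 0 < b0.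
Hypothesis f_grad : forall p, has_gradient g f p ->
  bform (metric g (chart_at g p) p) (gradient g f p) (gradient g f p) <= - b0 ^+ 2.
Local Notation vec := 'rV[R]_n.+1.
Local Notation mQ := (fun c p => - metric g c p).

(** A larger speed would make [f] grow by at least [m * s], with [m > 1], over the tangent increment
    [s *: u], while along the curve it changes by only [s]. The two end points differ by [o(s)] and
    [f] is Lipschitz, a contradiction. *)
Lemma speed_le_inv (beta : R -> M) t U d : {for t, continuous beta} -> 0 < d ->
  (forall s, `|s - t| < d -> f (beta s) = f (beta t) - (s - t)) ->
  convex_normal g U -> U (beta t) -> speed g mQ beta t <= b0^-1.
Proof.
move=> bc d0 fb cU Up; have b0p := b0_gt0.
have ib0 : 0 < b0^-1 by rewrite invr_gt0.
set p := beta t in Up fb *; set c := chart_at g p.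
have ac : atlas g c := chart_at_atlas g _; have cp : cdom c p := chart_at_dom g _.
pose x := (c \o beta : R -> vec).
have [dx|ndx] := pselect (derivable x t 1); last first.
  have -> : speed g mQ beta t = 0 by exact: (if_asboolF _ _ ndx).
  exact: ltW.
have -> : speed g mQ beta t = Num.sqrt (bform (- metric g c p) (derive1 x t) (derive1 x t)).
  exact: (if_asboolT _ _ dx).
set a := derive1 x t; rewrite bformN; set Q := - bform _ _ _.
rewrite leNgt; apply/negP => Qb.
have sQ0 : 0 < Num.sqrt Q by exact: lt_trans Qb.
have Q0 : 0 < Q by rewrite sqrtr_gt0 in sQ0.
have aa : bform (metric g c p) a a < 0 by rewrite -oppr_gt0.
have oa : bform (metric g c p) (orientation g c p) a != 0.
  apply/eqP => oa0; have oo := orientation_timelike ac cp.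
  have := lorentz_reverse_cs a (metric_signature ac cp) (ltW oo).
  rewrite oa0 expr0n/= => h.
  by have := nmulr_rgt0 (bform (metric g c p) a a) oo; rewrite aa ltNge h.
(* The time orientation of the velocity is not known here; the sign [ep] makes [u] future directed,
   and either sign leads to the contradiction. *)
have [ep [ep1 ou]] : exists ep : R, `|ep| = 1 /\
    bform (metric g c p) (orientation g c p) (ep *: a) < 0.
  have [h|h] := ltP (bform (metric g c p) (orientation g c p) a) 0.
    by exists 1; rewrite normr1 scale1r.
  exists (-1); rewrite normrN1 bformZr mulN1r oppr_lt0; split=> //.
  by rewrite lt_neqAle eq_sym oa.
set u := ep *: a in ou.
have ep2 : ep * ep = 1 by rewrite -expr2 -real_normK ?num_real// ep1 expr1n.
have uu : bform (metric g c p) u u = - Q by rewrite bformZl bformZr mulrA ep2 mul1r opprK.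
have bQ : 1 < b0 * Num.sqrt Q by rewrite -ltr_pdivrMl// mulr1.
pose m := (1 + b0 * Num.sqrt Q) / 2.
have m1 : 1 < m by rewrite /m; lra.
have m0 : 0 < m by exact: lt_trans m1.
have mQ2 : m ^+ 2 < b0 ^+ 2 * Q.
  rewrite -(sqr_sqrtr (ltW Q0)) -exprMn.
  have h1 : 0 <= b0 * Num.sqrt Q by apply: ltW; exact: lt_trans bQ.
  rewrite (ltr_sqr (ltW m0) h1) /m; lra.
have cG := sym_tensor_cvg (metric_tensor g) ac cp I.
have cO := orientation_cvg ac cp.
have FF : Filter (nbhs (c p)) := nbhs_filter _.
have cbu : (fun y => bform (metric g c (cinv c y)) u u) @ nbhs (c p) -->
    bform (metric g c p) u u.
  have cu : u @[_ --> nbhs (c p)] --> u by exact: cvg_cst.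
  exact: (@bform_cvg R n _ _ FF (fun y => metric g c (cinv c y)) _ (fun=> u) u u cG cu).
have cbo : (fun y => bform (metric g c (cinv c y)) (orientation g c (cinv c y)) u) @ nbhs (c p)
    --> bform (metric g c p) (orientation g c p) u.
  exact: (@bform_cvg R n _ _ FF (fun y => metric g c (cinv c y)) _
    (fun y => orientation g c (cinv c y)) _ u cG cO).
have n1 : \forall y \near c p, bform (metric g c (cinv c y)) u u < - (m ^+ 2 / b0 ^+ 2).
  apply: (cvgr_lt _ cbu); rewrite uu ltrN2 ltr_pdivrMr ?exprn_gt0// mulrC; exact: mQ2.
have n2 : \forall y \near c p, bform (metric g c (cinv c y)) (orientation g c (cinv c y)) u < 0.
  by apply: (cvgr_lt _ cbo); exact: ou.
have nU : \forall y \near c p, U (cinv c y).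
  have oU : open U by have [] := cU.
  exact: (cinv_continuous_at cp (open_nbhs_nbhs (conj oU Up))).
have [rho rho0 Hr] := near_closed_ball (filterI (near_cimg cp) (filterI nU (filterI n1 n2))).
pose F := (f \o cinv c : vec -> R).
have im z : `|z - c p| <= rho -> (c @` cdom c) z by move=> /Hr[].
have Ksub : [set q | cdom c q /\ `|c q - c p| <= rho] `<=` cdom c by move=> q [].
have [L0 HL] := f_lip ac Ksub (compact_chart_ball im).
pose L := `|L0| * n.+1%:R.
have L00 : 0 <= L by rewrite mulr_ge0.
have FL z z' : `|z - c p| <= rho -> `|z' - c p| <= rho -> `|F z - F z'| <= L * `|z - z'|.
  move=> zr zr'; have [E1 D1] := cinvK (im z zr); have [E2 D2] := cinvK (im z' zr').
  have k1 : [set q | cdom c q /\ `|c q - c p| <= rho] (cinv c z) by rewrite /= E1.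
  have k2 : [set q | cdom c q /\ `|c q - c p| <= rho] (cinv c z') by rewrite /= E2.
  apply: le_trans (HL _ _ k1 k2) _; rewrite E1 E2 /L -mulrA.
  apply: (@le_trans _ _ (`|L0| * enorm (z - z'))).
    by apply: ler_wpM2r; [exact: sqrtr_ge0|exact: ler_norm].
  by apply: ler_wpM2l => //; exact: enorm_le_norm.
have grad z : `|z - c p| < rho -> differentiable F z -> m <= 'd F z u.
  move=> zr dF; have [iz [Uz [h1 h2]]] := Hr z (ltW zr).
  have h3 : bform (metric g c (cinv c z)) u u < 0.
    by apply: lt_trans h1 _; rewrite oppr_lt0 divr_gt0// exprn_gt0.
  have dpos := chart_time_derivative f_time ac iz cU Uz dF h3 h2.
  have dbig := chart_gradient_bound f_grad ac iz dF (ltW h3).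
  rewrite -ler_sqr ?nnegrE ?(ltW m0)//; apply: le_trans dbig.
  rewrite mulrC -ler_pdivrMr ?exprn_gt0// lerNr; exact: ltW.
(* Makes [L * eta] at most half of the gap [m - 1]. *)
pose eta := (m - 1) / (2 * (L + 1)).
have L1 : 0 < 2 * (L + 1) by rewrite mulr_gt0// ltr_wpDl.
have eta0 : 0 < eta by rewrite divr_gt0// subr_gt0.
have Leta : L * eta <= (m - 1) / 2.
  have h : eta * (2 * (L + 1)) = m - 1 by rewrite divfK ?gt_eqF.
  by have := ltW eta0; lra.
have [d1 d10 Hd1] := derivable_increment dx eta0.
have [d2 /= d20 Hd2] : \forall s \near t, cdom c (beta s) by exact: (bc _ (near_cdom cp)).
have ne : 0 < `|u| + eta + 1 by rewrite addr_gt0// ltr_wpDl.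
pose s := Num.min (Num.min d d1) (Num.min d2 (rho / (`|u| + eta + 1))) / 2.
have mm : 0 < Num.min (Num.min d d1) (Num.min d2 (rho / (`|u| + eta + 1))).
  by rewrite !lt_min d0 d10 d20 divr_gt0.
have s0 : 0 < s by rewrite divr_gt0.
have : s < Num.min (Num.min d d1) (Num.min d2 (rho / (`|u| + eta + 1))).
  by rewrite /s ltr_pdivrMr// ltr_pMr// ltr1n.
rewrite !lt_min => /andP[/andP[sd sd1] /andP[sd2 srho]].
have srho' : s * (`|u| + eta + 1) < rho by rewrite -ltr_pdivlMr.
pose t' := t + ep * s.
have tt : t' - t = ep * s by rewrite /t' addrC addKr.
have tn : `|t' - t| = s by rewrite tt normrM ep1 mul1r gtr0_norm.
have ct' : cdom c (beta t') by apply: Hd2; rewrite /ball/= distrC tn.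
have su : `|s *: u| = s * `|u| by rewrite normrZ gtr0_norm.
have sur : `|s *: u| < rho.
  rewrite su; apply: le_lt_trans srho'; rewrite ler_pM2l// -addrA lerDl.
  by rewrite addr_ge0// ltW.
have low : m * s <= F (c p + s *: u) - F (c p).
  apply: (ball_mean_value rho0 L00 FL sur) => z zr dF.
  by rewrite linearZ /= [leRHS]mulrC ler_pM2r//; exact: grad.
have xinc : `|x t' - (c p + s *: u)| <= eta * s.
  have td1 : `|t' - t| < d1 by rewrite tn.
  have := Hd1 t' td1; rewrite tn tt -/a.
  rewrite (_ : x t' - x t - (ep * s) *: a = x t' - (c p + s *: u)) //.
  by rewrite opprD addrA /u scalerA (mulrC s).
have xr : `|x t' - c p| <= rho.
  rewrite -(subrK (c p + s *: u) (x t')) -addrA; apply: le_trans (ler_normD _ _) _.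
  have w1 : c p + s *: u - c p = s *: u by rewrite addrC addKr.
  rewrite w1 su; apply: le_trans (lerD xinc (lexx _)) _.
  by apply: le_trans (ltW srho'); rewrite mulrC -mulrDr ler_pM2l//; lra.
have cr : `|c p + s *: u - c p| <= rho by rewrite addrC addKr ltW.
have Fx : F (x t') = f p - ep * s.
  by rewrite /F /x /= (cmapK ct') fb ?tn// tt.
have Fp : F (c p) = f p by rewrite /F /= (cmapK cp).
have up := FL _ _ cr xr; rewrite distrC (distrC _ (x t')) in up.
have up2 : F (c p + s *: u) - F (x t') <= L * (eta * s).
  apply: le_trans (ler_norm _) _; rewrite distrC; apply: le_trans up _.
  exact: ler_wpM2l.
have eps : - ep <= 1 by apply: le_trans (ler_norm _) _; rewrite normrN ep1.
have eps' : - ep * s <= 1 * s by rewrite ler_pM2r.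
have Le : L * (eta * s) <= (m - 1) / 2 * s by rewrite mulrA ler_pM2r.
have ms : 0 < (m - 1) * s by rewrite mulr_gt0// subr_gt0.
move: low up2; rewrite Fx Fp; lra.
Qed.

End speed_le_inv.

(** * Parametrisation by the time function *)

Section time_parameter.
Context (R : realType) (n : nat) (M : topologicalType).
Variable g : lorentzianManifold R n M.
Variable f : M -> R.
Hypothesis f_time : time_function g f.
Local Notation vec := 'rV[R]_n.+1.
Local Notation leb := (@lebesgue_measure R).
Local Notation mQ := (fun c p => - metric g c p).

Lemma speed_near_eq (Q : chart R n M -> M -> 'M[R]_n.+1) (sigma sigma' : R -> M) t :
  {near t, sigma =1 sigma'} -> speed g Q sigma t = speed g Q sigma' t.
Proof.
move=> E; have E0 : sigma t = sigma' t := nbhs_singleton E.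
rewrite /speed /velocity E0; set c := chart_at g (sigma' t).
have Ec : {near t, (c \o sigma : R -> vec) =1 (c \o sigma' : R -> vec)}.
  by apply: filterS E => s /= ->.
have Ec' : {near t, (c \o sigma' : R -> vec) =1 (c \o sigma : R -> vec)}.
  by apply: filterS E => s /= ->.
have [d|d] := pselect (derivable (c \o sigma : R -> vec) t 1).
  have d' : derivable (c \o sigma' : R -> vec) t 1 := near_eq_derivable Ec d.
  apply: etrans (if_asboolT _ _ d) _; apply: etrans _ (esym (if_asboolT _ _ d')).
  by rewrite (near_eq_derive1 Ec).
have d' : ~ derivable (c \o sigma' : R -> vec) t 1.
  by move=> d'; apply: d; exact: near_eq_derivable Ec' d'.
exact: etrans (if_asboolF _ _ d) (esym (if_asboolF _ _ d')).
Qed.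

Variables (gam : R -> M) (b a : \bar R) (s : R -> R).
Hypothesis b_gt0 : (0 < b)%E.
Hypothesis gam_past : past_curve g (ray b) gam.
Hypothesis a_lim : (fun t => (f (gam 0) - f (gam t))%:E) @ at_end b --> a.
Hypothesis s_ray : forall t, ray a t -> ray b (s t).
Hypothesis s_param : forall t, ray a t -> f (gam (s t)) = f (gam 0) - t.

Lemma ray_sub (e : \bar R) u v t : ray e v -> 0 <= u -> u <= t <= v -> ray e t.
Proof.
move=> [v0 ve] u0 /andP[ut tv]; split; first exact: le_trans ut.
by apply: le_lt_trans ve; rewrite lee_fin.
Qed.

Lemma ray_right (e : \bar R) t d : 0 < d -> ray e t -> exists t', [/\ ray e t', t < t' & t' < t + d].
Proof.
move=> d0 [t0 te]; case: e te => [r| |] te.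
- move: te; rewrite lte_fin => tr.
  exists (t + Num.min d (r - t) / 2).
  have m0 : 0 < Num.min d (r - t) by rewrite lt_min d0 subr_gt0.
  have m1 : Num.min d (r - t) <= d by rewrite ge_min lexx.
  have m2 : Num.min d (r - t) <= r - t by rewrite ge_min lexx orbT.
  move: (Num.min d (r - t)) m0 m1 m2 => m m0 m1 m2.
  split; [split|lra|lra]; first by lra.
  by rewrite lte_fin; lra.
- by exists (t + d / 2); split; [split; [lra|exact: ltry]|lra|lra].
- by [].
Qed.

(** Elapsed time, which turns out to be the inverse of [s]. *)
Let psi t := f (gam 0) - f (gam t).

Lemma gam_decreasing u v : ray b u -> ray b v -> u < v -> f (gam v) < f (gam u).
Proof.
move=> [u0 ub] rv uv; have ch := past_curve_chain gam_past.
have sub : `[u, v] `<=` ray b.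
  by move=> z /=; rewrite in_itv/=; exact: ray_sub rv u0.
have := chain_time f_time uv (chain_sub sub ch).
by rewrite /height expr1 !mulN1r ltrN2.
Qed.

Lemma ray0 : ray b 0.
Proof. by split. Qed.

Lemma psi_mono u v : ray b u -> ray b v -> u < v -> psi u < psi v.
Proof. by move=> ru rv uv; rewrite /psi ltrD2l ltrN2; exact: gam_decreasing. Qed.

(** Elapsed time increases strictly, so its value at a later parameter, itself at most the limit
    [a], separates [psi t] from [a]. *)
Lemma psi_ray t : ray b t -> ray a (psi t).
Proof.
move=> rt; have [t' [rt' tt' _]] := ray_right ltr01 rt.
split.
  have [t0 _] := rt; move: t0; rewrite le_eqVlt => /predU1P[<-|t0].
    by rewrite /psi subrr.
  by have := psi_mono ray0 rt t0; rewrite {1}/psi subrr => /ltW.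
apply: (@lt_le_trans _ _ (psi t')%:E); first by rewrite lte_fin; exact: psi_mono.
have key z : ray b z -> t' < z -> ((psi t')%:E <= (f (gam 0) - f (gam z))%:E)%E.
  by move=> rz tz; rewrite lee_fin; apply/ltW/psi_mono.
have t'0 : 0 <= t' by have [] := rt'.
move: key rt' a_lim b_gt0; case: b => [r| |] //= key rt' al _.
- rewrite -(cvg_lim (@ereal_hausdorff R) al); apply: lime_ge; first exact: cvgP al.
  have [_ t'r] := rt'; rewrite lte_fin in t'r.
  near=> z; apply: key.
    split; last by rewrite lte_fin; near: z; exact: nbhs_left_lt.
    by apply: (le_trans t'0); near: z; exact: nbhs_left_ge.
  by near: z; exact: nbhs_left_gt.
- rewrite -(cvg_lim (@ereal_hausdorff R) al); apply: lime_ge; first exact: cvgP al.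
  near=> z; have tz : t' < z by near: z; exists t'; split; [exact: num_real|].
  by apply: key => //; split; [exact: ltW (le_lt_trans t'0 tz)|exact: ltry].
Unshelve. all: end_near. Qed.

Lemma f_inj u v : ray b u -> ray b v -> f (gam u) = f (gam v) -> u = v.
Proof.
move=> ru rv E; have [uv|vu|//] := ltgtP u v.
  by have := gam_decreasing ru rv uv; rewrite E ltxx.
by have := gam_decreasing rv ru vu; rewrite E ltxx.
Qed.

Lemma psiK t : ray b t -> s (psi t) = t.
Proof.
move=> rt; have ra := psi_ray rt; apply: f_inj; [exact: s_ray|exact: rt|].
by rewrite s_param// /psi opprB addrC subrK.
Qed.

Lemma sK t : ray a t -> psi (s t) = t.
Proof. by move=> ra; rewrite /psi s_param// opprB addrC subrK. Qed.

Lemma s_mono t t' : ray a t -> ray a t' -> t < t' -> s t < s t'.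
Proof.
move=> rt rt' tt'; rewrite ltNge le_eqVlt; apply/negP => /predU1P[E|h].
  by move: tt'; rewrite -(sK rt) -(sK rt') E ltxx.
have := psi_mono (s_ray rt') (s_ray rt) h; rewrite !sK// => h'.
by have := lt_trans tt' h'; rewrite ltxx.
Qed.

Lemma s_lt_psi t z : ray a t -> ray b z -> t < psi z -> s t < z.
Proof. by move=> rt rz tz; rewrite -(psiK rz); apply: s_mono => //; exact: psi_ray. Qed.

Lemma psi_lt_s t z : ray a t -> ray b z -> psi z < t -> z < s t.
Proof. by move=> rt rz tz; rewrite -(psiK rz); apply: s_mono => //; exact: psi_ray. Qed.

Lemma s_continuous : {within ray a, continuous s}.
Proof.
apply/within_continuousP => t W rt /nbhs_ballP[e /= e0 eW].
have [z [rz sz ze]] := ray_right e0 (s_ray rt).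
have tz : t < psi z by rewrite -{1}(sK rt); apply: psi_mono => //; exact: s_ray.
have [d1 d10 Hd1] : exists2 d, 0 < d & forall t', ray a t' -> t - d < t' -> s t - e < s t'.
  have [s0 sb] := s_ray rt.
  (* When [s t - e / 2] is negative the lower bound is free, because [s] takes nonnegative
     values. *)
  have [lt0|ge0] := ltP (s t - e / 2) 0.
    exists 1 => // t' rt' _; have [s0' _] := s_ray rt'; lra.
  have rl : ray b (s t - e / 2).
    by apply: (ray_sub (s_ray rt) (lexx 0)); rewrite ge0/= lerBlDr lerDl divr_ge0// ltW.
  have lt : psi (s t - e / 2) < t.
    rewrite -[ltRHS](sK rt); apply: psi_mono; [exact: rl|exact: s_ray|].
    by rewrite ltrBlDr ltrDl divr_gt0.
  exists (t - psi (s t - e / 2)); first by rewrite subr_gt0.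
  move=> t' rt'; rewrite opprB addrC subrK => h.
  by have := psi_lt_s rt' rl h; lra.
exists (Num.min d1 (psi z - t)); first by rewrite lt_min d10 subr_gt0.
move=> t' rt'; rewrite lt_min !ltr_norml => /andP[/andP[h1 _] /andP[_ h2]].
apply: eW; rewrite /ball/= ltr_norml.
have k1 : s t - e < s t' by apply: Hd1 => //; lra.
have k2 : s t' < z by apply: s_lt_psi => //; lra.
by apply/andP; split; lra.
Qed.

Let beta := gam \o s.

Lemma beta_chain : chain g true (ray a) beta.
Proof.
have [gc gch] := past_curve_chain gam_past; split.
  exact: within_comp gc s_continuous s_ray.
move=> t rt; have [d d0 Hd] := gch (s t) (s_ray rt).
have /within_continuousP sc := s_continuous.
have [d' d'0 Hd'] := sc t (ball (s t) d) rt (nbhsx_ballx _ _ d0).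
exists d' => // u v ru rv ud vd uv; apply: Hd.
- exact: s_ray.
- exact: s_ray.
- by rewrite distrC; exact: Hd'.
- by rewrite distrC; exact: Hd'.
- exact: s_mono.
Qed.

Lemma beta_time u v : ray a u -> ray a v -> f (beta u) - f (beta v) = v - u.
Proof. by move=> ru rv; rewrite /beta /= !s_param//; ring. Qed.

Lemma psi_continuous : {within ray b, continuous psi}.
Proof.
have [/within_continuousP gc _] := past_curve_chain gam_past.
apply/within_continuousP => t W rt /nbhs_ballP[e /= e0 eW].
have fc : {for gam t, continuous f} by have [fc _] := f_time; exact: fc.
have nf : nbhs (gam t) [set q | `|f (gam t) - f q| < e].
  by have /cvgrPdist_lt := fc; apply.
have [d d0 Hd] := gc t _ rt nf; exists d => // z rz zd; apply: eW.
have := Hd z rz zd; rewrite /ball/= /psi.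
rewrite (_ : f (gam 0) - f (gam t) - (f (gam 0) - f (gam z)) = - (f (gam t) - f (gam z))) ?normrN//.
by ring.
Qed.

(** A reparametrisation [phi] of [gam] becomes [psi \o phi] for [beta]. The composite curves agree
    on the parameter interval only, so their speeds are compared away from its endpoints. *)
Lemma length_le_time_parameter u v : ray b u -> ray b v ->
  (lorentz_length g gam u v <= lorentz_length g beta (psi u) (psi v))%E.
Proof.
move=> ru rv; apply: ge_ereal_sup => _ [phi [u' [v' [[u'v' phu phv phc phm] lip ->]]]].
have phI t : `[u', v']%classic t -> `[u, v]%classic (phi t).
  rewrite /= !in_itv/= => /andP[t1 t2].
  have mono z z' : u' <= z -> z <= z' -> z' <= v' -> phi z <= phi z'.
    move=> us; rewrite le_eqVlt => /predU1P[->//|ss'] s'v; apply/ltW/phm => //.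
      by rewrite in_itv/= us (le_trans (ltW ss')).
    by rewrite in_itv/= s'v (le_trans us (ltW ss')).
  by rewrite -{1}phu -{1}phv !mono.
have phr t : `[u', v']%classic t -> ray b (phi t).
  by move=> /phI; rewrite /= in_itv/=; have [u0 _] := ru; exact: ray_sub rv u0.
have bE t : `[u', v']%classic t -> (beta \o (psi \o phi)) t = (gam \o phi) t.
  by move=> tI; rewrite /beta /= psiK//; exact: phr.
apply: (@le_trans _ _ (\int[leb]_(t in `[u', v']) (speed g mQ (beta \o (psi \o phi)) t)%:E)%E).
  apply: ae_ge0_le_integral_fun; [exact: measurable_itv| | |].
  - by move=> t; rewrite lee_fin speed_ge0.
  - by move=> t; rewrite lee_fin speed_ge0.
  apply: ae_imply (ae_and (ae_neq u') (ae_neq v')) => t [tu tv] /=.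
  rewrite in_itv/= => /andP[ut tv']; rewrite lee_fin le_eqVlt; apply/orP; left; apply/eqP.
  have ut' : u' < t by rewrite lt_neqAle eq_sym tu.
  have tv2 : t < v' by rewrite lt_neqAle tv.
  apply: speed_near_eq; exists (Num.min (t - u') (v' - t)) => /=; first by rewrite lt_min !subr_gt0 ut'.
  move=> z; rewrite /ball/= lt_min !ltr_norml => /andP[/andP[h1 h2] /andP[h3 h4]].
  by rewrite [RHS]bE//= in_itv/=; apply/andP; split; lra.
apply: ereal_sup_ubound; exists (psi \o phi), u', v'; split; [|  |by []].
  split; [exact: u'v'|by rewrite /= phu|by rewrite /= phv| |].
    exact: within_comp psi_continuous phc phr.
  by move=> z z' zI z'I zz'; apply: psi_mono; [exact: phr|exact: phr|exact: phm].
move=> t It; have [c [N [K [ac nN cN lN]]]] := lip t It.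
exists c, N, K; split; [exact: ac|exact: nN| |].
  by move=> z Nz Iz; rewrite bE//; exact: cN.
by move=> z z' Nz Iz Nz' Iz'; rewrite !bE//; exact: lN.
Qed.

Lemma length_on_le_time_parameter :
  (lorentz_length_on g (ray b) gam <= lorentz_length_on g (ray a) beta)%E.
Proof.
apply: ge_ereal_sup => _ [u [v [ru rv uv ->]]].
apply: le_trans (length_le_time_parameter ru rv) _; apply: ereal_sup_ubound.
exists (psi u), (psi v); split; [exact: psi_ray|exact: psi_ray|exact: psi_mono|by []].
Qed.

Lemma null_distance_refl p : (null_distance g f p p <= 0)%E.
Proof.
apply: ereal_inf_lbound; exists (fun=> p), 0%N, (fun=> 0); split => //.
  by split=> //; apply: continuous_subspaceT => x; exact: cst_continuous.
by rewrite /null_length big_ord0.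
Qed.

Hypothesis f_al : locally_anti_lipschitz g f.

(** The curve is the limit of a constant sequence at null distance zero, so the statements about
    limit curves hold for it as well. *)
Lemma beta_local_limit T : ray a T -> local_limit g f T (fun=> beta) beta.
Proof.
move=> rT.
have sub : `[0, T] `<=` ray a.
  by move=> z /=; rewrite in_itv/=; exact: ray_sub rT (lexx 0).
have ch := chain_sub sub beta_chain.
apply: (local_limit_of_chains f_time f_al).
- apply: nearW => k; split; first exact: ch.
  by move=> u v uT vT; apply: beta_time; apply: sub; rewrite /= in_itv.
- move=> eps eps0; apply: nearW => k t _; apply: le_lt_trans (null_distance_refl _) _.
  by rewrite lte_fin.
- exact: ch.1.
Qed.

Hypothesis f_lip : locally_lipschitz g f.
Variable b0 : R.
Hypothesis b0_gt0 : 0 < b0.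
Hypothesis f_grad : forall p, has_gradient g f p ->
  bform (metric g (chart_at g p) p) (gradient g f p) (gradient g f p) <= - b0 ^+ 2.

Lemma beta_speed_le T t : ray a T -> 0 < t -> t < T -> speed g mQ beta t <= b0^-1.
Proof.
move=> rT t0 tT.
have rt : ray a t by apply: (ray_sub rT (lexx 0)); rewrite !ltW.
have [_ dc] := gam_past; have [N [U [_ cU Ut _ _]]] := dc (s t) (s_ray rt).
have sub : `[0, T] `<=` ray a.
  by move=> z /=; rewrite in_itv/=; exact: ray_sub rT (lexx 0).
have bc : {for t, continuous beta}.
  exact: within_interior (chain_sub sub beta_chain).1 t0 tT.
have d0 : 0 < Num.min t (T - t) by rewrite lt_min t0 subr_gt0.
apply: (speed_le_inv f_time f_lip b0_gt0 f_grad bc d0 _ cU Ut) => z.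
rewrite lt_min !ltr_norml => /andP[/andP[h1 h2] /andP[h3 h4]].
have rz : ray a z by apply: (ray_sub rT (lexx 0)); apply/andP; split; lra.
by have := beta_time rt rz; lra.
Qed.

Lemma beta_speed_integral_le u v : 0 <= u -> u <= v -> ray a v ->
  (\int[leb]_(t in `[u, v]) (speed g mQ beta t)%:E <= ((v - u) / b0)%:E)%E.
Proof.
move=> u0 uv rv; have ib : 0 < b0^-1 by rewrite invr_gt0.
pose h := fun t : R => 0 + t *: b0^-1.
have -> : (v - u) / b0 = h v - h u by rewrite /h !add0r -scalerBl.
apply: ge0_integral_le_increment => //.
- by move=> z z' _ zz' _; rewrite /h lerD2l ler_pM2r.
- by move=> t; exact: speed_ge0.
apply: aeW => t /andP[ut tv]; right.
have [dl El] := line_derivable 0 b0^-1 t; split; first exact: dl.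
rewrite El; exact: beta_speed_le rv (le_lt_trans u0 ut) tv.
Qed.

(** The interval is enlarged to [[0, T]], with [T] the larger of [v] and [t]; beyond [t] the speed
    is at most [1 / b0] and the duration at most [al - t]. *)
Lemma beta_length_split u v t (al : R) : ray a u -> ray a v -> u < v -> ray a t ->
  (a <= al%:E)%E ->
  (lorentz_length g beta u v <= lorentz_length g beta 0%R t + ((al - t) / b0)%:E)%E.
Proof.
move=> [u0 ua] rv uv rt aal; pose T := Num.max v t.
have [t0 ta] := rt; have [v0 va] := rv.
have rT : ray a T by rewrite /T; case: leP.
have vT : v <= T by rewrite le_max lexx.
have tT : t <= T by rewrite le_max lexx orbT.
have ll := beta_local_limit rT.
have sp0 x : (0 <= (speed g mQ beta x)%:E)%E by rewrite lee_fin speed_ge0.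
apply: le_trans (length_le_speed ll u0 uv vT) _.
apply: (@le_trans _ _ (\int[leb]_(x in `[0%R, T]) (speed g mQ beta x)%:E)%E).
  rewrite (@ge0_integral_itv_split _ _ 0 u T u0 (le_trans (ltW uv) vT))//.
  rewrite (@ge0_integral_itv_split _ _ u v T (ltW uv) vT)//.
  by rewrite addeCA leeDl// adde_ge0// integral_ge0.
rewrite (@ge0_integral_itv_split _ _ 0 t T t0 tT)//; apply: leeD.
  exact: speed_le_length ll (lexx 0) t0 tT.
apply: le_trans (beta_speed_integral_le t0 tT rT) _; rewrite lee_fin ler_pM2r ?invr_gt0//.
rewrite lerD2r; have [_ Ta] := rT.
by rewrite -lee_fin; exact: le_trans (ltW Ta) aal.
Qed.

Lemma beta_length_on_le t (al : R) : ray a t -> (a <= al%:E)%E ->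
  (lorentz_length_on g (ray a) beta <= lorentz_length g beta 0%R t + ((al - t) / b0)%:E)%E.
Proof.
by move=> rt aal; apply: ge_ereal_sup => _ [u [v [ru rv uv ->]]]; exact: beta_length_split.
Qed.

End time_parameter.

(** * Upper and lower limits, and the inequality for the limit curve *)

Section limits_of_lengths.
Context (R : realType).

Lemma limn_esup_lt_near (u : nat -> \bar R) y : (limn_esup u < y)%E ->
  \forall k \near \oo, (u k <= y)%E.
Proof.
move=> /ereal_inf_lt[_ [V nV <-] Vy].
apply: filterS nV => k Vk; apply: le_trans (ltW Vy).
by apply: ereal_sup_ubound; exists k.
Qed.

Lemma near_limn_esup_le (u v : nat -> \bar R) : (\forall k \near \oo, (u k <= v k)%E) ->
  (limn_esup u <= limn_esup v)%E.
Proof.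
move=> uv; apply: le_ereal_inf_tmp => _ [V nV <-].
apply: (@le_trans _ _ (ereal_sup (u @` (V `&` [set k | (u k <= v k)%E])))).
  by apply: ereal_inf_lbound; exists (V `&` [set k | (u k <= v k)%E]) => //; exact: filterI.
apply: ge_ereal_sup => _ [k [Vk uvk] <-]; apply: le_trans uvk _.
by apply: ereal_sup_ubound; exists k.
Qed.

Lemma near_limn_einf_le (u v : nat -> \bar R) : (\forall k \near \oo, (u k <= v k)%E) ->
  (limn_einf u <= limn_einf v)%E.
Proof.
move=> uv; rewrite /limn_einf leeN2; apply: near_limn_esup_le.
by apply: filterS uv => k; rewrite leeN2.
Qed.

Lemma cvg_of_limn (u : nat -> \bar R) l : (limn_esup u <= l)%E -> (l <= limn_einf u)%E ->
  u @ \oo --> l.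
Proof.
move=> ul lu.
have E1 : limn_esup u = l by apply/eqP; rewrite eq_le ul (le_trans lu (limn_einf_sup u)).
have E2 : limn_einf u = l by apply/eqP; rewrite eq_le lu (le_trans (limn_einf_sup u) ul).
apply: (@squeeze_cvge _ _ _ _ (einfs u) _ (esups u)).
- apply: nearW => k; apply/andP; split.
    by apply: ereal_inf_lbound; exists k => /=.
  by apply: ereal_sup_ubound; exists k => /=.
- by rewrite -E2 limn_einf_lim; exact: is_cvg_einfs.
- by rewrite -E1 limn_esup_lim; exact: is_cvg_esups.
Qed.

End limits_of_lengths.

Theorem theorem4p4 (R : realType) (n : nat) (M : topologicalType)
  (g : lorentzianManifold R n M)
  (f : M -> R)
  (f_time : time_function g f)
  (f_lip : locally_lipschitz g f)
  (f_antilip : locally_anti_lipschitz g f)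
  (b0 : R) (b0_gt0 : 0 < b0)
  (f_grad : forall p, has_gradient g f p ->
     bform (metric g (chart_at g p) p) (gradient g f p) (gradient g f p)
       <= - b0 ^+ 2)
  (x : M)
  (gam : nat -> R -> M) (b : nat -> \bar R)
  (b_gt0 : forall i, (0 < b i)%E)
  (gam_past : forall i, past_curve g (ray (b i)) (gam i))
  (gam_inext : forall i, inextendible (b i) (gam i))
  (gam_x : (fun i => gam i 0) @ \oo --> x)
  (a : nat -> \bar R)
  (a_lim : forall i,
     (fun t => (f (gam i 0) - f (gam i t))%:E) @ at_end (b i) --> a i)
  (s : nat -> R -> R)
  (s_ray : forall i t, ray (a i) t -> ray (b i) (s i t))
  (s_param : forall i t, ray (a i) t ->
     f (gam i (s i t)) = f (gam i 0) - t)
  (gamma : R -> M) (a0 : \bar R)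
  (a0_gt0 : (0 < a0)%E)
  (ik : nat -> nat)
  (ik_incr : {homo ik : k l / (k < l)%N})
  (gamma_cont : {within ray a0, continuous gamma})
  (gamma_0 : gamma 0 = x)
  (a0_le : (a0 <= limn_esup (fun k => a (ik k)))%E)
  (gamma_lim : converges_uniformly_on_compacta (null_distance g f)
     (fun k => gam (ik k) \o s (ik k)) (fun k => a (ik k)) x gamma a0)
  (L_bounded : exists C : R, forall k,
     (lorentz_length_on g (ray (a (ik k))) (gam (ik k) \o s (ik k)) <= C%:E)%E)
  (a_bounded : exists C : R, forall k, (a (ik k) <= C%:E)%E)
  (a_limsup : limn_esup (fun k => a (ik k)) = a0) :
  (exists2 kj : nat -> nat, {homo kj : j l / (j < l)%N} &
     (limn_esup (fun j =>
        lorentz_length_on g (ray (b (ik (kj j)))) (gam (ik (kj j))))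
      <= lorentz_length_on g (ray a0) gamma)%E) /\
  ((forall t, ray a0 t ->
      (fun k => lorentz_length g (gam (ik k) \o s (ik k)) 0 t) @ \oo
        --> lorentz_length g gamma 0 t) ->
   (fun k => lorentz_length_on g (ray (a (ik k))) (gam (ik k) \o s (ik k))) @ \oo
     --> lorentz_length_on g (ray a0) gamma).
Proof.
have [Ca HCa] := a_bounded.
(* The common bound on the [a (ik k)] makes their upper limit a real number. *)
have [al alE] : exists al : R, a0 = al%:E.
  have a0C : (a0 <= Ca%:E)%E.
    by rewrite -a_limsup; apply: limn_esup_le; exact: nearW.
  move: a0_gt0 a0C; case: (a0) => [r| |] // _ _; by exists r.
have al0 : 0 < al by move: a0_gt0; rewrite alE lte_fin.
pose B k := gam (ik k) \o s (ik k).
have [_ _ conv] := gamma_lim.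
have chB k : chain g true (ray (a (ik k))) (B k).
  exact: (beta_chain f_time (b_gt0 (ik k)) (gam_past (ik k)) (a_lim (ik k)) (s_ray (ik k)) (s_param (ik k))).
have ll T : ray a0 T -> local_limit g f T B gamma.
  move=> [T0 Ta]; have [n1 n2] := conv T T0 Ta.
  have sub0 : `[0, T] `<=` ray a0.
    by move=> z /=; rewrite in_itv/=; exact: (@ray_sub _ a0 0 T z (conj T0 Ta) (lexx 0)).
  apply: (local_limit_of_chains f_time f_antilip).
  - apply: filterS n1 => k Tk.
    have sub : `[0, T] `<=` ray (a (ik k)).
      by move=> z /=; rewrite in_itv/=; exact: (@ray_sub _ _ 0 T z (conj T0 Tk) (lexx 0)).
    split; first exact: chain_sub sub (chB k).
    move=> u v uT vT; have ru : ray (a (ik k)) u by apply: sub; rewrite /= in_itv.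
    have rv : ray (a (ik k)) v by apply: sub; rewrite /= in_itv.
    exact: (@beta_time R M f (gam (ik k)) (a (ik k)) (s (ik k)) (s_param (ik k)) u v ru rv).
  - exact: n2.
  - exact: continuous_subspaceW sub0 gamma_cont.
pose Lk k := lorentz_length_on g (ray (a (ik k))) (B k).
pose La := lorentz_length_on g (ray a0) gamma.
have upper (e : R) : 0 < e -> \forall k \near \oo, (Lk k <= La + e%:E)%E.
  (* [al / 2] keeps [t] positive, and [e * b0 / 4] makes the tail, of duration at most [2 * eta],
     cost at most [e / 2]; the other [e / 2] is the semicontinuity error on [[0, t]]. *)
  move=> e0; pose eta := Num.min (al / 2) (e * b0 / 4).
  have eta0 : 0 < eta by rewrite lt_min !divr_gt0// mulr_gt0.
  have eta1 : eta <= al / 2 by rewrite ge_min lexx.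
  have eta2 : eta <= e * b0 / 4 by rewrite ge_min lexx orbT.
  move: eta eta0 eta1 eta2 => eta eta0 eta1 eta2.
  pose t := al - eta.
  have t0 : 0 < t by rewrite /t; lra.
  have tal : t < al by rewrite /t; lra.
  have rt : ray a0 t by split; [exact: ltW|rewrite alE lte_fin].
  have E0 : 0 < e / (2 * al) by rewrite divr_gt0// mulr_gt0.
  have usc := limit_usc (ll t rt) (lexx 0) t0 (lexx t) E0.
  have [nt _] := conv t (ltW t0) rt.2.
  (* Here the upper limit of the [a (ik k)] enters: eventually the curves end by [al + eta]. *)
  have na : \forall k \near \oo, (a (ik k) <= (al + eta)%:E)%E.
    by apply: limn_esup_lt_near; rewrite a_limsup alE lte_fin ltrDl.
  apply: filterS (filterI usc (filterI nt na)) => k [h1 [h2 h3]].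
  have rtk : ray (a (ik k)) t by split; [exact: ltW|].
  have h4 := beta_length_on_le f_time (b_gt0 (ik k)) (gam_past (ik k)) (a_lim (ik k)) (s_ray (ik k)) (s_param (ik k))
    f_antilip f_lip b0_gt0 f_grad rtk h3.
  apply: le_trans h4 _; apply: le_trans (leeD h1 (lexx _)) _; rewrite -addeA; apply: leeD.
    apply: le_trans (speed_le_length (ll t rt) (lexx 0) (ltW t0) (lexx t)) _.
    have r0 : ray a0 0 by split; [exact: lexx|rewrite alE lte_fin].
    by apply: ereal_sup_ubound; exists 0, t.
  rewrite -EFinD lee_fin subr0.
  have k1 : e / (2 * al) * t <= e / 2.
    have -> : e / 2 = e / (2 * al) * al by field; rewrite gt_eqF.
    by rewrite ler_pM2l//; exact: ltW.
  have k2 : (al + eta - t) / b0 <= e / 2.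
    rewrite ler_pdivrMr// /t; lra.
  lra.
have limsup : (limn_esup Lk <= La)%E.
  by apply/lee_addgt0Pr => e e0; apply: limn_esup_le; exact: upper.
split.
  exists id; first by move=> j l.
  apply: le_trans limsup; apply: near_limn_esup_le; apply: nearW => k.
  exact: (length_on_le_time_parameter f_time (b_gt0 (ik k)) (gam_past (ik k)) (a_lim (ik k)) (s_ray (ik k)) (s_param (ik k))).
move=> cvgL; apply: cvg_of_limn; first exact: limsup.
(* A piece of the limit curve is enlarged to [[0, v]], where the assumed convergence makes its
   length a limit of lengths bounded by those of the whole curves. *)
apply: ge_ereal_sup => _ [u [v [ru rv uv ->]]].
have [u0 _] := ru; have [v0 va] := rv; have vpos : 0 < v by exact: le_lt_trans uv.
have llv := ll v rv.
have sp0 x0 : (0 <= (speed g (fun c p => - metric g c p) gamma x0)%:E)%E.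
  by rewrite lee_fin speed_ge0.
apply: (@le_trans _ _ (lorentz_length g gamma 0 v)).
  apply: le_trans (length_le_speed llv u0 uv (lexx v)) _.
  apply: le_trans (speed_le_length llv (lexx 0) (ltW vpos) (lexx v)).
  rewrite [leRHS](@ge0_integral_itv_split _ _ 0 u v u0 (ltW uv))//.
  by rewrite leeDr// integral_ge0.
have [<- _] := cvg_limn_einf_sup (cvgL v rv).
apply: near_limn_einf_le; have [nv _] := conv v v0 va.
apply: filterS nv => k vk.
have r0 : ray (a (ik k)) 0 by split; [exact: lexx|apply: lt_trans vk; rewrite lte_fin].
have rvk : ray (a (ik k)) v by [].
by apply: ereal_sup_ubound; exists 0, v.
Qed.
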